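(* Let $(E,h)$ be an acceptable vector bundle on $\Delta^*$. Then the determinant bundle $(\det E,\det h)$ is an acceptable line bundle on $\Delta^*$, and $$\det({}_aE)={}_{\gamma({}_aE)}\det E$$ holds for every $a\in\mathbb{R}$.
   Context: $\Delta=\{z\in\mathbb{C}: |z|<1\}$, $\Delta^*=\Delta\setminus\{0\}$, $j\colon\Delta^*\hookrightarrow\Delta$. The Poincaré metric on $\Delta^*$ is $\omega_P=\frac{\sqrt{-1}\,dz\wedge d\bar z}{|z|^2(-\log|z|^2)^2}$. A holomorphic vector bundle $E$ on $\Delta^*$ with a smooth Hermitian metric $h$ is acceptable if there is $C>0$ with $|\Theta_h(E)|_{h,\omega_P}\le C$ on $\Delta^*$, where $\Theta_h(E)$ is the Chern curvature and $|\cdot|_{h,\omega_P}$ is the pointwise norm induced by $h$ and $\omega_P$ (for $\Theta_h(E)=R\,dz\wedge d\bar z$ it equals $|z|^2(-\log|z|^2)^2|R|_h$). For $a\in\mathbb{R}$, ${}_aE$ is the sheaf of $\mathcal{O}_\Delta$-modules defined for open $U\subset\Delta$ by ${}_aE(U)=\{f\in E(U\setminus\{0\}) : |f|_h=O(|z|^{-(a+\varepsilon)})\text{ for every }\varepsilon>0\}$ (a growth condition as $z\to0$, vacuous if $0\notin U$). It is known that ${}_aE$ is a holomorphic vector bundle on $\Delta$ of rank $r=\operatorname{rank}E$. Define $\gamma({}_aE):=-\frac12\liminf_{z\to0}\frac{\log\det H(h,\bm v)}{\log|z|}$, where $\bm v=\{v_1,\ldots,v_r\}$ is any local frame of ${}_aE$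 near $0$ and $H(h,\bm v)=(h(v_i,v_j))_{i,j}$; this is a finite real number independent of $\bm v$. The sheaf ${}_b\det E$ is defined using the induced metric $\det h$. Both sides of the equality are regarded as subsheaves of $j_*\det E$. *)

(* Defs.v *)
From HB Require Import structures.
From mathcomp Require Import all_boot all_order all_algebra.
From mathcomp Require Import all_classical all_reals all_analysis.
From mathcomp Require Import complex.
Import numFieldNormedType.Exports.

Set Implicit Arguments.
Unset Strict Implicit.
Unset Printing Implicit Defensive.

Import Order.TTheory GRing.Theory Num.Theory.
Local Open Scope classical_set_scope.
Local Open Scope complex_scope.
Local Open Scope sesquilinear_scope.
Local Open Scope ring_scope.

Section Plane.
Variable R : realType.
(* The regular module R[i]^o is the copy of R[i] on which MathComp-Analysis
   puts the norm topology and complex differentiation. *)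
Local Notation C := R[i].

Definition cabs (z : C) : R := Normc.normc z.

Definition disc : set C := [set z | cabs z < 1].
Definition pdisc : set C := disc `\ 0.

Definition copen (U : set C) : Prop := open (U : set R[i]^o).

Definition near0 : set_system C := dnbhs (0 : R[i]^o).

Definition holo (V : set C) (f : C -> C) : Prop :=
  forall z, V z -> derivable (f : R[i]^o -> R[i]^o) z 1.

(* Real directional derivatives, for the real structure of the plane. *)
Definition rline (u : C -> R) (z v : C) (t : R) : R := u (z + t%:C * v).
Definition rder (v : C) (u : C -> R) (z : C) : R := derive1 (rline u z v) 0.

Fixpoint Ck (n : nat) (U : set C) (u : C -> R) : Prop :=
  (forall z, U z -> {for z, continuous (u : R[i]^o -> R)}) /\
  if n is m.+1 then
    [/\ forall z, U z ->
          derivable (rline u z 1) 0 1 /\ derivable (rline u z 'i%C) 0 1,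
        Ck m U (rder 1 u)
      & Ck m U (rder 'i%C u)]
  else True.

Definition smooth (U : set C) (f : C -> C) : Prop :=
  forall n, Ck n U (fun z => complex.Re (f z)) /\
            Ck n U (fun z => complex.Im (f z)).

Definition cder (v : C) (f : C -> C) (z : C) : C :=
  rder v (fun w => complex.Re (f w)) z +i* rder v (fun w => complex.Im (f w)) z.

(* Wirtinger derivatives d/dz and d/d(zbar). *)
Definition dz (f : C -> C) (z : C) : C := (cder 1 f z - 'i%C * cder 'i%C f z) / 2%:R.
Definition dzbar (f : C -> C) (z : C) : C :=
  (cder 1 f z + 'i%C * cder 'i%C f z) / 2%:R.

Definition dz_mx m n (A : C -> 'M[C]_(m, n)) (z : C) : 'M[C]_(m, n) :=
  \matrix_(k, l) dz (fun w => A w k l) z.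
Definition dzbar_mx m n (A : C -> 'M[C]_(m, n)) (z : C) : 'M[C]_(m, n) :=
  \matrix_(k, l) dzbar (fun w => A w k l) z.

End Plane.

Arguments disc {R}.
Arguments pdisc {R}.
Arguments near0 {R}.

Section Bundles.
Variable R : realType.
Local Notation C := R[i].

(* A holomorphic vector bundle of rank r on the punctured disc, presented by
   trivialising open sets and transition matrices.  Vectors are rows of
   coordinates: coordinates xi_i, xi_j of one vector over chart i and chart j
   satisfy xi_j = xi_i *m trans i j.  The data have a meaning only on the
   relevant chart domains. *)
Record bundle (r : nat) := Bundle {
  chart : Type;
  dom : chart -> set C;
  trans : chart -> chart -> C -> 'M[C]_r }.

Arguments dom {r} _ _ _.
Arguments trans {r} _ _ _ _.

Definition holomorphic_bundle r (E : bundle r) : Prop :=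
  [/\ forall i, copen (dom E i),
      \bigcup_(i in setT) dom E i = pdisc,
      forall i j k l,
        holo (dom E i `&` dom E j) (fun z => trans E i j z k l),
      forall i z, dom E i z -> trans E i i z = 1%:M
    & forall i j k z, dom E i z -> dom E j z -> dom E k z ->
        trans E i j z *m trans E j k z = trans E i k z].

(* [m i z] is the Gram matrix of the frame of chart [i]:
   h(xi, eta) = xi *m m i z *m eta^t*. *)
Definition metric r (E : bundle r) := chart E -> C -> 'M[C]_r.

Definition hermitian_metric r (E : bundle r) (h : metric E) : Prop :=
  [/\ forall i k l, smooth (dom E i) (fun z => h i z k l),
      forall i z, dom E i z -> (h i z)^t* = h i z,
      forall i z (xi : 'rV[C]_r), dom E i z -> xi != 0 ->
        0 < (xi *m h i z *m xi^t*) 0 0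
    & forall i j z, dom E i z -> dom E j z ->
        h i z = trans E i j z *m h j z *m (trans E i j z)^t*].

(* In row convention the Chern connection matrix is (dH/dz) H^-1 dz, hence
   Theta = dbar((dH/dz) H^-1 dz) = R dz /\ dzbar with the following R, which
   acts on rows by right multiplication. *)
Definition curvature r (E : bundle r) (h : metric E) (i : chart E) (z : C)
    : 'M[C]_r :=
  - dzbar_mx (fun w => dz_mx (h i) w *m invmx (h i w)) z.

(* Norm induced on End(E): |A|^2 = tr(A A^dagger), where the adjoint of A for
   the Hermitian form H is H A^t* H^-1 in row convention. *)
Definition end_norm r (H A : 'M[C]_r) : R :=
  Num.sqrt (complex.Re (\tr (A *m (H *m A^t* *m invmx H)))).

Definition acceptable r (E : bundle r) (h : metric E) : Prop :=
  [/\ holomorphic_bundle E, hermitian_metric h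
    & exists2 M : R, 0 < M & forall i z, dom E i z ->
        cabs z ^+ 2 * (- ln (cabs z ^+ 2)) ^+ 2
          * end_norm (h i z) (curvature h i z) <= M].

Definition local_data r (E : bundle r) := chart E -> C -> 'rV[C]_r.

Definition section r (E : bundle r) (V : set C) (s : local_data E) : Prop :=
  (forall i k, holo (V `&` dom E i) (fun z => s i z 0 k)) /\
  (forall i j z, V z -> dom E i z -> dom E j z ->
     s j z = s i z *m trans E i j z).

Definition eq_on r (E : bundle r) (V : set C) (s t : local_data E) : Prop :=
  forall i z, V z -> dom E i z -> s i z = t i z.

Definition lincomb r (E : bundle r) n (c : 'I_n -> C -> C)
    (v : 'I_n -> local_data E) : local_data E :=
  fun i z => \sum_(k < n) c k z *: v k i z.

(* h(s, t) at z, computed in any chart around z. *)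
Definition hprod r (E : bundle r) (h : metric E) (s t : local_data E) (z : C)
    : C :=
  xget 0 [set c | exists2 i, dom E i z
                  & c = (s i z *m h i z *m (t i z)^t*) 0 0].

Definition hnorm r (E : bundle r) (h : metric E) (s : local_data E) (z : C)
    : R := Num.sqrt (complex.Re (hprod h s s z)).

(* The sections over U of the sheaf _aE, as a subsheaf of j_*E. *)
Definition prolong r (E : bundle r) (h : metric E) (a : R) (U : set C)
    (s : local_data E) : Prop :=
  section (U `\ 0) s /\
  (U 0 -> forall e : R, 0 < e -> exists M : R,
     \forall z \near near0, hnorm h s z <= M * cabs z `^ (- (a + e))).

(* v is a frame of the O-module _aE over the neighbourhood U of 0. *)
Definition local_frame r (E : bundle r) (h : metric E) (a : R) (U : set C)
    (v : 'I_r -> local_data E) : Prop :=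
  [/\ copen U /\ U `<=` disc, U 0, forall k, prolong h a U (v k)
    & forall V, copen V -> V `<=` U ->
      (forall s, prolong h a V s ->
         exists2 c : 'I_r -> C -> C, forall k, holo V (c k)
           & eq_on (V `\ 0) s (lincomb c v)) /\
      (forall c : 'I_r -> C -> C, (forall k, holo V (c k)) ->
         eq_on (V `\ 0) (lincomb c v) (fun _ _ => 0) ->
         forall k z, V z -> c k z = 0)].

Definition gram r (E : bundle r) (h : metric E) (v : 'I_r -> local_data E)
    (z : C) : 'M[C]_r := \matrix_(k, l) hprod h (v k) (v l) z.

Definition gamma r (E : bundle r) (h : metric E) (v : 'I_r -> local_data E)
    : R :=
  fine ((- 2%:R^-1)%:E * limf_einf
    (fun z : R[i]^o => (ln (complex.Re (\det (gram h v z))) / ln (cabs z))%:E) near0)%E.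

Definition det_bundle r (E : bundle r) : bundle 1 :=
  @Bundle 1 (chart E) (dom E) (fun i j z => (\det (trans E i j z))%:M).

Definition det_metric r (E : bundle r) (h : metric E) : metric (det_bundle E) :=
  fun i z => (\det (h i z))%:M.

(* v_1 /\ ... /\ v_r as a section of det E. *)
Definition wedge r (E : bundle r) (v : 'I_r -> local_data E)
    : local_data (det_bundle E) :=
  fun i z => (\det (\matrix_(k < r) v k i z))%:M.

(* The sections over U of det(_aE), the image sheaf of the r-th exterior power
   of _aE in j_* det E: locally a finite O-linear combination of products
   v_1 /\ ... /\ v_r of sections of _aE. *)
Definition det_prolong r (E : bundle r) (h : metric E) (a : R) (U : set C)
    (s : local_data (det_bundle E)) : Prop :=
  section (U `\ 0) s /\
  forall p, U p -> exists2 V : set C, [/\ copen V, V p & V `<=` U] &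
    exists n (c : 'I_n -> C -> C) (v : 'I_n -> 'I_r -> local_data E),
      [/\ forall k, holo V (c k),
          forall k l, prolong h a V (v k l)
        & eq_on (V `\ 0) s (lincomb c (fun k => wedge (v k)))].

End Bundles.

(* Main.v *)
Require Import Defs.
From HB Require Import structures.
From mathcomp Require Import all_boot all_order all_algebra.
From mathcomp Require Import all_classical all_reals all_analysis.
From mathcomp Require Import complex.
From mathcomp Require Import perm ring lra.
Import numFieldNormedType.Exports.
Import Order.TTheory GRing.Theory Num.Theory.
Local Open Scope classical_set_scope.
Local Open Scope complex_scope.
Local Open Scope sesquilinear_scope.
Local Open Scope ring_scope.

Set Implicit Arguments.
Unset Strict Implicit.
Unset Printing Implicit Defensive.

(* Let v be a frame of _aE near 0 and phi = log det H(h, v), the logarithm of the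
   squared norm of w = v_1 /\ ... /\ v_r.  In a chart phi is log |W|^2 + log det H_i
   with W holomorphic and nowhere zero outside 0, so acceptability bounds its
   Laplacian on both sides by a multiple of the Poincare density, and the growth of
   the v_k gives phi <= N (-log |z|).

   For every such phi the quotient phi / log |z| has a limit at 0, not only a lower
   limit.  Let Phi_n(z) be the sum of phi over the n rotations of z by n-th roots of
   unity.  The maximum principle on annuli gives on each small circle a point with
   Phi_n >= - n K (-log |z|); comparing Phi_n with its mirror image in a sector of
   angle pi / n shows that Phi_n oscillates on a circle by at most
   2 n (M + 1) + 8 n S e^(- n d / 2), where S bounds |phi| on the annulus of
   logarithmic half-width d around it.  A suitable n depending on the circle yields
   |phi| = O(log^2 |z|), after which n = 1 bounds the oscillation of phi on circles,
   and the maximum principle between two circles turns the upper limit of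
   phi / (-log |z|) into a limit.

   Hence |w|_h = |z|^(- gamma + o(1)), and s = f w satisfies the growth condition of
   _gamma det E if and only if |f| = |z|^(- o(1)), that is, f extends
   holomorphically through 0.

   The determinant of h is acceptable because its curvature is the trace of the
   curvature of E (Jacobi's formula), and |tr A| <= r |A|_h. *)

(** * Analysis on the complex plane *)

(** The definition of gamma bounds |w|_h only from above, by |z|^(- gamma - e), which already yields
    the inclusion of det(_aE) in _gamma det E. The reverse inclusion divides by w and needs the
    matching lower bound, while no lower growth bound on phi is known at the start; this obstacle
    shapes the proof. The oscillation estimate on a circle contains the unknown bound S of |phi|.
    With n = 1 its factor depends only on the width d, and where d is small the term in S cannot be
    absorbed; summing over n rotations multiplies the exponent by n and makes absorption possible.

    The curvature costs nothing in the limit: the Poincare density has the potential - log(- log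
    |z|^2), which is o(log |z|), and adding M + 1 times it makes a Laplacian bounded below by - M
    times the density positive. Laplacian bounds enter only through comparison with moduli of
    holomorphic functions, a form stable under sums, rotations, squaring and conjugation. Thus the
    maximum modulus principle, obtained from Cauchy's theorem on rectangles, replaces integral means
    and potential theory. *)

Section ComplexPlane.
Variable R : realType.
Local Notation C := R[i].
Local Notation Co := (R[i]^o).

Lemma normC_cabs (z : C) : `|z| = (cabs z)%:C.
Proof. by case: z. Qed.

Lemma cabs_ge0 (z : C) : 0 <= cabs z.
Proof. by rewrite -lecR -normC_cabs normr_ge0. Qed.

Lemma cabs0 : cabs (0 : C) = 0.
Proof. by apply: (@complexI R); rewrite -normC_cabs normr0. Qed.

Lemma cabs1 : cabs (1 : C) = 1.
Proof. by apply: (@complexI R); rewrite -normC_cabs normr1. Qed.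

Lemma cabsM (z w : C) : cabs (z * w) = cabs z * cabs w.
Proof. exact: Normc.normcM. Qed.

Lemma cabsV (z : C) : cabs z^-1 = (cabs z)^-1.
Proof. exact: Normc.normcV. Qed.

Lemma cabsX (z : C) n : cabs (z ^+ n) = cabs z ^+ n.
Proof. by elim: n => [|n IH]; rewrite ?expr0 ?cabs1// !exprS cabsM IH. Qed.

Lemma cabsN (z : C) : cabs (- z) = cabs z.
Proof. exact: normcN. Qed.

Lemma cabsD (z w : C) : cabs (z + w) <= cabs z + cabs w.
Proof. exact: le_normcD. Qed.

Lemma cabsB (z w : C) : cabs (z - w) <= cabs z + cabs w.
Proof. by rewrite -(cabsN w); exact: cabsD. Qed.

Lemma cabs_distC (z w : C) : cabs (z - w) = cabs (w - z).
Proof. by rewrite -cabsN opprB. Qed.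

Lemma cabs_eq0 (z : C) : (cabs z == 0) = (z == 0).
Proof.
by apply/eqP/eqP => [|->]; [exact: Normc.eq0_normc|exact: cabs0].
Qed.

Lemma cabs_gt0 (z : C) : (0 < cabs z) = (z != 0).
Proof. by rewrite lt_def cabs_eq0 cabs_ge0 andbT. Qed.

Lemma cabs_real (x : R) : cabs (x%:C) = `|x|.
Proof. by rewrite /cabs /= expr0n /= addr0 sqrtr_sqr. Qed.

Lemma sqr_cabs (z : C) : cabs z ^+ 2 = complex.Re z ^+ 2 + complex.Im z ^+ 2.
Proof. by case: z => x y; rewrite /cabs /= sqr_sqrtr// addr_ge0 ?sqr_ge0. Qed.

Lemma normRe_le (z : C) : `|complex.Re z| <= cabs z.
Proof. by rewrite -lecR -normC_cabs normc_ge_Re. Qed.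

Lemma normIm_le (z : C) : `|complex.Im z| <= cabs z.
Proof.
rewrite -ler_sqr ?nnegrE ?cabs_ge0// sqr_cabs real_normK ?num_real//.
by rewrite lerDr sqr_ge0.
Qed.

Lemma Re_le_cabs (z : C) : complex.Re z <= cabs z.
Proof. exact: le_trans (ler_norm _) (normRe_le z). Qed.

Lemma cabs_le (z : C) : cabs z <= `|complex.Re z| + `|complex.Im z|.
Proof.
rewrite -ler_sqr ?nnegrE ?cabs_ge0 ?addr_ge0// sqr_cabs.
rewrite sqrrD !real_normK ?num_real//.
by rewrite -addrA lerD2l lerDr mulrn_wge0// mulr_ge0.
Qed.

Lemma ler_cabsB (z w : C) : cabs z - cabs w <= cabs (z - w).
Proof. by rewrite lerBlDr; apply: le_trans (cabsD _ _); rewrite subrK. Qed.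

Lemma ReD (z w : C) : complex.Re (z + w) = complex.Re z + complex.Re w.
Proof. by case: z w => [? ?] [? ?]. Qed.
Lemma ImD (z w : C) : complex.Im (z + w) = complex.Im z + complex.Im w.
Proof. by case: z w => [? ?] [? ?]. Qed.
Lemma ReN (z : C) : complex.Re (- z) = - complex.Re z.
Proof. by case: z. Qed.
Lemma ImN (z : C) : complex.Im (- z) = - complex.Im z.
Proof. by case: z. Qed.
Lemma ReM (z w : C) : complex.Re (z * w) =
  complex.Re z * complex.Re w - complex.Im z * complex.Im w.
Proof. by case: z w => [? ?] [? ?]. Qed.
Lemma ImM (z w : C) : complex.Im (z * w) =
  complex.Re z * complex.Im w + complex.Im z * complex.Re w.
Proof. by case: z w => [? ?] [? ?]. Qed.

Lemma eqC (z w : C) : complex.Re z = complex.Re w ->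
  complex.Im z = complex.Im w -> z = w.
Proof. by case: z w => [? ?] [? ?] /= -> ->. Qed.

(** The norm of [Co] takes values in [C], so radii of balls are complex numbers, positive only when
    real. Passing to real radii here keeps all later estimates in [R]. *)
Lemma nbhsC (z : Co) (P : set C) :
  nbhs z P <-> exists2 e : R, 0 < e & forall w, cabs (w - z) < e -> P w.
Proof.
split.
  move=> /nbhs_ballP[e /= e0 zP]; exists (complex.Re e).
    by move: e0; rewrite ltcE /= => /andP[].
  move=> w wz; apply: zP; rewrite -ball_normE /= distrC normC_cabs.
  move: e0; rewrite !ltcE /= => /andP[-> _]; exact: wz.
move=> [e e0 zP]; apply/nbhs_ballP; exists e%:C => /=; first by rewrite ltcR.
move=> w; rewrite -ball_normE /= distrC normC_cabs ltcR; exact: zP.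
Qed.

Lemma dnbhsC (z : Co) (P : set C) : dnbhs z P <->
  exists2 e : R, 0 < e & forall w, w != z -> cabs (w - z) < e -> P w.
Proof.
change (nbhs z (fun w => w != z -> P w) <->
  exists2 e : R, 0 < e & forall w, w != z -> cabs (w - z) < e -> P w).
split=> [/nbhsC[e e0 zP]|[e e0 zP]]; first by exists e => // w; move=> ? /zP; exact.
by apply/nbhsC; exists e => // w we wz; exact: zP.
Qed.

Lemma continuousRP (u : C -> R) (z : C) :
  {for z, continuous (u : Co -> R)} <-> forall e : R, 0 < e ->
    exists2 d : R, 0 < d & forall w, cabs (w - z) < d -> `|u w - u z| < e.
Proof.
split=> [uz e e0|uz].
  have /(@cvgrPdist_lt R R Co (nbhs (z : Co)) _ u (u z)) := uz.
  move=> /(_ e e0) /nbhsC[d d0 dP]; exists d => // w /dP.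
  by rewrite distrC.
apply/(@cvgrPdist_lt R R Co (nbhs (z : Co)) _ u (u z)) => e e0.
have [d d0 dP] := uz e e0; apply/nbhsC; exists d => // w /dP.
by rewrite distrC.
Qed.

Lemma continuous_Re (z : Co) : {for z, continuous (@complex.Re R : Co -> R)}.
Proof.
apply/continuousRP => e e0; exists e => // w wz.
by rewrite -ReN -ReD (le_lt_trans (normRe_le _)).
Qed.

Lemma continuous_Im (z : Co) : {for z, continuous (@complex.Im R : Co -> R)}.
Proof.
apply/continuousRP => e e0; exists e => // w wz.
by rewrite -ImN -ImD (le_lt_trans (normIm_le _)).
Qed.

Lemma continuous_cabs (z : Co) : {for z, continuous (@cabs R : Co -> R)}.
Proof.
apply/continuousRP => e e0; exists e => // w wz; apply: le_lt_trans wz.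
by rewrite ler_norml ler_cabsB lerNl opprB cabs_distC ler_cabsB.
Qed.

Lemma continuousCP (T : topologicalType) (f : T -> Co) (x : T) :
  {for x, continuous f} <->
  forall e : R, 0 < e -> \forall y \near x, cabs (f y - f x) < e.
Proof.
split=> [fx e e0|fx].
  have h : nbhs (f x : Co) [set w | cabs (w - f x) < e] by apply/nbhsC; exists e.
  exact: (fx _ h).
move=> A /nbhsC[e e0 eA]; have := fx _ e0; apply: filterS => y; exact: eA.
Qed.

(** Complex differentiability with real error bounds, multiplied out so that [h = 0] needs no
    exception. *)
Definition cdiff (f : C -> C) (z : C) : Prop := exists l : C, forall e : R, 0 < e ->
  exists2 d : R, 0 < d & forall h, cabs h < d ->
    cabs (f (z + h) - f z - l * h) <= e * cabs h.

Lemma cdiffP (f : C -> C) (z : C) : derivable (f : Co -> Co) z 1 <-> cdiff f z.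
Proof.
split.
  move=> /cvg_ex[l /cvgrPdist_lt fl]; exists l => e e0.
  have /fl /dnbhsC[d d0 dP] : 0 < e%:C by rewrite ltcR.
  exists d => // h hd; have [h0|h0] := eqVneq h (0 : C); first by rewrite h0 addr0 mulr0 !subrr cabs0 mulr0.
  have := dP h h0; rewrite subr0 => /(_ hd).
  rewrite /= normC_cabs ltcR => hle.
  have -> : f (z + h) - f z - l * h =
      - (l - h^-1 * (f (h * 1 + z) - f z)) * h.
    rewrite mulr1 (addrC h z); field; exact: h0.
  by rewrite cabsM cabsN ler_wpM2r ?cabs_ge0// ltW.
move=> [l fl]; apply/cvg_ex; exists (l : Co); apply/cvgrPdist_lt => -[e ey].
rewrite ltcE /= => /andP[/eqP -> e0].
have [|d d0 dP] := fl (e / 2); first by rewrite divr_gt0.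
apply/dnbhsC; exists d => // h h0; rewrite subr0 => /dP hle.
rewrite complexr0 normC_cabs ltcR.
have -> : l - h^-1 *: ((f \o shift z) (h *: (1:Co)) - f z) =
      - (f (z + h) - f z - l * h) / h :> C.
  by rewrite /= /GRing.scale /= mulr1 (addrC h z); field; exact: h0.
rewrite cabsM cabsN cabsV ltr_pdivrMr ?cabs_gt0//.
apply: (le_lt_trans hle); rewrite ltr_pM2r ?cabs_gt0//.
by rewrite ltr_pdivrMr// ltr_pMr// ltr1n.
Qed.


(** The one-constructor wrapper keeps continuity from being unfolded to an inclusion of filters
    during unification. *)
Variant ccont (f : C -> C) (z : C) : Prop :=
  Ccont of {for (z : Co), continuous (f : Co -> Co)}.
Implicit Types f g : C -> C.

Lemma ccontP f z : ccont f z <-> forall e : R, 0 < e ->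
  exists2 d : R, 0 < d & forall w, cabs (w - z) < d -> cabs (f w - f z) < e.
Proof.
split=> [[/continuousCP fz] e /fz /nbhsC//|fz]; split.
by apply/continuousCP => e /fz ?; apply/nbhsC.
Qed.

Lemma ccont_cst (c : C) z : ccont (fun=> c) z.
Proof. by split; exact: (@cst_continuous Co Co c z). Qed.

Lemma ccont_id z : ccont (fun w => w) z.
Proof. by split; exact: (@cvg_id _ (nbhs (z : Co))). Qed.

Lemma ccontD f g z : ccont f z -> ccont g z -> ccont (fun w => f w + g w) z.
Proof. by move=> [fz] [gz]; split; exact: (@continuousD _ Co Co f g z fz gz). Qed.

Lemma ccontM f g z : ccont f z -> ccont g z -> ccont (fun w => f w * g w) z.
Proof. by move=> [fz] [gz]; split; exact: (@continuousM _ Co f g z fz gz). Qed.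

Lemma ccontV f z : f z != 0 -> ccont f z -> ccont (fun w => (f w)^-1) z.
Proof. by move=> fz0 [fz]; split; exact: (@continuousV _ Co f z fz0 fz). Qed.

Lemma cdiff_cont f z : cdiff f z -> ccont f z.
Proof.
by move=> /cdiffP /derivable1_diffP fz; split; exact: differentiable_continuous.
Qed.

Variant rcont (u : C -> R) (z : C) : Prop :=
  Rcont of {for (z : Co), continuous (u : Co -> R)}.
Implicit Types u v : C -> R.

Lemma rcontP u z : rcont u z <-> forall e : R, 0 < e ->
  exists2 d : R, 0 < d & forall w, cabs (w - z) < d -> `|u w - u z| < e.
Proof. by split=> [[/continuousRP//]|uz]; split; apply/continuousRP. Qed.

Lemma rcont_cst (k : R) z : rcont (fun=> k) z.
Proof. by split; exact: (@cst_continuous Co R k z). Qed.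

Lemma rcontD u v z : rcont u z -> rcont v z -> rcont (fun w => u w + v w) z.
Proof. by move=> [uz] [vz]; split; exact: (@continuousD _ R Co u v z uz vz). Qed.

Lemma rcontM u v z : rcont u z -> rcont v z -> rcont (fun w => u w * v w) z.
Proof. by move=> [uz] [vz]; split; exact: (@continuousM R Co u v z uz vz). Qed.

Lemma rcontN u z : rcont u z -> rcont (fun w => - u w) z.
Proof. by move=> [uz]; split; exact: (@continuousN _ R Co u z uz). Qed.

Lemma rcont_comp (b : R -> R) u z : rcont u z -> {for u z, continuous b} ->
  rcont (fun w => b (u w)) z.
Proof. by move=> [uz] bu; split; exact: (@continuous_comp Co R R u b z uz bu). Qed.

Lemma rcont_ccomp u g z : ccont g z -> rcont u (g z) -> rcont (fun w => u (g w)) z.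
Proof. by move=> [gz] [ug]; split; exact: (@continuous_comp Co Co R g u z gz ug). Qed.

Lemma rcont_Re z : rcont (@complex.Re R) z.
Proof. by split; exact: continuous_Re. Qed.

Lemma rcont_Im z : rcont (@complex.Im R) z.
Proof. by split; exact: continuous_Im. Qed.

Lemma rcont_cabs z : rcont (@cabs R) z.
Proof. by split; exact: continuous_cabs. Qed.

Lemma rcont_gt u (z : C) (k : R) : rcont u z -> k < u z ->
  \forall w \near (z : Co), k < u w.
Proof.
by move=> [uz]; exact: (@cvgr_gt R Co (nbhs (z : Co)) _ _ _ uz k).
Qed.

Lemma rcont_near u v (z : C) : (\forall w \near (z : Co), u w = v w) ->
  rcont u z -> rcont v z.
Proof.
move=> uv /rcontP uz; apply/rcontP => e /uz[d d0 dP].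
have /nbhsC[r r0 rP] := uv; exists (Num.min d r); first by rewrite lt_min d0.
move=> w; rewrite lt_min => /andP[wd wr].
by rewrite -!rP ?subrr ?cabs0//; exact: dP.
Qed.

Lemma rcont_sum n (u : 'I_n -> C -> R) z : (forall i, rcont (u i) z) ->
  rcont (fun w => \sum_(i < n) u i w) z.
Proof.
elim: n u => [|n IH] u uc.
  by apply: (@rcont_near (fun=> 0)); [apply: filterE => w; rewrite big_ord0|exact: rcont_cst].
apply: (@rcont_near (fun w => \sum_(i < n) u (widen_ord (leqnSn n) i) w + u ord_max w)).
  by apply: filterE => w; rewrite big_ord_recr.
by apply: rcontD => //; exact: IH.
Qed.

Lemma cdiff_cst (c : C) z : cdiff (fun=> c) z.
Proof. by apply/cdiffP; exact: (@derivable_cst _ Co Co c z 1). Qed.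

Lemma cdiff_id z : cdiff (fun w => w) z.
Proof. by apply/cdiffP; exact: (@derivable_id _ Co z 1). Qed.

Lemma cdiffD f g z : cdiff f z -> cdiff g z -> cdiff (fun w => f w + g w) z.
Proof.
by move=> /cdiffP fz /cdiffP gz; apply/cdiffP; exact: (@derivableD _ Co Co f g z 1 fz gz).
Qed.

Lemma cdiffM f g z : cdiff f z -> cdiff g z -> cdiff (fun w => f w * g w) z.
Proof.
by move=> /cdiffP fz /cdiffP gz; apply/cdiffP; exact: (@derivableM _ Co f g z 1 fz gz).
Qed.

Lemma cdiffV f z : f z != 0 -> cdiff f z -> cdiff (fun w => (f w)^-1) z.
Proof.
by move=> fz0 /cdiffP fz; apply/cdiffP; exact: (@derivableV _ Co f z 1 fz0 fz).
Qed.

Lemma cdiff_comp f g z : cdiff g z -> cdiff f (g z) -> cdiff (fun w => f (g w)) z.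
Proof.
move=> /cdiffP/derivable1_diffP gz /cdiffP/derivable1_diffP fz.
apply/cdiffP/derivable1_diffP.
exact: (@differentiable_comp _ Co Co Co g f z gz fz).
Qed.

Lemma cdiff_near f g (z : Co) : (\forall w \near z, f w = g w) ->
  cdiff f z -> cdiff g z.
Proof.
move=> fg /cdiffP fz; apply/cdiffP; exact: (@near_eq_derivable _ Co Co f g z 1 fg fz).
Qed.

Lemma cdiffN f z : cdiff f z -> cdiff (fun w => - f w) z.
Proof. by move=> /cdiffP fz; apply/cdiffP; exact: (@derivableN _ Co Co f z 1 fz). Qed.

Lemma cdiffB (f g : C -> C) z : cdiff f z -> cdiff g z -> cdiff (fun w => f w - g w) z.
Proof. by move=> fz gz; exact: (cdiffD fz (cdiffN gz)). Qed.

Lemma cdiffX (f : C -> C) n z : cdiff f z -> cdiff (fun w => f w ^+ n) z.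
Proof.
move=> fz; elim: n => [|n IH]; first exact: cdiff_cst.
have -> : (fun w => f w ^+ n.+1) = (fun w => f w * f w ^+ n) by apply/funext => w; rewrite exprS.
exact: (cdiffM fz IH).
Qed.

Lemma cdiff_sum (I : Type) (s : seq I) (P : pred I) (f : I -> C -> C) z :
  (forall i, P i -> cdiff (f i) z) -> cdiff (fun w => \sum_(i <- s | P i) f i w) z.
Proof.
move=> fz; elim: s => [|i s IH].
  by under eq_fun do rewrite big_nil; exact: cdiff_cst.
have -> : (fun w => \sum_(j <- i :: s | P j) f j w) = (fun w =>
    if P i then f i w + \sum_(j <- s | P j) f j w else \sum_(j <- s | P j) f j w).
  by apply/funext => w; rewrite big_cons.
case: (boolP (P i)) => Pi; last exact: IH.
exact: (cdiffD (fz i Pi) IH).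
Qed.

Lemma cdiff_prod (I : Type) (s : seq I) (P : pred I) (f : I -> C -> C) z :
  (forall i, P i -> cdiff (f i) z) -> cdiff (fun w => \prod_(i <- s | P i) f i w) z.
Proof.
move=> fz; elim: s => [|i s IH].
  by under eq_fun do rewrite big_nil; exact: cdiff_cst.
have -> : (fun w => \prod_(j <- i :: s | P j) f j w) = (fun w =>
    if P i then f i w * \prod_(j <- s | P j) f j w else \prod_(j <- s | P j) f j w).
  by apply/funext => w; rewrite big_cons.
case: (boolP (P i)) => Pi; last exact: IH.
exact: (cdiffM (fz i Pi) IH).
Qed.

End ComplexPlane.

Ltac cplx := apply: eqC; rewrite ?(ReM, ImM, ReD, ImD, ReN, ImN) /=; ring.

(** * Cauchy's theorem on rectangles *)

Section Integral.
Variable R : realType.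
Local Notation C := R[i].
Local Notation Co := (R[i]^o).
Local Notation mu := (@lebesgue_measure R).

Definition cint (a b : R) (g : R -> C) : C :=
  (\int[mu]_(x in `[a, b]) complex.Re (g x)) +i*
  (\int[mu]_(x in `[a, b]) complex.Im (g x)).

Definition cont_seg (a b : R) (g : R -> C) : Prop :=
  forall x, a <= x <= b -> {for x, continuous (g : R -> Co)}.

Lemma cont_seg_integrable a b g : cont_seg a b g ->
  mu.-integrable `[a, b] (EFin \o (fun x => complex.Re (g x))) /\
  mu.-integrable `[a, b] (EFin \o (fun x => complex.Im (g x))).
Proof.
move=> gc; split; apply: continuous_compact_integrable;
  try exact: segment_compact; apply: continuous_in_subspaceT => x;
  rewrite inE /= in_itv /= => /gc gx.
- have := @continuous_comp _ Co R (g : R -> Co) (@complex.Re R : Co -> R) x.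
  by apply => //; exact: continuous_Re.
- have := @continuous_comp _ Co R (g : R -> Co) (@complex.Im R : Co -> R) x.
  by apply => //; exact: continuous_Im.
Qed.

Lemma eq_cint a b f g : (forall x, a <= x <= b -> f x = g x) ->
  cint a b f = cint a b g.
Proof.
move=> fg; rewrite /cint.
by congr (_ +i* _); apply: eq_Rintegral => x; rewrite inE /= in_itv /= => /fg ->.
Qed.

Lemma cintD a b f g : cont_seg a b f -> cont_seg a b g ->
  cint a b (fun x => f x + g x) = cint a b f + cint a b g.
Proof.
move=> /cont_seg_integrable[fr fi] /cont_seg_integrable[gr gi].
rewrite /cint /GRing.add /=; congr (_ +i* _); rewrite -RintegralD//.
- by apply: eq_Rintegral => x _; rewrite ReD.
- by apply: eq_Rintegral => x _; rewrite ImD.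
Qed.

Lemma cintZ a b (c : C) f : cont_seg a b f ->
  cint a b (fun x => c * f x) = c * cint a b f.
Proof.
move=> fc; have [fr fi] := cont_seg_integrable fc.
apply/eqP; rewrite eq_complex ReM ImM /cint /=.
apply/andP; split; apply/eqP; rewrite -!RintegralZl//.
- rewrite -RintegralB//.
  + by apply: eq_Rintegral => x _; rewrite ReM.
  + exact: (integrableZl _ _ fr).
  + exact: (integrableZl _ _ fi).
- rewrite -RintegralD//.
  + by apply: eq_Rintegral => x _; rewrite ImM.
  + exact: (integrableZl _ _ fi).
  + exact: (integrableZl _ _ fr).
Qed.

Lemma cint_cst a b (c : C) : a <= b -> cint a b (fun=> c) = c * (b - a)%:C.
Proof.
move=> ab; apply/eqP; rewrite eq_complex ReM ImM /= !mulr0 subr0 add0r.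
rewrite !Rintegral_cst//= lebesgue_measure_itv /= lte_fin.
case: (ltrP a b) => [|ba] /=; first by rewrite !eqxx.
by have -> : b = a; [apply/eqP; rewrite eq_le ab ba|rewrite subrr !eqxx].
Qed.

Lemma cint_chasles a m b f : a <= m -> m <= b -> cont_seg a b f ->
  cint a b f = cint a m f + cint m b f.
Proof.
move=> am mb /cont_seg_integrable[fr fi].
rewrite /cint /GRing.add /=; congr (_ +i* _); apply/eqP; rewrite addrC -subr_eq.
- rewrite Rintegral_itvB ?bnd_simp// Rintegral_itv_obnd_cbnd//.
  by apply: integrableS fr => //; apply: subset_itvr; rewrite bnd_simp.
- rewrite Rintegral_itvB ?bnd_simp// Rintegral_itv_obnd_cbnd//.
  by apply: integrableS fi => //; apply: subset_itvr; rewrite bnd_simp.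
Qed.

Lemma Rintegral_le a b (u : R -> R) M : a <= b ->
  mu.-integrable `[a, b] (EFin \o u) ->
  (forall x, a <= x <= b -> `|u x| <= M) ->
  `|\int[mu]_(x in `[a, b]) u x| <= M * (b - a).
Proof.
move=> ab ui uM; apply: le_trans (le_normr_Rintegral _ _) _ => //.
have -> : M * (b - a) = \int[mu]_(x in `[a, b]) M.
  rewrite Rintegral_cst//= lebesgue_measure_itv /= lte_fin.
  case: (ltrP a b) => //= ba.
  by have -> : b = a; [apply/eqP; rewrite eq_le ab ba|rewrite subrr].
apply: le_Rintegral => //.
- exact: integrable_norm.
- apply: continuous_compact_integrable; first exact: segment_compact.
  by move=> x; exact: cst_continuous.
Qed.

(** The factor 2 comes from estimating real and imaginary parts separately; the later arguments
    tolerate any constant factor. *)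
Lemma cabs_cint a b f M : a <= b -> cont_seg a b f ->
  (forall x, a <= x <= b -> cabs (f x) <= M) ->
  cabs (cint a b f) <= 2 * M * (b - a).
Proof.
move=> ab /cont_seg_integrable[fr fi] fM.
apply: le_trans (cabs_le _) _; rewrite -mulrA mulr_natl mulr2n /=.
apply: lerD; apply: Rintegral_le => // x /fM; apply: le_trans.
- exact: normRe_le.
- exact: normIm_le.
Qed.

End Integral.

(** * Induction on rectangles by bisection *)

Section Bisection.
Variable R : realType.


(** A rectangle where [P] fails has a quarter where it fails; the nested failing rectangles shrink
    to a point, and there the local hypothesis is contradicted. *)
Lemma rect_induction (P : R -> R -> R -> R -> Prop) (a0 b0 c0 d0 : R) :
  a0 <= b0 -> c0 <= d0 ->
  (forall a b c d, a <= b -> c <= d ->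
    P a ((a + b) / 2) c ((c + d) / 2) -> P ((a + b) / 2) b c ((c + d) / 2) ->
    P a ((a + b) / 2) ((c + d) / 2) d -> P ((a + b) / 2) b ((c + d) / 2) d ->
    P a b c d) ->
  (forall x y, a0 <= x <= b0 -> c0 <= y <= d0 -> exists2 e, 0 < e &
    forall a b c d, a0 <= a -> b <= b0 -> c0 <= c -> d <= d0 ->
      a <= x <= b -> c <= y <= d -> (b - a) + (d - c) < e -> P a b c d) ->
  P a0 b0 c0 d0.
Proof.
move=> ab0 cd0 quarter loc; apply: contrapT => nP0.
(* The side lengths at stage [n] are fixed in advance, so only the lower left corner has to be
   chosen. *)
pose w n := (b0 - a0) / 2 ^+ n; pose h n := (d0 - c0) / 2 ^+ n.
have w_ge0 n : 0 <= w n by rewrite divr_ge0 ?subr_ge0// exprn_ge0.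
have h_ge0 n : 0 <= h n by rewrite divr_ge0 ?subr_ge0// exprn_ge0.
have wS n : w n = w n.+1 + w n.+1 by rewrite /w exprS; field; rewrite expf_neq0.
have hS n : h n = h n.+1 + h n.+1 by rewrite /h exprS; field; rewrite expf_neq0.
have wE n : w n = (b0 - a0) / 2 ^+ n by [].
have hE n : h n = (d0 - c0) / 2 ^+ n by [].
have w0 : w 0%N = b0 - a0 by rewrite wE expr0 divr1.
have h0 : h 0%N = d0 - c0 by rewrite hE expr0 divr1.
clearbody w h; pose Q n (q : R * R) := P q.1 (q.1 + w n) q.2 (q.2 + h n).
pose sub n (q q' : R * R) := (q'.1 = q.1 \/ q'.1 = q.1 + w n.+1) /\
  (q'.2 = q.2 \/ q'.2 = q.2 + h n.+1).
(* The implication stands under the existential so that [choice] yields a step function defined on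
   all corners. *)
have stepP (t : nat * (R * R)) : exists q', ~ Q t.1 t.2 -> sub t.1 t.2 q' /\ ~ Q t.1.+1 q'.
  case: t => n q /=; apply: contrapT => /forallNP noq.
  have nQ : ~ Q n q by move=> Qq; apply: (noq q) => nQ; case: nQ.
  apply: nQ.
  have allQ q' : sub n q q' -> Q n.+1 q'.
    move=> qq'; apply: contrapT => nQ'; apply: (noq q') => _; by split.
  have midw x : (x + (x + w n)) / 2 = x + w n.+1 by rewrite (wS n); field.
  have midh x : (x + (x + h n)) / 2 = x + h n.+1 by rewrite (hS n); field.
  apply: quarter; rewrite ?lerDl// ?midw ?midh.
  - have /allQ : sub n q q by split; left.
    exact.
  - have /allQ : sub n q (q.1 + w n.+1, q.2) by split; [right|left].
    by rewrite /Q /= -addrA -wS.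
  - have /allQ : sub n q (q.1, q.2 + h n.+1) by split; [left|right].
    by rewrite /Q /= -!addrA -hS.
  - have /allQ : sub n q (q.1 + w n.+1, q.2 + h n.+1) by split; right.
    by rewrite /Q /= -!addrA -wS -hS.
have [step sP] := choice stepP.
pose fix u n := if n is m.+1 then step (m, u m) else (a0, c0).
have nQu n : ~ Q n (u n).
  elim: n => [|n IH] /=; last by have /= := sP (n, u n) IH => -[].
  by rewrite /Q w0 h0 /= !(addrC _ (_ - _)) !subrK.
have subu n : sub n (u n) (u n.+1) by have /= := sP (n, u n) (nQu n) => -[].
have mono1 n : (u n).1 <= (u n.+1).1 /\ (u n.+1).1 + w n.+1 <= (u n).1 + w n.
  by have [[->|->] _] := subu n; rewrite (wS n); have := w_ge0 n.+1; split; lra.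
have mono2 n : (u n).2 <= (u n.+1).2 /\ (u n.+1).2 + h n.+1 <= (u n).2 + h n.
  by have [_ [->|->]] := subu n; rewrite (hS n); have := h_ge0 n.+1; split; lra.
have nest (x v : nat -> R) : (forall n, 0 <= v n) ->
    (forall n, x n <= x n.+1 /\ x n.+1 + v n.+1 <= x n + v n) ->
    exists p, forall n, x n <= p <= x n + v n.
  move=> v0 xv.
  have up n m : x n <= x (n + m)%N /\ x (n + m)%N + v (n + m)%N <= x n + v n.
    elim: m => [|m [IH1 IH2]]; first by rewrite addn0.
    by rewrite addnS; have [] := xv (n + m)%N; split; lra.
  have le n m : x n <= x m + v m.
    have [nm|mn] := leP n m.
      by have [] := up n (m - n)%N; rewrite subnKC//; have := v0 m; lra.
    by have [] := up m (n - m)%N; rewrite (subnKC (ltnW mn)); have := v0 n; lra.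
  exists (sup (range x)) => n; apply/andP; split.
    by apply: ub_le_sup; [exists (x 0%N + v 0%N) => _ [m _ <-]|exists n].
  by apply: ge_sup; [exists (x 0%N); exists 0%N|move=> _ [m _ <-]].
have [x xP] := nest _ _ w_ge0 mono1; have [y yP] := nest _ _ h_ge0 mono2.
have lo1 n : a0 <= (u n).1 /\ (u n).1 + w n <= b0.
  elim: n => [|n [IH1 IH2]]; first by rewrite w0 /=; lra.
  by have [] := mono1 n; lra.
have lo2 n : c0 <= (u n).2 /\ (u n).2 + h n <= d0.
  elim: n => [|n [IH1 IH2]]; first by rewrite h0 /=; lra.
  by have [] := mono2 n; lra.
have [||e e0 eP] := loc x y.
- by have := xP 0%N; have := lo1 0%N; lra.
- by have := yP 0%N; have := lo2 0%N; lra.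
have [n nP] : exists n, w n + h n < e.
  pose k := (b0 - a0 + (d0 - c0)); have k0 : 0 <= k by rewrite /k; lra.
  have [n nk] : exists n : nat, k / e < n%:R.
    exists (Num.bound (k / e)); apply: archi_boundP.
    exact: divr_ge0 k0 (ltW e0).
  exists n; rewrite wE hE -mulrDl ltr_pdivrMr ?exprn_gt0//.
  move: nk; rewrite ltr_pdivrMr// mulrC => nk; apply: (lt_le_trans nk).
  rewrite ler_pM2l//.
  have : (n <= 2 ^ n)%N by apply: ltnW; exact: ltn_expl.
  by rewrite -(ler_nat R) natrX.
apply: (nQu n); apply: eP; rewrite ?xP ?yP//; try by case: (lo1 n); case: (lo2 n).
by move: nP; lra.
Qed.

End Bisection.

(** * Goursat's lemma *)

Section Goursat.
Variable R : realType.
Local Notation C := R[i].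
Local Notation Co := (R[i]^o).
Implicit Types f g : C -> C.

(** The contour integral of f dz, counterclockwise from the bottom side; on vertical sides dz = i
    dy. *)
Definition rint (f : C -> C) (a b c d : R) : C :=
  cint a b (fun x => f (x +i* c)) + 'i%C * cint c d (fun y => f (b +i* y))
  - cint a b (fun x => f (x +i* d)) - 'i%C * cint c d (fun y => f (a +i* y)).

Definition hcont (f : C -> C) (a b c : R) : Prop :=
  forall x, a <= x <= b -> ccont f (x +i* c).
Definition vcont (f : C -> C) (a c d : R) : Prop :=
  forall y, c <= y <= d -> ccont f (a +i* y).
Definition bcont (f : C -> C) (a b c d : R) : Prop :=
  [/\ hcont f a b c, hcont f a b d, vcont f a c d & vcont f b c d].

Lemma hcont_seg f a b c : hcont f a b c -> cont_seg a b (fun x => f (x +i* c)).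
Proof.
move=> fc x /fc /ccontP fx; apply/continuousCP => e /fx [d d0 dP].
apply/(@nbhs_ballP R R); exists d => //= y; rewrite /ball /= => xy; apply: dP.
have -> : y +i* c - x +i* c = (y - x)%:C.
  by apply/eqP; rewrite eq_complex /= subrr !eqxx.
by rewrite cabs_real distrC.
Qed.

Lemma vcont_seg f a c d : vcont f a c d -> cont_seg c d (fun y => f (a +i* y)).
Proof.
move=> fc x /fc /ccontP fx; apply/continuousCP => e /fx [r r0 rP].
apply/(@nbhs_ballP R R); exists r => //= y; rewrite /ball /= => xy; apply: rP.
have -> : a +i* y - a +i* x = 'i%C * (y - x)%:C.
  by apply/eqP; rewrite eq_complex ?ReM ?ImM /= subrr !mul0r !mulr0 subrr add0r mul1r !eqxx.
by rewrite cabsM cabs_real {1}/cabs /= expr0n expr1n /= add0r sqrtr1 mul1r distrC.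
Qed.

Lemma rint_hsplit f a m b c d : a <= m -> m <= b ->
  hcont f a b c -> hcont f a b d -> rint f a b c d = rint f a m c d + rint f m b c d.
Proof.
move=> am mb /hcont_seg fc /hcont_seg fd; rewrite /rint.
rewrite (cint_chasles am mb fc) (cint_chasles am mb fd).
move: (cint _ _ _) (cint _ _ _) (cint _ _ _) (cint _ _ _) (cint _ _ _) (cint _ _ _) (cint _ _ _).
by move=> x1 x2 x3 x4 x5 x6 x7; ring.
Qed.

Lemma rint_vsplit f a b c m d : c <= m -> m <= d ->
  vcont f a c d -> vcont f b c d -> rint f a b c d = rint f a b c m + rint f a b m d.
Proof.
move=> cm md /vcont_seg fc /vcont_seg fd; rewrite /rint.
rewrite (cint_chasles cm md fc) (cint_chasles cm md fd).
move: (cint _ _ _) (cint _ _ _) (cint _ _ _) (cint _ _ _) (cint _ _ _) (cint _ _ _) (cint _ _ _).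
by move=> x1 x2 x3 x4 x5 x6 x7; ring.
Qed.

Lemma rintD f g a b c d : bcont f a b c d -> bcont g a b c d ->
  rint (fun z => f z + g z) a b c d = rint f a b c d + rint g a b c d.
Proof.
move=> [/hcont_seg f1 /hcont_seg f2 /vcont_seg f3 /vcont_seg f4].
move=> [/hcont_seg g1 /hcont_seg g2 /vcont_seg g3 /vcont_seg g4].
rewrite /rint (cintD f1 g1) (cintD f2 g2) (cintD f3 g3) (cintD f4 g4).
move: (cint _ _ _) (cint _ _ _) (cint _ _ _) (cint _ _ _) (cint _ _ _) (cint _ _ _) (cint _ _ _) (cint _ _ _).
by move=> x1 x2 x3 x4 x5 x6 x7 x8; ring.
Qed.

Lemma rintZ (k : C) f a b c d : bcont f a b c d ->
  rint (fun z => k * f z) a b c d = k * rint f a b c d.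
Proof.
move=> [/hcont_seg f1 /hcont_seg f2 /vcont_seg f3 /vcont_seg f4].
rewrite /rint (cintZ k f1) (cintZ k f2) (cintZ k f3) (cintZ k f4).
move: (cint _ _ _) (cint _ _ _) (cint _ _ _) (cint _ _ _).
by move=> x1 x2 x3 x4; ring.
Qed.

Definition on_bdry (a b c d : R) (z : C) : Prop :=
  (exists2 x, a <= x <= b & z = x +i* c \/ z = x +i* d) \/
  (exists2 y, c <= y <= d & z = a +i* y \/ z = b +i* y).

Lemma eq_rint f g a b c d : (forall z, on_bdry a b c d z -> f z = g z) ->
  rint f a b c d = rint g a b c d.
Proof.
move=> fg; rewrite /rint; congr (_ + _ * _ - _ - _ * _); apply: eq_cint => x xP; apply: fg.
- by left; exists x => //; left.
- by right; exists x => //; right.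
- by left; exists x => //; right.
- by right; exists x => //; left.
Qed.

Lemma cabs_rint f a b c d M : a <= b -> c <= d -> bcont f a b c d ->
  (forall z, on_bdry a b c d z -> cabs (f z) <= M) ->
  cabs (rint f a b c d) <= 4 * M * ((b - a) + (d - c)).
Proof.
move=> ab cd [/hcont_seg f1 /hcont_seg f2 /vcont_seg f3 /vcont_seg f4] fM.
have i1 : cabs ('i%C : C) = 1 by rewrite /cabs /= expr0n expr1n /= add0r sqrtr1.
rewrite /rint.
apply: le_trans (cabsB _ _) _; rewrite cabsM i1 mul1r.
have h1 := @cabs_cint _ a b _ M ab f1 (fun x xP => fM _ (or_introl (ex_intro2 _ _ x xP (or_introl erefl)))).
have h2 := @cabs_cint _ a b _ M ab f2 (fun x xP => fM _ (or_introl (ex_intro2 _ _ x xP (or_intror erefl)))).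
have h3 := @cabs_cint _ c d _ M cd f3 (fun x xP => fM _ (or_intror (ex_intro2 _ _ x xP (or_introl erefl)))).
have h4 := @cabs_cint _ c d _ M cd f4 (fun x xP => fM _ (or_intror (ex_intro2 _ _ x xP (or_intror erefl)))).
apply: le_trans (lerD (le_trans (cabsB _ _) (lerD (le_trans (cabsD _ _) (lerD h1 _)) h2)) h3) _.
  by rewrite cabsM i1 mul1r; exact: h4.
by rewrite le_eqVlt; apply/orP; left; apply/eqP; ring.
Qed.

Lemma ccont_affine (u v : C) z : ccont (fun w => u + v * w) z.
Proof. by apply: ccontD; [|apply: ccontM]; try exact: ccont_cst; exact: ccont_id. Qed.

Lemma bcont_affine (u v : C) a b c d : bcont (fun w => u + v * w) a b c d.
Proof. by split=> ? _; exact: ccont_affine. Qed.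

Lemma rint_affine (u v : C) a b c d : a <= b -> c <= d ->
  rint (fun z => u + v * z) a b c d = 0.
Proof.
move=> ab cd; have [/hcont_seg f1 /hcont_seg f2 /vcont_seg f3 /vcont_seg f4] := bcont_affine u v a b c d.
have cs p q (k : C) : cont_seg p q (fun=> k).
  by move=> x _; exact: (@cst_continuous R Co k x).
have e1 : cint a b (fun x => u + v * (x +i* c)) =
    cint a b (fun x => u + v * (x +i* d)) + cint a b (fun=> v * 'i%C * (c - d)%:C).
  rewrite -(cintD f2 (cs _ _ _)).
  apply: eq_cint => x _; rewrite -addrA -mulrA -mulrDr; congr (_ + _ * _).
  by cplx.
have e2 : cint c d (fun y => u + v * (b +i* y)) =
    cint c d (fun y => u + v * (a +i* y)) + cint c d (fun=> v * (b - a)%:C).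
  rewrite -(cintD f3 (cs _ _ _)).
  apply: eq_cint => x _; rewrite -addrA -mulrDr; congr (_ + _ * _).
  by cplx.
rewrite /rint e1 e2 (cint_cst _ ab) (cint_cst _ cd).
have -> : (c - d)%:C = - (d - c)%:C :> C by rewrite -rmorphN /= opprB.
move: (cint _ _ _) (cint _ _ _) (b - a)%:C (d - c)%:C => x1 x2 x3 x4; ring.
Qed.

Definition in_rect (a b c d : R) (z : C) : Prop :=
  a <= complex.Re z <= b /\ c <= complex.Im z <= d.

Lemma on_bdry_rect a b c d z : a <= b -> c <= d ->
  on_bdry a b c d z -> in_rect a b c d z.
Proof.
by move=> ab cd [[x /andP[? ?] [->|->]]|[x /andP[? ?] [->|->]]]; split => /=; apply/andP.
Qed.

Lemma rect_bcont f a b c d : a <= b -> c <= d ->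
  (forall z, in_rect a b c d z -> ccont f z) -> bcont f a b c d.
Proof.
move=> ab cd fP; split=> x /andP[? ?]; apply: fP; split => /=; apply/andP; split => //.
Qed.

Lemma in_rect_dist a b c d z w : in_rect a b c d z -> in_rect a b c d w ->
  cabs (z - w) <= (b - a) + (d - c).
Proof.
move=> [/andP[? ?] /andP[? ?]] [/andP[? ?] /andP[? ?]].
apply: le_trans (cabs_le _) _; rewrite ReD ImD ReN ImN.
by apply: lerD; rewrite ler_norml; apply/andP; split; lra.
Qed.

Lemma goursat f a b c d : a <= b -> c <= d ->
  (forall z, in_rect a b c d z -> cdiff f z) -> rint f a b c d = 0.
Proof.
move=> ab cd fd; apply/eqP; rewrite -cabs_eq0 eq_le cabs_ge0 andbT.
apply/ler_addgt0Pr => e e0; rewrite add0r.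
have s0 : 0 <= (b - a) + (d - c) by lra.
set s := (b - a) + (d - c) in s0.
suff H e' : 0 < e' -> cabs (rint f a b c d) <= e' * s ^+ 2.
  have s1 : 0 < s ^+ 2 + 1 by rewrite ltr_wpDl// sqr_ge0.
  have := H (e / (s ^+ 2 + 1)); rewrite divr_gt0// => /(_ isT) /le_trans; apply.
  by rewrite mulrAC ler_pdivrMr// ler_pM2l// lerDl.
move=> {e e0}e0; rewrite /s => {s s0}.
(* A bound quadratic in the half-perimeter is additive under quartering: each quarter contributes a
   fourth of it. For small rectangles it comes from subtracting the first-order Taylor polynomial,
   whose integral vanishes. *)
pose P a1 b1 c1 d1 := a <= a1 -> b1 <= b -> c <= c1 -> d1 <= d -> a1 <= b1 -> c1 <= d1 ->
  cabs (rint f a1 b1 c1 d1) <= e' * ((b1 - a1) + (d1 - c1)) ^+ 2.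
suff : P a b c d by apply.
apply: rect_induction => //.
  move=> a1 b1 c1 d1 ab1 cd1 P1 P2 P3 P4 la lb lc ld _ _.
  have fc z : in_rect a1 b1 c1 d1 z -> ccont f z.
    move=> [/andP[? ?] /andP[? ?]]; apply: cdiff_cont; apply: fd.
    by split; apply/andP; split; lra.
  set m := (a1 + b1) / 2; set n := (c1 + d1) / 2.
  have hm : a1 <= m <= b1 by rewrite /m; apply/andP; split; lra.
  have hn : c1 <= n <= d1 by rewrite /n; apply/andP; split; lra.
  have [am mb] := andP hm; have [cn nd] := andP hn.
  have hh y : c1 <= y <= d1 -> hcont f a1 b1 y.
    by move=> y1 x x1; apply: fc; split.
  have hv x : a1 <= x <= b1 -> vcont f x c1 d1.
    by move=> x1 y y1; apply: fc; split.
  rewrite (rint_hsplit am mb); try by apply: hh; rewrite lexx cd1.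
  rewrite (rint_vsplit cn nd); try by apply: hv; rewrite ?lexx.
  rewrite (rint_vsplit (a := m) cn nd); try by apply: hv; rewrite ?lexx ?andbT//.
  apply: le_trans (cabsD _ _) _.
  apply: le_trans (lerD (cabsD _ _) (cabsD _ _)) _.
  have q1 := P1; have q2 := P2; have q3 := P3; have q4 := P4.
  have {}q1 : cabs (rint f a1 m c1 n) <= e' * ((m - a1) + (n - c1)) ^+ 2 by apply: P1 => //; lra.
  have {}q2 : cabs (rint f m b1 c1 n) <= e' * ((b1 - m) + (n - c1)) ^+ 2 by apply: P2 => //; lra.
  have {}q3 : cabs (rint f a1 m n d1) <= e' * ((m - a1) + (d1 - n)) ^+ 2 by apply: P3 => //; lra.
  have {}q4 : cabs (rint f m b1 n d1) <= e' * ((b1 - m) + (d1 - n)) ^+ 2 by apply: P4 => //; lra.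
  have m1 : m - a1 = (b1 - a1) / 2 by rewrite /m; field.
  have m2 : b1 - m = (b1 - a1) / 2 by rewrite /m; field.
  have n1 : n - c1 = (d1 - c1) / 2 by rewrite /n; field.
  have n2 : d1 - n = (d1 - c1) / 2 by rewrite /n; field.
  rewrite m1 m2 n1 n2 in q1 q2 q3 q4.
  apply: le_trans (lerD (lerD q1 q3) (lerD q2 q4)) _.
  by rewrite le_eqVlt; apply/orP; left; apply/eqP; field.
move=> x y xab ycd.
have [l fl] : cdiff f (x +i* y) by apply: fd; split.
have [|r r0 rP] := fl (e' / 4); first by rewrite divr_gt0.
exists r => // a1 b1 c1 d1 la lb lc ld x1 y1 sr _ _ _ _ ab1 cd1.
have fc z : in_rect a1 b1 c1 d1 z -> ccont f z.
  move=> [/andP[? ?] /andP[? ?]]; apply: cdiff_cont; apply: fd.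
  by split; apply/andP; split; lra.
pose p : C := x +i* y.
pose g z := f z + ((- (f p - l * p)) + (- l) * z).
have -> : rint f a1 b1 c1 d1 = rint g a1 b1 c1 d1.
  rewrite /g rintD; last 2 first.
  - exact: rect_bcont.
  - exact: bcont_affine.
  by rewrite rint_affine// addr0.
have s0 : 0 <= (b1 - a1) + (d1 - c1) by lra.
have -> : e' * (b1 - a1 + (d1 - c1)) ^+ 2 =
    4 * (e' / 4 * (b1 - a1 + (d1 - c1))) * (b1 - a1 + (d1 - c1)) by field.
apply: cabs_rint => //.
  apply: (rect_bcont ab1 cd1) => z zP.
  rewrite /g; apply: ccontD; first exact: fc.
  exact: ccont_affine.
move=> z /(on_bdry_rect ab1 cd1) zP.
have zp : cabs (z - p) <= (b1 - a1) + (d1 - c1) by apply: in_rect_dist zP _; split.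
have := rP (z - p) (le_lt_trans zp sr).
have -> : x +i* y + (z - p) = z by rewrite addrC subrK.
have -> : g z = f z - f (x +i* y) - l * (z - p) by rewrite /g /p; ring.
by move=> /le_trans; apply; rewrite ler_wpM2l// divr_ge0// ltW.
Qed.

End Goursat.

(** * Cauchy's formula on rectangles *)

Section Cauchy.
Variable R : realType.
Local Notation C := R[i].
Implicit Types f g : C -> C.
Local Notation mu := (@lebesgue_measure R).

Definition int_rect (a b c d : R) (z : C) : Prop :=
  a < complex.Re z < b /\ c < complex.Im z < d.

Lemma rint_shrink f a a' b' b c c' d' d :
  a <= a' -> a' <= b' -> b' <= b -> c <= c' -> c' <= d' -> d' <= d ->
  hcont f a b c -> hcont f a b d -> vcont f a' c d -> vcont f b' c d ->
  rint f a a' c d = 0 -> rint f b' b c d = 0 ->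
  rint f a' b' c c' = 0 -> rint f a' b' d' d = 0 ->
  rint f a b c d = rint f a' b' c' d'.
Proof.
move=> aa ab bb cc cd dd hc hd va vb z1 z2 z3 z4.
have cd' : c' <= d := le_trans cd dd.
have ab' : a' <= b := le_trans ab bb.
have hs v : hcont f a b v -> hcont f a' b v.
  by move=> hv u /andP[u1 u2]; apply: hv; rewrite (le_trans aa u1).
have vs u : vcont f u c d -> vcont f u c' d.
  by move=> hv v /andP[u1 u2]; apply: hv; rewrite (le_trans cc u1).
rewrite (rint_hsplit aa ab' hc hd) (rint_hsplit ab bb (hs _ hc) (hs _ hd)).
rewrite (rint_vsplit cc cd' va vb) (rint_vsplit cd dd (vs _ va) (vs _ vb)).
by rewrite z1 z2 z3 z4 !(add0r, addr0).
Qed.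

(** The contour shrinks to a square of side 2 r around [p], where the integral is at most 16 r M. *)
Lemma goursat_except f a b c d p M e0 : int_rect a b c d p ->
  (forall z, in_rect a b c d z -> z != p -> cdiff f z) ->
  0 <= M -> 0 < e0 -> (forall z, cabs (z - p) < e0 -> z != p -> cabs (f z) <= M) ->
  rint f a b c d = 0.
Proof.
move=> pP fd M0 e00 fM; have [/andP[ap pb] /andP[cp pd]] := pP.
set x := complex.Re p in ap pb; set y := complex.Im p in cp pd.
have ne_re u v : u != x -> u +i* v != p.
  by apply: contra => /eqP H; rewrite /x -H.
have ne_im u v : v != y -> u +i* v != p.
  by apply: contra => /eqP H; rewrite /y -H.
have fc z : in_rect a b c d z -> z != p -> ccont f z.
  by move=> zP zp; apply: cdiff_cont; exact: fd.
have zero a1 b1 c1 d1 : a <= a1 -> a1 <= b1 -> b1 <= b -> c <= c1 -> c1 <= d1 -> d1 <= d ->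
    (b1 < x \/ x < a1) \/ (d1 < y \/ y < c1) -> rint f a1 b1 c1 d1 = 0.
  move=> h1 h2 h3 h4 h5 h6 H; apply: goursat => // z [/andP[u1 u2] /andP[v1 v2]]; apply: fd.
    by split; rewrite ?(le_trans h1 u1) ?(le_trans u2 h3) ?(le_trans h4 v1) ?(le_trans v2 h6).
  apply/eqP => zp; move: H u1 u2 v1 v2; rewrite zp -/x -/y; clear.
  by case=> [[]|[]] H ? ? ? ?; lra.
apply/eqP; rewrite -cabs_eq0 eq_le cabs_ge0 andbT.
apply/ler_addgt0Pr => e egt0; rewrite add0r.
(* The first four bounds keep the square inside the rectangle. Points of the square are within 4 r
   of [p], so e0 / 5 keeps them where [M] bounds [f]; the last bound makes 16 r M at most [e]. *)
pose r := Num.min (Num.min ((x - a) / 2) ((b - x) / 2))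
  (Num.min (Num.min ((y - c) / 2) ((d - y) / 2))
    (Num.min (e0 / 5) (e / (16 * (M + 1))))).
have r0 : 0 < r.
  by rewrite !lt_min !divr_gt0// ?subr_gt0// mulr_gt0// ltr_wpDl.
have [[r1 r2 r6] [r3 r4 r5]] : [/\ r <= (x - a) / 2, r <= (b - x) / 2 & r <= e0 / 5] /\
    [/\ r <= (y - c) / 2, r <= (d - y) / 2 & r <= e / (16 * (M + 1))].
  by split; split; rewrite /r ?ge_min ?lexx ?orbT.
clearbody r.
have hh v : c <= v <= d -> v != y -> hcont f a b v.
  by move=> vP vy u uP; apply: fc; [split|exact: ne_im].
have vv u : a <= u <= b -> u != x -> vcont f u c d.
  by move=> uP ux v vP; apply: fc; [split|exact: ne_re].
have [xa xb] : x - r < x /\ x < x + r by clear -r0; split; lra.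
have [yc yd] : y - r < y /\ y < y + r by clear -r0; split; lra.
have [ar br] : a <= x - r /\ x + r <= b by clear -r1 r2 r0 ap pb; split; lra.
have [cr dr] : c <= y - r /\ y + r <= d by clear -r3 r4 r0 cp pd; split; lra.
have xx : x - r <= x + r by exact: ltW (lt_trans xa xb).
have yy : y - r <= y + r by exact: ltW (lt_trans yc yd).
have ab : a <= b := ltW (lt_trans ap pb).
have cd : c <= d := ltW (lt_trans cp pd).
have xma : a <= x - r <= b by rewrite ar (le_trans xx br).
have xpa : a <= x + r <= b by rewrite br (le_trans ar xx).
have ymc : c <= y - r <= d by rewrite cr (le_trans yy dr).
have ypc : c <= y + r <= d by rewrite dr (le_trans cr yy).
have [xmb xpb] := (andP xma, andP xpa); have [ymd ypd] := (andP ymc, andP ypc).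
rewrite (@rint_shrink f a (x - r) (x + r) b c (y - r) (y + r) d) //; last 8 first.
- by apply: hh; rewrite ?lexx ?cd// lt_eqF.
- by apply: hh; rewrite ?lexx ?cd// gt_eqF.
- by apply: vv => //; rewrite lt_eqF.
- by apply: vv => //; rewrite gt_eqF.
- exact: (zero a (x - r) c d (lexx a) ar xmb.2 (lexx c) cd (lexx d) (or_introl (or_introl xa))).
- exact: (zero (x + r) b c d xpb.1 br (lexx b) (lexx c) cd (lexx d) (or_introl (or_intror xb))).
- exact: (zero _ _ c (y - r) ar xx br (lexx c) cr ymd.2 (or_intror (or_introl yc))).
- exact: (zero _ _ (y + r) d ar xx br ypd.1 dr (lexx d) (or_intror (or_intror yd))).
have e16 : 16 * (r * M) <= e.
  have : r * (16 * (M + 1)) <= e by rewrite -ler_pdivlMr// mulr_gt0// ltr_wpDl.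
  by clear -r0; lra.
apply: le_trans (@cabs_rint _ f (x - r) (x + r) (y - r) (y + r) M xx yy _ _) _.
- split=> [u /andP[u1 u2]|u /andP[u1 u2]|v /andP[v1 v2]|v /andP[v1 v2]].
  + apply: hh => //; first by rewrite lt_eqF.
    by rewrite (le_trans ar u1) (le_trans u2 br).
  + apply: hh => //; first by rewrite gt_eqF.
    by rewrite (le_trans ar u1) (le_trans u2 br).
  + apply: vv => //; first by rewrite lt_eqF.
    by rewrite (le_trans cr v1) (le_trans v2 dr).
  + apply: vv => //; first by rewrite gt_eqF.
    by rewrite (le_trans cr v1) (le_trans v2 dr).
- move=> z zP; have [/andP[u1 u2] /andP[v1 v2]] := on_bdry_rect xx yy zP.
  apply: fM.
    apply: (@le_lt_trans _ _ ((x + r - (x - r)) + (y + r - (y - r)))).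
      apply: in_rect_dist; first exact: on_bdry_rect zP.
      by split; rewrite ?(ltW xa) ?(ltW xb) ?(ltW yc) ?(ltW yd).
    by clear -r0 r6; lra.
  case: zP => [[u _ [->|->]]|[v _ [->|->]]].
  + by apply: ne_im; rewrite lt_eqF.
  + by apply: ne_im; rewrite gt_eqF.
  + by apply: ne_re; rewrite lt_eqF.
  + by apply: ne_re; rewrite gt_eqF.
- by have -> : 4 * M * (x + r - (x - r) + (y + r - (y - r))) = 16 * (r * M) by ring.
Qed.

Lemma Rintegral_gt0 a b (u : R -> R) m : a < b -> 0 < m ->
  mu.-integrable `[a, b] (EFin \o u) ->
  (forall x, a <= x <= b -> m <= u x) -> 0 < \int[mu]_(x in `[a, b]) u x.
Proof.
move=> ab m0 ui um; apply: (@lt_le_trans _ _ (m * (b - a))).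
  by rewrite mulr_gt0// subr_gt0.
have -> : m * (b - a) = \int[mu]_(x in `[a, b]) m.
  by rewrite Rintegral_cst//= lebesgue_measure_itv /= lte_fin ab.
apply: le_Rintegral => //.
- apply: continuous_compact_integrable; first exact: segment_compact.
  by move=> x; exact: cst_continuous.
Qed.

Lemma Re_inv (z : C) : complex.Re z^-1 = complex.Re z / (cabs z ^+ 2).
Proof. by case: z => x y; rewrite sqr_cabs /=. Qed.

Lemma Im_inv (z : C) : complex.Im z^-1 = - (complex.Im z / (cabs z ^+ 2)).
Proof. by case: z => x y; rewrite sqr_cabs /= -?mulNr. Qed.

Lemma bcont_inv a b c d p : a <= b -> c <= d -> int_rect a b c d p ->
  bcont (fun z => (z - p)^-1) a b c d.
Proof.
move=> ab cd [/andP[ap pb] /andP[cp pd]].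
have cc z : z - p != 0 -> ccont (fun z => (z - p)^-1) z.
  move=> zp; apply: ccontV => //; apply: ccontD; [exact: ccont_id|exact: ccont_cst].
split => u uP; apply: cc; rewrite subr_eq0; apply/eqP => up; rewrite -up /= in ap pb cp pd; lra.
Qed.

(** Each side contributes positively to the imaginary part: its integrand is the distance from [p]
    to the line of the side, divided by |z - p|^2. Non-vanishing replaces the exact value 2 pi i in
    all later uses. *)
Lemma rint_inv_neq0 a b c d p : int_rect a b c d p ->
  rint (fun z => (z - p)^-1) a b c d != 0.
Proof.
move=> pP; have [/andP[ap pb] /andP[cp pd]] := pP.
have ab := lt_trans ap pb; have cd := lt_trans cp pd.
have [/hcont_seg f1 /hcont_seg f2 /vcont_seg f3 /vcont_seg f4] :=
  bcont_inv (ltW ab) (ltW cd) pP.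
pose D := (b - a) + (d - c); have D0 : 0 < D by rewrite /D; lra.
have key z t : on_bdry a b c d z -> 0 < t -> t / D ^+ 2 <= t / cabs (z - p) ^+ 2.
  move=> zP t0; have zr := on_bdry_rect (ltW ab) (ltW cd) zP.
  have pr : in_rect a b c d p by split; apply/andP; lra.
  have z0 : 0 < cabs (z - p).
    rewrite cabs_gt0 subr_eq0; apply/eqP => zp; rewrite -zp in ap pb cp pd.
    by case: zP ap pb cp pd => [[u _ [->|->]]|[v _ [->|->]]] /=; lra.
  rewrite ler_pM2l// lef_pV2 ?posrE ?exprn_gt0//.
  by rewrite ler_sqr ?nnegrE ?cabs_ge0 ?(ltW D0)//; exact: in_rect_dist zr pr.
have pos t : 0 < t -> 0 < t / D ^+ 2 by move=> t0; rewrite divr_gt0// exprn_gt0.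
suff H : 0 < complex.Im (rint (fun z => (z - p)^-1) a b c d).
  by apply/eqP => H0; rewrite H0 ltxx in H.
have ImiM (w : C) : complex.Im ('i%C * w) = complex.Re w by rewrite ImM /= mul0r add0r mul1r.
rewrite /rint !ImD !ImN !ImiM /=.
have i1 := Rintegral_gt0 ab (pos _ _) (cont_seg_integrable f1).2.
have i2 := Rintegral_gt0 cd (pos _ _) (cont_seg_integrable f4).1.
have {}i1 := i1 (complex.Im p - c); have {}i2 := i2 (b - complex.Re p).
have i3 : 0 < \int[mu]_(x in `[a, b]) (- complex.Im (((x +i* d) - p)^-1)).
  apply: (Rintegral_gt0 ab (pos (d - complex.Im p) _)); first by lra.
    have /integrableN := (cont_seg_integrable f2).2.
    by apply: eq_integrable => // x _ /=; rewrite EFinN.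
  move=> x xP; rewrite Im_inv opprK ImD ImN /=; apply: key; last by lra.
  by left; exists x => //; right.
have i4 : 0 < \int[mu]_(x in `[c, d]) (- complex.Re (((a +i* x) - p)^-1)).
  apply: (Rintegral_gt0 cd (pos (complex.Re p - a) _)); first by lra.
    have /integrableN := (cont_seg_integrable f3).1.
    by apply: eq_integrable => // x _ /=; rewrite EFinN.
  move=> x xP; rewrite Re_inv ReD ReN /= -mulNr opprB.
  apply: key; last by lra.
  by right; exists x => //; left.
have neg (u v : R) (g : R -> R) : mu.-integrable `[u, v] (EFin \o g) ->
   \int[mu]_(x in `[u, v]) (- g x) = - \int[mu]_(x in `[u, v]) g x.
  move=> gi; rewrite -mulN1r -RintegralZl//.
  by apply: eq_Rintegral => x _; rewrite mulN1r.
rewrite (neg _ _ _ (cont_seg_integrable f2).2) in i3.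
rewrite (neg _ _ _ (cont_seg_integrable f3).1) in i4.
have {}i1 : 0 < \int[mu]_(x in `[a, b]) (complex.Im (((x +i* c) - p)^-1)).
  apply: i1; first by lra.
  move=> x xP; rewrite Im_inv -mulNr ImD ImN /= opprB.
  by apply: key; [left; exists x => //; left|lra].
have {}i2 : 0 < \int[mu]_(x in `[c, d]) (complex.Re (((b +i* x) - p)^-1)).
  apply: i2; first by lra.
  move=> x xP; rewrite Re_inv ReD ReN /=.
  by apply: key; [right; exists x => //; right|lra].
by lra.
Qed.

(** The quotient (g z - g p) / (z - p) is bounded near [p] by differentiability, so [goursat_except]
    applies to it. *)
Lemma cauchy_rect g a b c d p : int_rect a b c d p ->
  (forall z, in_rect a b c d z -> cdiff g z) ->
  rint (fun z => g z * (z - p)^-1) a b c d =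
  g p * rint (fun z => (z - p)^-1) a b c d.
Proof.
move=> pP gd; have [/andP[ap pb] /andP[cp pd]] := pP.
have ab := lt_trans ap pb; have cd := lt_trans cp pd.
have pr : in_rect a b c d p by split; apply/andP; lra.
have bi := bcont_inv (ltW ab) (ltW cd) pP.
have gb : bcont g a b c d.
  by apply: (rect_bcont (ltW ab) (ltW cd)) => z zP; exact: (cdiff_cont (gd z zP)).
apply/eqP; rewrite -subr_eq0 -mulNr -rintZ// -rintD; last 2 first.
- by case: bi gb => ? ? ? ? [? ? ? ?]; split => x xP; apply: ccontM; auto.
- by case: bi => ? ? ? ?; split => x xP; apply: ccontM; auto; exact: ccont_cst.
pose f z := (g z - g p) * (z - p)^-1.
have -> : (fun z => g z * (z - p)^-1 + - g p * (z - p)^-1) = f.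
  by apply/funext => z; rewrite /f mulrBl mulNr.
have fd z : in_rect a b c d z -> z != p -> cdiff f z.
  move=> zr zp; apply: cdiffM.
    by apply: cdiffB; [exact: gd|exact: cdiff_cst].
  apply: cdiffV; first by rewrite subr_eq0.
  by apply: cdiffB; [exact: cdiff_id|exact: cdiff_cst].
have [l gl] := gd _ pr.
have [e e0 eP] := gl 1 ltr01.
rewrite (@goursat_except f a b c d p (1 + cabs l) e) ?addr_ge0 ?cabs_ge0//.
move=> z ze zp; rewrite /f cabsM cabsV ler_pdivrMr ?cabs_gt0 ?subr_eq0//.
have := eP (z - p) ze; rewrite (addrC p) subrK mul1r => H.
have -> : g z - g p = (g z - g p - l * (z - p)) + l * (z - p) by rewrite subrK.
by apply: le_trans (cabsD _ _) _; rewrite cabsM mulrDl mul1r lerD2r.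
Qed.

End Cauchy.

(** * Maximum modulus and removable singularities *)

Section MaximumModulus.
Variable R : realType.
Local Notation C := R[i].
Local Notation Co := (R[i]^o).
Implicit Types f g : C -> C.

Lemma bernoulli_le (x : R) n : 0 <= x -> 1 + n%:R * x <= (1 + x) ^+ n.
Proof.
move=> x0; elim: n => [|n IH]; first by rewrite expr0 mul0r addr0.
rewrite exprS; apply: (@le_trans _ _ ((1 + x) * (1 + n%:R * x))).
  have : 0 <= n%:R * x * x by rewrite !mulr_ge0.
  by rewrite -natr1; lra.
by rewrite ler_pM2l// ltr_wpDr.
Qed.

(** If t > q > 0, Bernoulli's inequality makes (t / q)^n exceed every bound. *)
Lemma geometric_bounded_le1 (t q B : R) : 0 <= q -> 0 <= t ->
  (forall n, t ^+ n <= q ^+ n * B) -> t <= q.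
Proof.
move=> q0 t0 tq; rewrite leNgt; apply/negP => qt.
have [q_eq0|q_gt0] := eqVneq q 0.
  by have := tq 1%N; rewrite q_eq0 !expr1 mul0r leNgt -q_eq0 qt.
have {}q_gt0 : 0 < q by rewrite lt_def q_gt0.
pose x := t / q - 1; have x0 : 0 < x by rewrite /x subr_gt0 ltr_pdivlMr// mul1r.
have xB n : 1 + n%:R * x <= B.
  apply: le_trans (bernoulli_le n (ltW x0)) _.
  by rewrite /x addrC subrK expr_div_n ler_pdivrMr ?exprn_gt0// mulrC.
have B0 : 0 <= B / x.
  apply: divr_ge0 (ltW x0); have := xB 0%N; rewrite mul0r addr0.
  exact: le_trans ler01.
have := archi_boundP B0; rewrite ltr_pdivrMr// => H.
by have := le_lt_trans (xB (Num.bound (B / x))) H; rewrite gtrDr ltr10.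
Qed.

Lemma on_bdry_dist (a b c d : R) (p z : C) : int_rect a b c d p -> on_bdry a b c d z ->
  Num.min (Num.min (complex.Re p - a) (b - complex.Re p))
          (Num.min (complex.Im p - c) (d - complex.Im p)) <= cabs (z - p).
Proof.
move=> [/andP[ap pb] /andP[cp pd]]; rewrite !ge_min.
case=> [[x _ [->|->]]|[y _ [->|->]]].
- apply/orP; right; apply/orP; left; apply: le_trans (normIm_le _).
  by rewrite ImD ImN /= distrC ler_norm.
- apply/orP; right; apply/orP; right; apply: le_trans (normIm_le _).
  by rewrite ImD ImN /= ler_norm.
- apply/orP; left; apply/orP; left; apply: le_trans (normRe_le _).
  by rewrite ReD ReN /= distrC ler_norm.
- apply/orP; left; apply/orP; right; apply: le_trans (normRe_le _).
  by rewrite ReD ReN /= ler_norm.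
Qed.

(* Landau's trick: Cauchy's formula for [f ^+ n] bounds [|f p|] by [q] up to a
   constant factor whose n-th root tends to 1. *)
Lemma max_modulus_rect f a b c d p q : int_rect a b c d p ->
  (forall z, in_rect a b c d z -> cdiff f z) ->
  (forall z, on_bdry a b c d z -> cabs (f z) <= q) -> cabs (f p) <= q.
Proof.
move=> pP fd fq; have [/andP[ap pb] /andP[cp pd]] := pP.
have ab := ltW (lt_trans ap pb); have cd := ltW (lt_trans cp pd).
have q0 : 0 <= q.
  apply: le_trans (cabs_ge0 _) (fq (a +i* c) _); left; exists a; last by left.
  by rewrite lexx ab.
set I := rint (fun z => (z - p)^-1) a b c d.
have I0 : 0 < cabs I by rewrite cabs_gt0; exact: rint_inv_neq0.
pose r := Num.min (Num.min (complex.Re p - a) (b - complex.Re p))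
          (Num.min (complex.Im p - c) (d - complex.Im p)).
have r0 : 0 < r by rewrite !lt_min !subr_gt0 ap pb cp pd.
pose B := 4 * r^-1 * ((b - a) + (d - c)) / cabs I.
apply: (@geometric_bounded_le1 _ _ B) => // [|n]; first exact: cabs_ge0.
rewrite /B !mulrA ler_pdivlMr// -cabsX -cabsM.
have gd z : in_rect a b c d z -> cdiff (fun z => f z ^+ n) z.
  by move=> zP; apply: cdiffX; exact: fd.
rewrite -(cauchy_rect pP gd).
have -> : q ^+ n * 4 / r * (b - a + (d - c)) = 4 * (q ^+ n / r) * (b - a + (d - c)).
  by rewrite (mulrC _ 4) !mulrA.
have bi := bcont_inv ab cd pP.
apply: (cabs_rint ab cd).
  have [g1 g2 g3 g4] := rect_bcont ab cd (fun z zP => cdiff_cont (gd z zP)).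
  have [b1 b2 b3 b4] := bi.
  split=> x xP; [exact: ccontM (g1 x xP) (b1 x xP)|exact: ccontM (g2 x xP) (b2 x xP)
    |exact: ccontM (g3 x xP) (b3 x xP)|exact: ccontM (g4 x xP) (b4 x xP)].
move=> z zP; rewrite cabsM cabsX cabsV.
have rz : r <= cabs (z - p) by exact: on_bdry_dist.
apply: ler_pM; rewrite ?exprn_ge0 ?invr_ge0 ?cabs_ge0//.
  by rewrite lerXn2r ?nnegrE ?cabs_ge0//; exact: fq.
by rewrite lef_pV2 ?posrE// (lt_le_trans r0).
Qed.

Lemma no_strict_max f (z0 : C) (q d : R) : 0 < d -> q < 1 -> f z0 = 1 ->
  (forall z, cabs (z - z0) <= 2 * d -> cdiff f z) ->
  (forall z, d <= cabs (z - z0) <= 2 * d -> cabs (f z) <= q) -> False.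
Proof.
move=> d0 q1 f1 fd fq; set x := complex.Re z0; set y := complex.Im z0.
have pP : int_rect (x - d) (x + d) (y - d) (y + d) z0.
  by split; rewrite gtrBl ltrDl d0.
have near_z z : in_rect (x - d) (x + d) (y - d) (y + d) z -> cabs (z - z0) <= 2 * d.
  move=> [/andP[h1 h2] /andP[h3 h4]]; apply: le_trans (cabs_le _) _.
  rewrite ReD ImD ReN ImN mulr_natl mulr2n -/x -/y.
  by apply: lerD; rewrite ler_norml; apply/andP; clear -h1 h2 h3 h4; split; lra.
have xd : x - d <= x + d by clear -d0; lra.
have yd : y - d <= y + d by clear -d0; lra.
have : cabs (f z0) <= q.
  apply: (@max_modulus_rect f (x - d) (x + d) (y - d) (y + d)) => //.
    by move=> z /near_z /fd.
  move=> z zP; apply: fq; apply/andP; split; last exact: near_z (on_bdry_rect xd yd zP).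
  apply: le_trans (on_bdry_dist pP zP); rewrite -/x -/y.
  by rewrite !le_min; apply/andP; split; apply/andP; clear; split; lra.
by rewrite f1 cabs1 leNgt q1.
Qed.

Lemma cabs_gt0_far (a b c d : R) (p : C) : int_rect a b c d p -> exists2 r, 0 < r &
  forall w z, cabs (w - p) <= r -> on_bdry a b c d z -> r <= cabs (z - w).
Proof.
move=> pP; have [/andP[ap pb] /andP[cp pd]] := pP.
pose r := Num.min (Num.min (complex.Re p - a) (b - complex.Re p))
          (Num.min (complex.Im p - c) (d - complex.Im p)).
have r0 : 0 < r by rewrite !lt_min !subr_gt0 ap pb cp pd.
exists (r / 2); first by rewrite divr_gt0.
move=> w z wp zP; have rz : r <= cabs (z - p) by exact: on_bdry_dist.
have : cabs (z - p) <= cabs (z - w) + cabs (w - p).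
  by rewrite -(subrKA w z); exact: cabsD.
by clear -wp rz; lra.
Qed.

(** The kernel is expanded exactly: 1 / (A - k) = 1 / A + k / A^2 + k^2 / (A^2 (A - k)). With A = z
    - p and k = h the last term is O(|h|^2) uniformly on the boundary, which justifies
    differentiating under the integral. *)
Lemma cdiff_cauchy_transform f a b c d p : a <= b -> c <= d ->
  int_rect a b c d p -> bcont f a b c d ->
  cdiff (fun w => rint (fun z => f z * (z - w)^-1) a b c d) p.
Proof.
move=> ab cd pP fc; have [r r0 rP] := cabs_gt0_far pP.
have [M M0 fM] : exists2 M, 0 <= M & forall z, on_bdry a b c d z -> cabs (f z) <= M.
  have seg u v (g : R -> C) : u <= v -> cont_seg u v g ->
      exists2 M, 0 <= M & forall x, u <= x <= v -> cabs (g x) <= M.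
    move=> uv gc.
    have gw : {within `[u, v], continuous (fun x => cabs (g x))}.
      apply: continuous_in_subspaceT => x; rewrite inE /= in_itv /= => /gc gx.
      have := @continuous_comp _ Co R (g : R -> Co) (@cabs R : Co -> R) x.
      by apply => //; exact: continuous_cabs.
    have [m _ mP] := EVT_max uv gw.
    exists (cabs (g m)); first exact: cabs_ge0.
    by move=> x xP; apply: mP; rewrite in_itv.
  have [/hcont_seg f1 /hcont_seg f2 /vcont_seg f3 /vcont_seg f4] := fc.
  have [M1 M10 M1P] := seg _ _ _ ab f1; have [M2 M20 M2P] := seg _ _ _ ab f2.
  have [M3 M30 M3P] := seg _ _ _ cd f3; have [M4 M40 M4P] := seg _ _ _ cd f4.
  exists (M1 + M2 + (M3 + M4)); first by rewrite !addr_ge0.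
  move=> z [[x xP [->|->]]|[y yP [->|->]]].
  - by apply: le_trans (M1P _ xP) _; rewrite -addrA lerDl !addr_ge0.
  - by apply: le_trans (M2P _ xP) _; rewrite (addrC M1) -addrA lerDl !addr_ge0.
  - by apply: le_trans (M3P _ yP) _; rewrite addrCA lerDl !addr_ge0.
  - by apply: le_trans (M4P _ yP) _; rewrite addrA lerDr !addr_ge0.
have ne z w : cabs (w - p) <= r -> on_bdry a b c d z -> z - w != 0.
  by move=> wp zP; rewrite -cabs_gt0; exact: lt_le_trans (rP w z wp zP).
have bdryP (P : C -> Prop) : (forall z, on_bdry a b c d z -> ccont f z -> P z) ->
    [/\ forall x, a <= x <= b -> P (x +i* c), forall x, a <= x <= b -> P (x +i* d),
     forall y, c <= y <= d -> P (a +i* y) & forall y, c <= y <= d -> P (b +i* y)].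
  move=> H; have [f1 f2 f3 f4] := fc; split=> x xP; apply: H; auto.
  - by left; exists x => //; left.
  - by left; exists x => //; right.
  - by right; exists x => //; left.
  - by right; exists x => //; right.
have invc w z : cabs (w - p) <= r -> on_bdry a b c d z -> ccont (fun z => (z - w)^-1) z.
  move=> wp zP; apply: ccontV; first exact: ne.
  by apply: ccontD; [exact: ccont_id|exact: ccont_cst].
pose f1 (z : C) : C := f z * (z - p)^-1; pose f2 (z : C) : C := f1 z * (z - p)^-1.
pose f3 (w z : C) : C := f2 z * (z - w)^-1.
have pp : cabs (p - p) <= r by rewrite subrr cabs0 ltW.
have c1 z : on_bdry a b c d z -> ccont f z -> ccont f1 z.
  by move=> zP fz; exact: ccontM fz (invc _ _ pp zP).
have c2 z : on_bdry a b c d z -> ccont f z -> ccont f2 z.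
  by move=> zP fz; exact: ccontM (c1 _ zP fz) (invc _ _ pp zP).
have c3 w z : cabs (w - p) <= r -> on_bdry a b c d z -> ccont f z -> ccont (f3 w) z.
  by move=> wp zP fz; exact: ccontM (c2 _ zP fz) (invc _ _ wp zP).
have bc g : (forall z, on_bdry a b c d z -> ccont f z -> ccont g z) -> bcont g a b c d.
  exact: (bdryP (ccont g)).
have b1 : bcont f1 a b c d by apply: bc; exact: c1.
have b2 : bcont f2 a b c d by apply: bc; exact: c2.
have b3 w : cabs (w - p) <= r -> bcont (f3 w) a b c d.
  by move=> wp; apply: bc => z; exact: c3.
have expand (A k F : C) : A != 0 -> A - k != 0 -> F * (A - k)^-1 =
    F * A^-1 + k * (F * A^-1 * A^-1) + k ^+ 2 * (F * A^-1 * A^-1 * (A - k)^-1).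
  by move=> A0 Ak0; field; rewrite A0 Ak0.
exists (rint f2 a b c d) => e e0.
pose L := 4 * (M / r / r / r) * ((b - a) + (d - c)).
have L0 : 0 <= L.
  have ri : 0 <= r^-1 by rewrite invr_ge0 ltW.
  by rewrite /L; apply: mulr_ge0; [rewrite !mulr_ge0|rewrite addr_ge0 ?subr_ge0].
exists (Num.min r (e / (L + 1))).
  by rewrite lt_min r0 divr_gt0// ltr_wpDl.
move=> h; rewrite lt_min => /andP[hr he].
have wp : cabs (p + h - p) <= r by rewrite addrC addKr ltW.
have -> : rint (fun z => f z * (z - (p + h))^-1) a b c d -
    rint (fun z => f z * (z - p)^-1) a b c d - rint f2 a b c d * h =
    h ^+ 2 * rint (f3 (p + h)) a b c d.
  have -> : rint (fun z => f z * (z - (p + h))^-1) a b c d =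
     rint (fun z => (f1 z + h * f2 z) + h ^+ 2 * f3 (p + h) z) a b c d.
    apply: eq_rint => z zP; rewrite /f3 /f2 /f1.
    have n1 := ne z p pp zP; have n2 := ne z (p + h) wp zP.
    by move: n1 n2; rewrite opprD addrA; exact: expand.
  have bh2 : bcont (fun z => h * f2 z) a b c d.
    by apply: bc => z zP fz; exact: (ccontM (ccont_cst h z) (c2 z zP fz)).
  have bh12 : bcont (fun z => f1 z + h * f2 z) a b c d.
    apply: bc => z zP fz.
    exact: (ccontD (c1 z zP fz) (ccontM (ccont_cst h z) (c2 z zP fz))).
  have bh3 : bcont (fun z => h ^+ 2 * f3 (p + h) z) a b c d.
    by apply: bc => z zP fz; exact: (ccontM (ccont_cst (h ^+ 2) z) (c3 _ z wp zP fz)).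
  rewrite (rintD bh12 bh3) (rintD b1 bh2).
  rewrite (rintZ _ b2) (rintZ _ (b3 _ wp)) -/f1.
  by move: (rint _ _ _ _ _) (rint _ _ _ _ _) (rint _ _ _ _ _) => x1 x2 x3; ring.
rewrite cabsM cabsX expr2 mulrAC ler_wpM2r ?cabs_ge0//.
apply: (@le_trans _ _ (cabs h * L)).
  rewrite ler_wpM2l ?cabs_ge0//; apply: (cabs_rint ab cd); first exact: b3.
  move=> z zP; rewrite /f3 /f2 /f1 !cabsM !cabsV.
  have := rP p z pp zP; have := rP (p + h) z wp zP => z1 z2.
  by rewrite !ler_pM ?mulr_ge0 ?invr_ge0 ?cabs_ge0 ?fM// lef_pV2 ?posrE// (lt_le_trans r0).
apply: (@le_trans _ _ (e / (L + 1) * L)); first by rewrite ler_wpM2r// ltW.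
by rewrite mulrAC ler_pdivrMr ?ltr_wpDl// ler_pM2l// lerDl.
Qed.

End MaximumModulus.

(** * Removable singularities *)

Section Removable.
Variable R : realType.
Local Notation C := R[i].
Implicit Types f g : C -> C.

(** The hypothesis says f = O(|z|^(-1/2)) without square roots, so z^2 f = O(|z|^(3/2)) has
    derivative 0 at the origin. *)
Lemma cdiff_mulsq0 f (rho K : R) : 0 < rho -> 0 <= K ->
  (forall z, 0 < cabs z < rho -> cabs z * cabs (f z) ^+ 2 <= K) ->
  cdiff (fun z => z ^+ 2 * f z) 0.
Proof.
move=> rho0 K0 fK; exists 0 => e e0.
exists (Num.min rho (e ^+ 2 / (K + 1))).
  by rewrite lt_min rho0 divr_gt0 ?exprn_gt0// ltr_wpDl.
move=> h; rewrite lt_min => /andP[h1 h2].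
rewrite add0r mul0r subr0 expr0n /= mul0r subr0.
have [->|h0] := eqVneq h (0 : C); first by rewrite expr0n mul0r cabs0 mulr0.
have hp : 0 < cabs h by rewrite cabs_gt0.
rewrite cabsM cabsX expr2 -mulrA (mulrC e) ler_pM2l//.
rewrite -ler_sqr ?nnegrE ?mulr_ge0 ?cabs_ge0 ?(ltW e0)// exprMn expr2 -mulrA.
apply: (@le_trans _ _ (cabs h * K)); first by rewrite ler_pM2l// fK// hp.
apply: (@le_trans _ _ (cabs h * (K + 1))); first by rewrite ler_pM2l// lerDl.
by rewrite -ler_pdivlMr ?ltr_wpDl// ltW.
Qed.

(* [z ^+ 2 * f z] is holomorphic at 0, and Cauchy's formula for it shows that
   [w ^+ 2 * f w] differs from [w ^+ 2 * A w / I w], [A] and [I] being Cauchy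
   transforms, by [(B1 + w * B0) / I w] with constants [B1] and [B0]; the growth
   bound on [f] forces [B1 = B0 = 0]. *)
Lemma removable f (rho K : R) : 0 < rho ->
  (forall z, 0 < cabs z < rho -> cdiff f z) ->
  (forall z, 0 < cabs z < rho -> cabs z * cabs (f z) ^+ 2 <= K) ->
  exists (r : R) (g : C -> C), [/\ 0 < r, forall z, cabs z < r -> cdiff g z
    & forall z, 0 < cabs z < r -> g z = f z].
Proof.
move=> rho0 fd fK; pose d := rho / 3.
have d0 : 0 < d by rewrite divr_gt0.
have dd : - d <= d by rewrite ge0_cp ?ltW.
have K0 : 0 <= K.
  have dr : 0 < cabs (d%:C : C) < rho.
    rewrite cabs_real gtr0_norm// d0 /d; clear -rho0; lra.
  by apply: le_trans (fK _ dr); rewrite mulr_ge0 ?exprn_ge0 ?cabs_ge0.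
pose g0 (z : C) : C := z ^+ 2 * f z.
have rectP z : in_rect (- d) d (- d) d z -> cabs z < rho.
  move=> [/andP[h1 h2] /andP[h3 h4]]; apply: le_lt_trans (cabs_le _) _.
  have i1 : `|complex.Re z| <= d by rewrite ler_norml h1 h2.
  have i2 : `|complex.Im z| <= d by rewrite ler_norml h3 h4.
  by move: i1 i2; rewrite /d; clear -rho0; lra.
have intP z : cabs z < d -> int_rect (- d) d (- d) d z.
  move=> zd; have := normRe_le z; have := normIm_le z.
  by rewrite /int_rect -!ltr_norml => i1 i2; split; exact: le_lt_trans zd.
have g0d z : in_rect (- d) d (- d) d z -> cdiff g0 z.
  move=> /rectP zr; have [->|z0] := eqVneq z (0 : C); first exact: cdiff_mulsq0 fK.
  apply: cdiffM; first by apply: cdiffX; exact: cdiff_id.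
  by apply: fd; rewrite cabs_gt0 z0.
have bd z : on_bdry (- d) d (- d) d z -> 0 < cabs z < rho.
  move=> zb; rewrite rectP ?andbT; last exact: on_bdry_rect zb.
  rewrite cabs_gt0; apply/eqP => z0; move: zb; rewrite z0 => -[[x _]|[x _]] [] [] H1 H2;
    by move: d0; rewrite -?H2 -?H1 ?oppr_gt0 -?oppr_eq0 ?opprK; move: H1 H2; clear; lra.
have bc g : (forall z, on_bdry (- d) d (- d) d z -> ccont g z) -> bcont g (- d) d (- d) d.
  move=> H; split=> x xP; apply: H.
  - by left; exists x => //; left.
  - by left; exists x => //; right.
  - by right; exists x => //; left.
  - by right; exists x => //; right.
have fc z : on_bdry (- d) d (- d) d z -> ccont f z by move=> /bd /fd; exact: cdiff_cont.
pose A w := rint (fun z => f z * (z - w)^-1) (- d) d (- d) d.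
pose I w : C := rint (fun z => (z - w)^-1) (- d) d (- d) d.
pose B0 := rint f (- d) d (- d) d.
pose B1 := rint (fun z => z * f z) (- d) d (- d) d.
have I_neq0 w : cabs w < d -> I w != 0 by move=> /intP wP; exact: rint_inv_neq0.
have AE w : cabs w < d -> g0 w * I w = B1 + w * B0 + w ^+ 2 * A w.
  move=> /intP wP; rewrite -(cauchy_rect wP g0d).
  have bi := bcont_inv dd dd wP.
  have b1 : bcont (fun z => z * f z) (- d) d (- d) d.
    by apply: bc => z zb; exact: ccontM (ccont_id z) (fc z zb).
  have b0 : bcont f (- d) d (- d) d by apply: bc.
  have bA : bcont (fun z => f z * (z - w)^-1) (- d) d (- d) d.
    have [f1 f2 f3 f4] := b0; have [i1 i2 i3 i4] := bi.
    split=> x xP; [exact: ccontM (f1 x xP) (i1 x xP)|exact: ccontM (f2 x xP) (i2 x xP)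
      |exact: ccontM (f3 x xP) (i3 x xP)|exact: ccontM (f4 x xP) (i4 x xP)].
  have bw0 : bcont (fun z => w * f z) (- d) d (- d) d.
    by apply: bc => z zb; exact: ccontM (ccont_cst w z) (fc z zb).
  have bwA : bcont (fun z => w ^+ 2 * (f z * (z - w)^-1)) (- d) d (- d) d.
    have [f1 f2 f3 f4] := bA.
    split=> x xP; apply: (ccontM (ccont_cst (w ^+ 2) _)); auto.
  have b10 : bcont (fun z => z * f z + w * f z) (- d) d (- d) d.
    have [f1 f2 f3 f4] := b1; have [i1 i2 i3 i4] := bw0.
    split=> x xP; [exact: ccontD (f1 x xP) (i1 x xP)|exact: ccontD (f2 x xP) (i2 x xP)
      |exact: ccontD (f3 x xP) (i3 x xP)|exact: ccontD (f4 x xP) (i4 x xP)].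
  rewrite /B1 /B0 /A -(rintZ w b0) -(rintZ (w ^+ 2) bA) -(rintD b1 bw0) -(rintD b10 bwA).
  apply: eq_rint => z zb.
  have zw : z - w != 0.
    apply/eqP => /eqP; rewrite subr_eq0 => /eqP zw; rewrite -zw in wP.
    case: wP => /andP[h1 h2] /andP[h3 h4].
    case: zb h1 h2 h3 h4 => [[x _ [->|->]]|[x _ [->|->]]] /=; rewrite ?ltxx//.
  by rewrite /g0; field; rewrite zw.
have AI w : cabs w < d -> cdiff A w /\ cdiff I w.
  move=> /intP wP; split.
    by apply: cdiff_cauchy_transform => //; exact: bc.
  have -> : I = (fun w => rint (fun z => 1 * (z - w)^-1) (- d) d (- d) d).
    by apply/funext => u; apply: eq_rint => z _; rewrite mul1r.
  apply: cdiff_cauchy_transform => //; apply: bc => z _; exact: ccont_cst.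
have d00 : cabs (0 : C) < d by rewrite cabs0.
have B10 : B1 = 0.
  by have := AE 0 d00; rewrite /g0 expr0n /= !mul0r !addr0 => <-.
have B00 : B0 = 0.
  have [/cdiff_cont Ac /cdiff_cont Ic] := AI 0 d00.
  have nb g : ccont g 0 -> exists2 r, 0 < r & forall w, cabs w < r -> cabs (g w) <= cabs (g 0) + 1.
    move=> /ccontP /(_ 1 ltr01) [r r0 rP]; exists r => // w wr.
    have := rP w; rewrite subr0 => /(_ wr) /ltW H.
    by rewrite -(subrK (g 0) (g w)) addrC; apply: le_trans (cabsD _ _) _; rewrite lerD2l.
  have [r1 r10 r1P] := nb _ Ac; have [r2 r20 r2P] := nb _ Ic.
  set a := cabs (A 0) + 1 in r1P; set i := cabs (I 0) + 1 in r2P.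
  have a0 : 0 < a by rewrite ltr_wpDl// cabs_ge0.
  have i0 : 0 < i by rewrite ltr_wpDl// cabs_ge0.
  apply/eqP; rewrite -cabs_eq0 eq_le cabs_ge0 andbT; apply/ler_addgt0Pr => e e0; rewrite add0r.
  (* At the point [w] of modulus t / 2, the bounds [r1] and [r2] control the two Cauchy transforms
     by [a] and [i]; the last two entries then make |w A w| and |w f(w) I w| at most e / 2 each. *)
  pose t := Num.min (Num.min (Num.min r1 r2) (d / 2)) (Num.min (e / (2 * a)) ((e / (2 * i)) ^+ 2 / (K + 1))).
  have t0 : 0 < t by rewrite !lt_min r10 r20 !divr_gt0 ?exprn_gt0 ?divr_gt0 ?mulr_gt0// ltr_wpDl.
  have t_lt : t / 2 < t by rewrite ltr_pdivrMr// ltr_pMr// ltr1n.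
  pose w : C := (t / 2)%:C.
  have wt : cabs w < t by rewrite cabs_real gtr0_norm ?divr_gt0.
  have w0 : 0 < cabs w by rewrite cabs_real gtr0_norm ?divr_gt0.
  move: (wt); rewrite !lt_min => /andP[/andP[/andP[w1 w2] w3] /andP[w4 w5]].
  have wd : cabs w < d by apply: lt_trans w3 _; rewrite ltr_pdivrMr// ltr_pMr// ltr1n.
  have E : B0 = w * f w * I w - w * A w.
    have wn0 : w != 0 by rewrite -cabs_gt0.
    apply: (mulfI wn0); have := AE w wd; rewrite /g0 B10 add0r => H.
    have -> : w * B0 = w ^+ 2 * f w * I w - w ^+ 2 * A w by rewrite H addrK.
    by move: (f w) (I w) (A w) => x1 x2 x3; ring.
  rewrite E; apply: le_trans (cabsB _ _) _; rewrite !cabsM.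
  have wf : cabs w * cabs (f w) <= e / (2 * i).
    have ei : 0 <= e / (2 * i) by rewrite divr_ge0 ?(ltW e0)// mulr_ge0// ltW.
    have wf0 : 0 <= cabs w * cabs (f w) by rewrite mulr_ge0 ?cabs_ge0.
    rewrite -ler_sqr ?nnegrE// exprMn expr2 -mulrA.
    apply: (@le_trans _ _ (cabs w * (K + 1))).
      rewrite ler_pM2l//; apply: (@le_trans _ _ K); last by rewrite lerDl.
      by apply: fK; rewrite w0 (lt_trans wd)// /d; clear -rho0; lra.
    by rewrite -ler_pdivlMr ?ltr_wpDl// ltW.
  have k1 : cabs w * cabs (f w) * cabs (I w) <= e / (2 * i) * i.
    by apply: ler_pM => //; rewrite ?mulr_ge0 ?cabs_ge0//; exact: r2P.
  have k2 : cabs w * cabs (A w) <= e / (2 * a) * a.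
    by apply: ler_pM; rewrite ?cabs_ge0 ?(ltW w4)//; exact: r1P.
  apply: le_trans (lerD k1 k2) _.
  have -> : e / (2 * i) * i = e / 2 by field; rewrite gt_eqF.
  have -> : e / (2 * a) * a = e / 2 by field; rewrite gt_eqF.
  by rewrite -splitr.
exists d, (fun w => A w * (I w)^-1); split => // [w wd|w /andP[w0 wd]].
  have [Ad Id] := AI w wd.
  by apply: (cdiffM Ad); apply: cdiffV => //; exact: I_neq0.
have := AE w wd; rewrite B10 B00 mulr0 !add0r /g0 -mulrA.
have wn0 : w ^+ 2 != 0 by rewrite expf_neq0// -cabs_gt0.
by move=> /(mulfI wn0) <-; rewrite mulfK// I_neq0.
Qed.

End Removable.

(** * Bounding the Laplacian by barriers *)

Section ComplexExponential.
Variable R : realType.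
Local Notation C := R[i].
Implicit Types f g : C -> C.

Lemma is_derive_eps (f : R -> R) (x l : R) : is_derive x 1 f l ->
  forall e : R, 0 < e -> exists2 d : R, 0 < d & forall h, `|h| < d ->
    `|f (x + h) - f x - l * h| <= e * `|h|.
Proof.
move=> [fx fl] e e0.
have : (fun h => h^-1 *: ((f \o shift x) (h *: 1) - f x)) @ 0^' --> l.
  by rewrite -fl; exact: fx.
move=> /cvgrPdist_le /(_ e e0); rewrite near_withinE => /nbhs_ballP[d /= d0 dP].
exists d => // h hd; have [->|h0] := eqVneq h 0.
  by rewrite addr0 mulr0 !subrr normr0 mulr0.
have := dP h; rewrite /ball /= sub0r normrN => /(_ hd h0).
rewrite /GRing.scale /= mulr1 (addrC h) => H.
have -> : f (x + h) - f x - l * h = - (l - h^-1 * (f (x + h) - f x)) * h.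
  by field.
by rewrite normrM normrN ler_wpM2r.
Qed.

Definition cexp (z : C) : C :=
  (expR (complex.Re z) * cos (complex.Im z)) +i* (expR (complex.Re z) * sin (complex.Im z)).

Lemma cexp0 : cexp 0 = 1.
Proof. by apply: eqC; rewrite /= expR0 ?cos0 ?sin0 ?mulr1 ?mulr0. Qed.

Lemma cexpD z w : cexp (z + w) = cexp z * cexp w.
Proof.
apply: eqC; rewrite ?ReM ?ImM /= ReD ImD expRD.
  by rewrite cosD; ring.
by rewrite sinD; ring.
Qed.

Lemma cabs_cexp z : cabs (cexp z) = expR (complex.Re z).
Proof.
apply/eqP; rewrite -(eqrXn2 (n:=2)) ?cabs_ge0 ?expR_ge0// sqr_cabs /=.
by rewrite !exprMn -mulrDr cos2Dsin2 mulr1.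
Qed.

Lemma cexp_neq0 z : cexp z != 0.
Proof. by rewrite -cabs_gt0 cabs_cexp expR_gt0. Qed.

Lemma cexp_near0 (e : R) : 0 < e -> exists2 d : R, 0 < d & forall h : C, cabs h < d ->
  cabs (cexp h - 1 - h) <= e * cabs h.
Proof.
move=> e0; pose e1 := Num.min 1 (e / 8).
have e10 : 0 < e1 by rewrite lt_min ltr01 divr_gt0.
have [e11 e1e] : e1 <= 1 /\ 8 * e1 <= e.
  split; first by rewrite ge_min lexx.
  by rewrite mulrC -ler_pdivlMr// ge_min lexx orbT.
have [d1 d10 d1P] := is_derive_eps (is_derive_expR (0 : R)) e10.
have [d2 d20 d2P] := is_derive_eps (is_derive_cos (0 : R)) e10.
have [d3 d30 d3P] := is_derive_eps (is_derive_sin (0 : R)) e10.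
exists (Num.min (Num.min d1 d2) (Num.min d3 (e1 / 2))).
  by rewrite !lt_min d10 d20 d30 divr_gt0.
move=> h; rewrite !lt_min => /andP[/andP[h1 h2] /andP[h3 h4]].
case: h h1 h2 h3 h4 => x y; set r := cabs _ => h1 h2 h3 h4.
have xr : `|x| <= r := normRe_le (x +i* y).
have yr : `|y| <= r := normIm_le (x +i* y).
have r0 : 0 <= r by exact: cabs_ge0.
clearbody e1.
have := d1P x (le_lt_trans xr h1); have := d2P y (le_lt_trans yr h2).
have := d3P y (le_lt_trans yr h3).
rewrite !add0r expR0 cos0 sin0 !mul1r oppr0 mul0r !addr0 !subr0 => s c ex.
have es : e1 * `|y| <= e1 * r by rewrite ler_wpM2l// ltW.
have exx : e1 * `|x| <= e1 * r by rewrite ler_wpM2l// ltW.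
have e1r : e1 * r <= r by rewrite ler_piMl.
have ex1 : `|expR x - 1| <= 2 * r.
  have -> : expR x - 1 = (expR x - 1 - x) + x by rewrite subrK.
  apply: le_trans (ler_normD _ _) _; move: ex exx xr e1r; clear; lra.
have ex2 : `|expR x| <= 2.
  have -> : expR x = (expR x - 1) + 1 by rewrite subrK.
  apply: le_trans (ler_normD _ _) _; rewrite normr1.
  by move: ex1 h4 e11; clear; lra.
apply: le_trans (cabs_le _) _; rewrite !(ReD, ImD, ReN, ImN) /= subr0.
have -> : expR x * cos y - 1 - x = (expR x - 1 - x) + expR x * (cos y - 1) by ring.
have -> : expR x * sin y - y = expR x * (sin y - y) + (expR x - 1) * y by ring.
have t1 : `|expR x * (cos y - 1)| <= 2 * (e1 * r).
  by rewrite normrM ler_pM// (le_trans c).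
have t2 : `|expR x * (sin y - y)| <= 2 * (e1 * r).
  by rewrite normrM ler_pM// (le_trans s).
have t3 : `|(expR x - 1) * y| <= e1 * r.
  rewrite normrM; apply: (@le_trans _ _ (2 * r * r)); first exact: ler_pM.
  by rewrite ler_wpM2r//; move: h4; clear; lra.
have t4 := ler_normD (expR x - 1 - x) (expR x * (cos y - 1)).
have t5 := ler_normD (expR x * (sin y - y)) ((expR x - 1) * y).
have : 8 * (e1 * r) <= e * r by rewrite mulrA ler_wpM2r.
have : 0 <= e1 * r by exact: mulr_ge0 (ltW e10) r0.
by move: t1 t2 t3 t4 t5 ex exx; clear; lra.
Qed.

Lemma cdiff_cexp z : cdiff cexp z.
Proof.
exists (cexp z) => e e0.
have z0 : 0 < cabs (cexp z) by rewrite cabs_gt0 cexp_neq0.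
have [d d0 dP] := cexp_near0 (divr_gt0 e0 z0).
exists d => // h /dP H.
have -> : cexp (z + h) - cexp z - cexp z * h = cexp z * (cexp h - 1 - h).
  by rewrite cexpD; ring.
by rewrite cabsM mulrC -ler_pdivlMr// mulrAC.
Qed.

End ComplexExponential.

(** * Calculus of lower Laplacian bounds *)

Section LaplacianBound.
Variable R : realType.
Local Notation C := R[i].
Local Notation Co := (R[i]^o).
Implicit Types (f g F : C -> C) (u v : C -> R).

(* [lap_ge u z0 c] expresses in barrier form that the (1,1)-derivative of [u]
   at [z0] is at least [c]: up to a pluriharmonic term [ln |F|], the function
   [u] has a minorant of the form [c' |z - z0|^2] at [z0] for every [c' < c]. *)
Variant lap_ge (u : C -> R) (z0 : C) (c : R) : Prop := LapGe of
  forall c', c' < c -> exists2 F : C -> C, F z0 = 1 &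
    \forall z \near (z0 : Co), cdiff F z /\
      cabs (F z) <= expR (u z - u z0 - c' * cabs (z - z0) ^+ 2).

(** At a local maximum of [u] the barrier function would satisfy F z0 = 1 and |F z| <= exp(- c/2 |z
    - z0|^2) nearby, against the maximum modulus principle. *)
Lemma lap_ge_no_max u z0 c : 0 < c -> lap_ge u z0 c ->
  ~ (\forall z \near (z0 : Co), u z <= u z0).
Proof.
move=> c0 [/(_ (c / 2))]; rewrite ltr_pdivrMr// ltr_pMr// ltr1n => /(_ isT)[F F1 nF] nu.
have /nbhsC[d d0 dP] : \forall z \near (z0 : Co), cdiff F z /\
    cabs (F z) <= expR (- (c / 2 * cabs (z - z0) ^+ 2)).
  apply: filterS2 nF nu => z [Fz zF] uz; split => //; apply: le_trans zF _.
  by rewrite ler_expR gerDr subr_le0.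
have d3 : 0 < d / 3 by rewrite divr_gt0.
have dl z : cabs (z - z0) <= 2 * (d / 3) -> cabs (z - z0) < d.
  by move=> H; apply: le_lt_trans H _; clear -d0; lra.
apply: (@no_strict_max R F z0 (expR (- (c / 2 * (d / 3) ^+ 2))) _ d3) => //.
- by rewrite expR_lt1 oppr_lt0 !mulr_gt0 ?exprn_gt0 ?divr_gt0.
- by move=> z /dl /dP[].
- move=> z /andP[zd /dl /dP[_ Fz]]; apply: le_trans Fz _.
  rewrite ler_expR lerN2 ler_pM2l ?divr_gt0//.
  by rewrite lerXn2r ?nnegrE ?cabs_ge0// ltW.
Qed.

Lemma lap_ge_le u z0 c c1 : c1 <= c -> lap_ge u z0 c -> lap_ge u z0 c1.
Proof. by move=> cc [uc]; split=> c' c'c; apply: uc; exact: lt_le_trans cc. Qed.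

Lemma lap_geD u v z0 c1 c2 : lap_ge u z0 c1 -> lap_ge v z0 c2 ->
  lap_ge (fun z => u z + v z) z0 (c1 + c2).
Proof.
move=> [uc] [vc]; split=> c' c'lt; pose e := (c1 + c2 - c') / 2.
have e0 : 0 < e by rewrite divr_gt0// subr_gt0.
have [|F F1 nF] := uc (c1 - e); first by rewrite gtrBl.
have [|G G1 nG] := vc (c2 - e); first by rewrite gtrBl.
exists (fun z => F z * G z); first by rewrite F1 G1 mulr1.
apply: filterS2 nF nG => z [Fd Fz] [Gd Gz]; split; first exact: cdiffM.
rewrite cabsM; have -> : u z + v z - (u z0 + v z0) - c' * cabs (z - z0) ^+ 2 =
    (u z - u z0 - (c1 - e) * cabs (z - z0) ^+ 2) +
    (v z - v z0 - (c2 - e) * cabs (z - z0) ^+ 2) by rewrite /e; field.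
by rewrite expRD; apply: ler_pM; rewrite ?cabs_ge0.
Qed.

Lemma lap_ge_near u v z0 c : (\forall z \near (z0 : Co), u z = v z) ->
  lap_ge u z0 c -> lap_ge v z0 c.
Proof.
move=> uv [uc]; split=> c' /uc[F F1 nF]; exists F => //.
have uv0 := nbhs_singleton uv.
by apply: filterS2 uv nF => z <-; rewrite uv0.
Qed.

Lemma lap_ge_cst (k : R) z0 : lap_ge (fun=> k) z0 0.
Proof.
split=> c' c'0; exists (fun=> 1) => //; apply: filterE => z; split; first exact: cdiff_cst.
rewrite cabs1 subrr sub0r -[leLHS]expR0 ler_expR oppr_ge0.
by rewrite mulr_le0_ge0 ?sqr_ge0 ?ltW.
Qed.

Lemma lap_ge_Re g z0 : (\forall z \near (z0 : Co), cdiff g z) ->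
  lap_ge (fun z => complex.Re (g z)) z0 0.
Proof.
move=> ng; split=> c' c'0; exists (fun z => cexp (g z - g z0)); first by rewrite subrr cexp0.
apply: filterS ng => z gz; split.
  exact: (cdiff_comp (cdiffB gz (cdiff_cst (g z0) z)) (cdiff_cexp _)).
rewrite cabs_cexp ReD ReN ler_expR lerDl oppr_ge0.
by rewrite mulr_le0_ge0 ?sqr_ge0 ?ltW.
Qed.

Lemma ccont_neq0 f (z0 : C) : ccont f z0 -> f z0 != 0 ->
  \forall z \near (z0 : Co), f z != 0.
Proof.
move=> /ccontP fc fz0; have := fc (cabs (f z0)); rewrite cabs_gt0 => /(_ fz0)/nbhsC.
apply: filterS => z fz; apply/eqP => f0; move: fz.
by rewrite f0 sub0r cabsN ltxx.
Qed.

Lemma lap_ge_ln_cabs f z0 : (\forall z \near (z0 : Co), cdiff f z) -> f z0 != 0 ->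
  lap_ge (fun z => ln (cabs (f z))) z0 0.
Proof.
move=> nf f0; split=> c' c'0; exists (fun z => (f z0)^-1 * f z); first by rewrite mulVf.
have fc := cdiff_cont (nbhs_singleton nf).
apply: filterS2 nf (ccont_neq0 fc f0) => z fd fz; split.
  exact: (cdiffM (cdiff_cst _ _) fd).
rewrite cabsM cabsV expRD.
rewrite expRB !lnK ?posrE ?cabs_gt0// mulrC ler_peMr ?mulr_ge0 ?invr_ge0 ?cabs_ge0//.
by rewrite -expR0 ler_expR oppr_ge0 mulr_le0_ge0 ?sqr_ge0 ?ltW.
Qed.

Lemma lap_geN_ln_cabs f z0 : (\forall z \near (z0 : Co), cdiff f z) -> f z0 != 0 ->
  lap_ge (fun z => - ln (cabs (f z))) z0 0.
Proof.
move=> nf f0; have fc := cdiff_cont (nbhs_singleton nf).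
have nf0 := ccont_neq0 fc f0.
apply: (@lap_ge_near (fun z => ln (cabs ((f z)^-1)))).
  by apply: filterS nf0 => z fz; rewrite cabsV lnV// posrE cabs_gt0.
apply: lap_ge_ln_cabs; last by rewrite invr_eq0.
by apply: filterS2 nf nf0 => z fd fz; exact: cdiffV.
Qed.

(** [m z0] is |g' z0|, the conformal factor. It enters through an exact identity because for the
    maps in use, rotations and the square, [m] is explicit: 1 and |z + z0|. *)
Lemma lap_ge_comp u g (m : C -> R) z0 c :
  (\forall z \near (z0 : Co), cdiff g z) ->
  (forall z, cabs (g z - g z0) = m z * cabs (z - z0)) ->
  rcont m z0 ->
  lap_ge u (g z0) c -> lap_ge (fun z => u (g z)) z0 (c * m z0 ^+ 2).
Proof.
move=> ng gm mc [uc]; split=> c' c'lt; pose e := (c * m z0 ^+ 2 - c') / (2 * (m z0 ^+ 2 + 1)).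
have m1 : 0 < m z0 ^+ 2 + 1 by rewrite ltr_wpDl// sqr_ge0.
have e0 : 0 < e by rewrite divr_gt0 ?subr_gt0// mulr_gt0.
have [|F F1 nF] := uc (c - e); first by rewrite gtrBl.
exists (fun z => F (g z)) => //.
have [gc] : ccont g z0 := cdiff_cont (nbhs_singleton ng).
have c'm : c' < (c - e) * (m z0 * m z0).
  rewrite -expr2.
  have : e * (m z0 ^+ 2 + 1) = (c * m z0 ^+ 2 - c') / 2.
    by rewrite /e; field; rewrite gt_eqF.
  by rewrite mulrBl mulrDr mulr1; move: e0 c'lt; clear; lra.
have nm : \forall z \near (z0 : Co), c' < (c - e) * (m z * m z).
  apply: (@rcont_gt R (fun z => (c - e) * (m z * m z))) => //.
  exact: (rcontM (rcont_cst _ _) (rcontM mc mc)).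
have nFg : \forall z \near (z0 : Co), cdiff F (g z) /\
    cabs (F (g z)) <= expR (u (g z) - u (g z0) - (c - e) * cabs (g z - g z0) ^+ 2).
  exact: (gc _ nF).
apply: filterS3 nFg nm ng => z [Fd Fz] mz gz; split.
  exact: (cdiff_comp gz Fd).
apply: le_trans Fz _; rewrite ler_expR lerD2l lerN2 gm exprMn (expr2 (m z)) [leRHS]mulrA.
exact: (ler_wpM2r (sqr_ge0 _) (ltW mz)).
Qed.

Lemma lap_ge_conj u z0 c : lap_ge u z0^*%C c -> lap_ge (fun z => u z^*%C) z0 c.
Proof.
have cJ (z : C) : cabs z^*%C = cabs z.
  by apply: (@complexI R); rewrite -!normC_cabs normcJ.
have JB (z w : C) : z^*%C - w^*%C = (z - w)^*%C by rewrite (rmorphB (@conjc R)).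
have JD (z w : C) : z^*%C + w^*%C = (z + w)^*%C by rewrite (rmorphD (@conjc R)).
have JM (z w : C) : z^*%C * w^*%C = (z * w)^*%C by rewrite (rmorphM (@conjc R)).
move=> [uc]; split=> c' /uc[F F1 /nbhsC[d d0 dP]].
exists (fun z => (F z^*%C)^*%C); first by rewrite F1 conjc1.
apply/nbhsC; exists d => // z zd; have := dP z^*%C.
rewrite JB cJ => /(_ zd)[[l lP] Fz]; split; last by rewrite cJ.
exists l^*%C => e /lP[r r0 rP]; exists r => // h hr.
have := rP h^*%C; rewrite cJ => /(_ hr).
have -> : (F (z + h)^*%C)^*%C - (F z^*%C)^*%C - l^*%C * h =
    (F (z^*%C + h^*%C) - F z^*%C - l * h^*%C)^*%C.
  by rewrite -!JB -JM conjcK JD.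
by rewrite cJ.
Qed.

Lemma lap_ge_sum n (u : 'I_n -> C -> R) z0 c : (forall i, lap_ge (u i) z0 c) ->
  lap_ge (fun z => \sum_(i < n) u i z) z0 (n%:R * c).
Proof.
elim: n u => [|n IH] u uc.
  apply: (@lap_ge_near (fun=> 0)); first by apply: filterE => z; rewrite big_ord0.
  by rewrite mul0r; exact: lap_ge_cst.
apply: (@lap_ge_near (fun z => \sum_(i < n) u (widen_ord (leqnSn n) i) z + u ord_max z)).
  by apply: filterE => z; rewrite big_ord_recr.
by rewrite -natr1 mulrDl mul1r; apply: lap_geD => //; exact: IH.
Qed.

(* [c] is the mixed Wirtinger derivative (one fourth of the Laplacian) of [u] at
   [z0]; the real part of a holomorphic polynomial does not affect [lap_ge]. *)
Variant taylor2 (u : C -> R) (z0 a b : C) (c : R) : Prop := Taylor2 of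
  forall e : R, 0 < e -> \forall z \near (z0 : Co),
    `|u z - u z0 - complex.Re (a * (z - z0) + b * (z - z0) ^+ 2)
      - c * cabs (z - z0) ^+ 2| <= e * cabs (z - z0) ^+ 2.

Lemma taylor2_lap_ge u z0 a b c : taylor2 u z0 a b c -> lap_ge u z0 c.
Proof.
move=> [uT]; split=> c' c'c; pose g z := a * (z - z0) + b * (z - z0) ^+ 2.
exists (fun z => cexp (g z)).
  by rewrite /g subrr expr0n !mulr0 addr0 cexp0.
have : 0 < c - c' by rewrite subr_gt0.
move=> /uT; apply: filterS => z uz; split.
  suff gd : cdiff g z by exact: (cdiff_comp gd (cdiff_cexp _)).
  have id0 : cdiff (fun z => z - z0) z by exact: (cdiffB (cdiff_id z) (cdiff_cst z0 z)).
  exact: (cdiffD (cdiffM (cdiff_cst a z) id0) (cdiffM (cdiff_cst b z) (cdiffX 2 id0))).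
rewrite cabs_cexp ler_expR /g; move: uz; rewrite ler_norml => /andP[+ _].
rewrite mulrBl; move: (complex.Re _) (u z) (u z0) (c * _) (c' * _) => x1 x2 x3 x4 x5.
by clear; lra.
Qed.

Lemma taylor2N u z0 a b c : taylor2 u z0 a b c ->
  taylor2 (fun z => - u z) z0 (- a) (- b) (- c).
Proof.
move=> [uT]; split=> e /uT; apply: filterS => z.
have -> : - u z - - u z0 - complex.Re (- a * (z - z0) + - b * (z - z0) ^+ 2)
      - - c * cabs (z - z0) ^+ 2 =
    - (u z - u z0 - complex.Re (a * (z - z0) + b * (z - z0) ^+ 2) - c * cabs (z - z0) ^+ 2).
  have -> : - a * (z - z0) + - b * (z - z0) ^+ 2 = - (a * (z - z0) + b * (z - z0) ^+ 2).
    by rewrite !mulNr opprD.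
  by rewrite ReN; ring.
by rewrite normrN.
Qed.

End LaplacianBound.

(** * Second-order expansions on a line and of radial functions *)

Section Taylor.
Variable R : realType.
Local Notation C := R[i].

Lemma der_shift (f : R -> R) (x c l : R) : is_derive (c + x) 1 f l ->
  is_derive x 1 (fun t => f (c + t)) l.
Proof.
move=> fl; have H : is_derive x 1 (fun t : R => c + t) (0 + 1).
  exact: (@is_deriveD R R R (cst c) id x 1 0 1 (is_derive_cst c x 1) (is_derive_id x 1)).
have := @is_derive1_comp R f (fun t : R => c + t) x l (0 + 1) fl H.
by rewrite add0r mulr1.
Qed.

Lemma derB (f g : R -> R) (x a b : R) : is_derive x 1 f a -> is_derive x 1 g b ->
  is_derive x 1 (fun t => f t - g t) (a - b).
Proof. by move=> fa gb; exact: (@is_deriveB R R R f g x 1 a b fa gb). Qed.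

Lemma derD (f g : R -> R) (x a b : R) : is_derive x 1 f a -> is_derive x 1 g b ->
  is_derive x 1 (fun t => f t + g t) (a + b).
Proof. by move=> fa gb; exact: (@is_deriveD R R R f g x 1 a b fa gb). Qed.

Lemma derZ (k : R) (f : R -> R) (x a : R) : is_derive x 1 f a ->
  is_derive x 1 (fun t => k * f t) (k * a).
Proof. by move=> fa; exact: (@is_deriveZ R R R f k x 1 a fa). Qed.

Lemma derM (f g : R -> R) (x a b : R) : is_derive x 1 f a -> is_derive x 1 g b ->
  is_derive x 1 (fun t => f t * g t) (a * g x + f x * b).
Proof.
move=> fa gb; apply: is_derive_eq (@is_deriveM R R f g x 1 a b fa gb) _.
by rewrite addrC; congr (_ + _); rewrite /GRing.scale /= mulrC.
Qed.

Lemma mvt_le (f df : R -> R) (k M : R) :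
  (forall x : R, `|x| <= `|k| -> is_derive x 1 f (df x)) ->
  (forall x, `|x| <= `|k| -> `|df x| <= M) ->
  `|f k - f 0| <= M * `|k|.
Proof.
move=> fd fM.
have key a b : a <= b -> (forall x, a <= x <= b -> `|x| <= `|k|) ->
    `|f b - f a| <= M * (b - a).
  move=> ab abk.
  have [c /[!in_itv]/= cP ->] : exists2 c, c \in `[a, b] & f b - f a = df c * (b - a).
    apply: MVT_segment => //.
      by move=> x /[!in_itv]/= /andP[ax xb]; apply: fd; apply: abk; rewrite !ltW.
    apply: derivable_within_continuous => x /[!in_itv]/= xP.
    by have [] := fd x (abk x xP).
  rewrite normrM (@ger0_norm _ (b - a)) ?subr_ge0// ler_wpM2r ?subr_ge0//.
  by apply: fM; exact: abk.
have [k0|k0] := leP 0 k.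
  have := key 0 k k0; rewrite subr0 ger0_norm//; apply => x /andP[x0 xk].
  by rewrite !ger0_norm.
have := key k 0 (ltW k0); rewrite sub0r distrC ltr0_norm//; apply => x /andP[x0 xk].
by rewrite (ler0_norm xk) lerN2.
Qed.

(** The mean value theorem is applied to the second-order remainder, whose derivative is the
    first-order remainder of [b1]; hence [b1] is only required to be differentiable at [s0]
    itself. *)
Lemma taylor2_line (b b1 : R -> R) (s0 b2 : R) :
  (\forall s \near s0, is_derive (s : R) 1 b (b1 s)) -> is_derive s0 1 b1 b2 ->
  forall e : R, 0 < e -> exists2 d : R, 0 < d & forall k, `|k| < d ->
    `|b (s0 + k) - b s0 - b1 s0 * k - b2 / 2 * k ^+ 2| <= e * k ^+ 2.
Proof.
move=> /nbhs_ballP[r /= r0 rP] db1 e e0.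
have [d d0 dP] := is_derive_eps db1 e0.
exists (Num.min d r); first by rewrite lt_min d0.
move=> k; rewrite lt_min => /andP[kd kr].
pose f x := b (s0 + x) - b1 s0 * x - b2 / 2 * (x * x).
pose df x := b1 (s0 + x) - b1 s0 - b2 * x.
have := @mvt_le f df k (e * `|k|).
have -> : f k - f 0 = b (s0 + k) - b s0 - b1 s0 * k - b2 / 2 * k ^+ 2.
  by rewrite /f addr0 expr2; ring.
have -> : e * `|k| * `|k| = e * k ^+ 2 by rewrite -mulrA -expr2 real_normK ?num_real.
apply.
  move=> x xk; have Hb : is_derive (s0 + x) 1 b (b1 (s0 + x)).
    by apply: rP; rewrite /ball /= opprD addrA subrr sub0r normrN (le_lt_trans xk).
  have idx := is_derive_id x (1 : R).
  have := derB (derB (der_shift Hb) (derZ (b1 s0) idx)) (derZ (b2 / 2) (derM idx idx)).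
  rewrite /f /df => H; apply: is_derive_eq H _.
  by field.
move=> x xk; apply: le_trans (dP x (le_lt_trans xk kd)) _.
by rewrite ler_wpM2l// ltW.
Qed.


(** With h = z - z0 and W the product of h with the conjugate of z0, |z|^2 grows by 2 Re W + |h|^2.
    In the quadratic term, (Re W)^2 = (|W|^2 + Re W^2) / 2 separates the part in |h|^2 from the real
    part of a holomorphic polynomial. *)
Lemma taylor2_radial (b b1 : R -> R) (b2 : R) (z0 : C) :
  (\forall s \near (cabs z0 ^+ 2), is_derive (s : R) 1 b (b1 s)) ->
  is_derive (cabs z0 ^+ 2) 1 b1 b2 ->
  taylor2 (fun z => b (cabs z ^+ 2)) z0 ((2 * b1 (cabs z0 ^+ 2))%:C * z0^*%C)
    (b2%:C * z0^*%C ^+ 2) (b1 (cabs z0 ^+ 2) + b2 * cabs z0 ^+ 2).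
Proof.
move=> nb db; split=> e e0; set s0 := cabs z0 ^+ 2 in nb db *.
pose K := 1 + 2 * cabs z0; have K1 : 1 <= K by rewrite lerDl mulr_ge0 ?cabs_ge0.
have K0 : 0 < K by exact: lt_le_trans K1.
pose e1 := e / (2 * K ^+ 2).
have e10 : 0 < e1 by rewrite divr_gt0// mulr_gt0// exprn_gt0.
have [d d0 dP] := taylor2_line nb db e10.
pose L := `|b2| * K + 1; have L0 : 0 < L by rewrite ltr_wpDl// mulr_ge0// ltW.
apply/nbhsC; exists (Num.min (Num.min 1 (d / K)) (e / 2 / L)).
  by rewrite !lt_min ltr01 !divr_gt0.
move=> z; set h := z - z0; rewrite !lt_min => /andP[/andP[h1 hd] he].
have -> : z = z0 + h by rewrite /h addrC subrK.
set r := cabs h in h1 hd he *; have r0 : 0 <= r by exact: cabs_ge0.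
pose w := complex.Re (z0^*%C * h).
have wr : `|w| <= cabs z0 * r.
  apply: le_trans (normRe_le _) _; rewrite cabsM.
  have -> : cabs z0^*%C = cabs z0 by apply: (@complexI R); rewrite -!normC_cabs normcJ.
  by [].
have sE : cabs (z0 + h) ^+ 2 = s0 + (2 * w + r ^+ 2).
  rewrite /s0 /r /w !sqr_cabs ReM ReD ImD.
  by case: (z0) (h) => [x y] [u v] /=; ring.
set k := 2 * w + r ^+ 2 in sE.
have kK : `|k| <= K * r.
  have -> : K * r = 2 * (cabs z0 * r) + r by rewrite /K; ring.
  rewrite /k; apply: le_trans (ler_normD _ _) _.
  apply: lerD; first by rewrite normrM ger0_norm// ler_wpM2l.
  by rewrite ger0_norm ?sqr_ge0// expr2 ler_piMl// ltW.
have kd : `|k| < d by apply: le_lt_trans kK _; rewrite mulrC -ltr_pdivlMr.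
have := dP k kd; rewrite -sE.
have w2 : w ^+ 2 = (s0 * r ^+ 2 + complex.Re (z0^*%C ^+ 2 * h ^+ 2)) / 2.
  rewrite /w /s0 /r !sqr_cabs !expr2 !ReM.
  by case: (z0) (h) => [x y] [u v] /=; field.
have -> : complex.Re ((2 * b1 s0)%:C * z0^*%C * h + b2%:C * z0^*%C ^+ 2 * h ^+ 2) =
    2 * b1 s0 * w + b2 * complex.Re (z0^*%C ^+ 2 * h ^+ 2).
  move: (b1 s0) => B; rewrite /w !expr2; clear; move: (z0^*%C) => u.
  by rewrite !(ReD, ReM, ImM) /=; ring.
set X := complex.Re (_ ^+ 2 * _) in w2 *; set Y := b (cabs (z0 + h) ^+ 2).
have k2 : k ^+ 2 <= K ^+ 2 * r ^+ 2.
  by rewrite -exprMn -real_normK ?num_real// lerXn2r ?nnegrE ?mulr_ge0// ltW.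
have -> : Y - b s0 - (2 * b1 s0 * w + b2 * X) - (b1 s0 + b2 * s0) * r ^+ 2 =
   (Y - b s0 - b1 s0 * k - b2 / 2 * k ^+ 2) + b2 / 2 * (k ^+ 2 - 4 * w ^+ 2).
  by rewrite w2 /k; field.
move=> H; apply: le_trans (ler_normD _ _) _.
have -> : k ^+ 2 - 4 * w ^+ 2 = (k + 2 * w) * r ^+ 2 by rewrite /k; ring.
have t1 : e1 * k ^+ 2 <= e / 2 * r ^+ 2.
  apply: (@le_trans _ _ (e1 * (K ^+ 2 * r ^+ 2))); first by rewrite ler_wpM2l// ltW.
  by rewrite /e1 le_eqVlt; apply/orP; left; apply/eqP; field; rewrite gt_eqF.
have t2 : `|b2 / 2 * ((k + 2 * w) * r ^+ 2)| <= e / 2 * r ^+ 2.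
  rewrite mulrA normrM (@ger0_norm _ (r ^+ 2)) ?sqr_ge0// ler_wpM2r ?sqr_ge0//.
  have kw : `|k + 2 * w| <= 2 * (K * r).
    have -> : 2 * (K * r) = K * r + K * r by ring.
    apply: le_trans (ler_normD _ _) _; apply: lerD => //.
    rewrite normrM ger0_norm//; apply: (@le_trans _ _ (2 * (cabs z0 * r))); first by rewrite ler_wpM2l.
    by rewrite mulrA ler_wpM2r// /K lerDr.
  rewrite normrM normrM normfV (@ger0_norm _ 2)//.
  apply: (@le_trans _ _ (`|b2| / 2 * (2 * (K * r)))); first by rewrite ler_wpM2l// divr_ge0.
  have -> : `|b2| / 2 * (2 * (K * r)) = `|b2| * K * r by field.
  apply: (@le_trans _ _ (r * L)); first by rewrite mulrC ler_wpM2l// /L lerDl.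
  by rewrite -ler_pdivlMr// ltW.
by apply: le_trans (lerD (le_trans H t1) t2) _; rewrite -mulrDl -splitr.
Qed.

End Taylor.

(** * The maximum principle on compact regions *)

Section MaximumPrinciple.
Variable R : realType.
Local Notation C := R[i].
Local Notation Co := (R[i]^o).
Implicit Types (u g : C -> R) (z : C).

Lemma compact_rect (M : R) : compact [set z : Co | `|complex.Re z| <= M /\ `|complex.Im z| <= M].
Proof.
pose f (p : R * R) : Co := p.1 +i* p.2.
have -> : [set z : Co | `|complex.Re z| <= M /\ `|complex.Im z| <= M] =
    f @` (`[- M, M] `*` `[- M, M]).
  apply/seteqP; split => [[x y] /= [xM yM]|_ [[x y] /= [+ +] <-]] /=.
    by exists (x, y) => //; split; rewrite /= in_itv /= -ler_norml.
  by rewrite !in_itv /= -!ler_norml.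
apply: continuous_compact; last by apply: compact_setX; exact: segment_compact.
apply: continuous_subspaceT => p; apply/continuousCP => e e0.
have e2 : 0 < e / 2 by rewrite divr_gt0.
apply/(@nbhs_ballP R (R * R)%type); exists (e / 2) => //= q [].
rewrite /ball /= => q1 q2; change (cabs (f q - f p) < e).
apply: le_lt_trans (cabs_le _) _.
by rewrite ReD ReN ImD ImN /= [ltRHS]splitr; apply: ltrD; rewrite distrC.
Qed.

(** Four constraints describe a truncated sector: two radii and two rays. An annulus fills the last
    two with the constant -1. *)
Definition region (g1 g2 g3 g4 : C -> R) : set C :=
  [set z | [/\ g1 z <= 0, g2 z <= 0, g3 z <= 0 & g4 z <= 0]].

Lemma compact_region (g1 g2 g3 g4 : C -> R) (M : R) :
  (forall z, [/\ rcont g1 z, rcont g2 z, rcont g3 z & rcont g4 z]) ->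
  (forall z, region g1 g2 g3 g4 z -> cabs z <= M) ->
  compact (region g1 g2 g3 g4 : set Co).
Proof.
move=> gc gM; apply: subclosed_compact (@compact_rect M) _; last first.
  by move=> z /gM zM; split; apply: le_trans zM; [exact: normRe_le|exact: normIm_le].
have key g : (forall z, rcont g z) -> closed ([set z | g z <= 0] : set Co).
  move=> gcz; rewrite -(setCK ([set z | g z <= 0] : set Co)); apply: open_closedC.
  rewrite openE => z /= /negP; rewrite -ltNge => /(rcont_gt (gcz z)).
  by apply: filterS => w gw /=; apply/negP; rewrite -ltNge.
have -> : region g1 g2 g3 g4 = (([set z | g1 z <= 0] `&` [set z | g2 z <= 0]) `&`
    ([set z | g3 z <= 0] `&` [set z | g4 z <= 0]) : set Co).
  by apply/seteqP; split => z /=; [case|move=> [[? ?] [? ?]]].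
apply: closedI; apply: closedI; apply: key => z; have [] := gc z; auto.
Qed.

Lemma region_max (g1 g2 g3 g4 u : C -> R) (M : R) :
  (forall z, [/\ rcont g1 z, rcont g2 z, rcont g3 z & rcont g4 z]) ->
  (forall z, region g1 g2 g3 g4 z -> cabs z <= M) ->
  (forall z, region g1 g2 g3 g4 z -> rcont u z) -> region g1 g2 g3 g4 !=set0 ->
  exists2 z, region g1 g2 g3 g4 z & forall w, region g1 g2 g3 g4 w -> u w <= u z.
Proof.
move=> gc gM uc K0; have Kc := compact_region gc gM.
have [] := @compact_EVT_max Co R (u : Co -> R) (region g1 g2 g3 g4) K0 Kc.
  apply: continuous_in_subspaceT => z; rewrite inE => /uc[]; exact.
move=> z; rewrite inE => zK zmax; exists z => // w wK; apply: zmax; by rewrite inE.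
Qed.

(** At a point where [u] is maximal, one alternative gives the sign directly; the other makes the
    point interior, and [lap_ge_no_max] excludes it. *)
Lemma max_principle (g1 g2 g3 g4 u : C -> R) (M : R) :
  (forall z, [/\ rcont g1 z, rcont g2 z, rcont g3 z & rcont g4 z]) ->
  (forall z, region g1 g2 g3 g4 z -> cabs z <= M) ->
  (forall z, region g1 g2 g3 g4 z -> rcont u z) ->
  (forall z, region g1 g2 g3 g4 z ->
    u z <= 0 \/ [/\ g1 z < 0, g2 z < 0, g3 z < 0 & g4 z < 0] /\
      exists2 c, 0 < c & lap_ge u z c) ->
  forall z, region g1 g2 g3 g4 z -> u z <= 0.
Proof.
move=> gc gM uc ub z zK.
have [p pK pmax] := region_max gc gM uc (ex_intro _ z zK).
apply: le_trans (pmax z zK) _; have [//|[[p1 p2 p3 p4] [c c0 up]]] := ub p pK.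
exfalso; apply: (lap_ge_no_max c0 up).
have neg g : rcont g p -> g p < 0 -> \forall w \near (p : Co), g w <= 0.
  move=> gp gp0; have : 0 < - g p by rewrite oppr_gt0.
  move=> /(rcont_gt (rcontN gp)); apply: filterS => w; rewrite oppr_gt0; exact: ltW.
have [c1 c2 c3 c4] := gc p.
have nI := @filterI Co (nbhs (p : Co)) (nbhs_filter (p : Co)).
have H := nI _ _ (nI _ _ (neg _ c1 p1) (neg _ c2 p2)) (nI _ _ (neg _ c3 p3) (neg _ c4 p4)).
move: H; apply: (@filterS Co (nbhs (p : Co)) (nbhs_filter (p : Co))) => w [[w1 w2] [w3 w4]].
by apply: pmax; split.
Qed.

Lemma annulus_rcont (r1 r2 : R) z : [/\ rcont (fun z => r1 - cabs z) z,
  rcont (fun z => cabs z - r2) z, rcont (fun=> -1) z & rcont (fun=> -1) z].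
Proof.
split; try exact: rcont_cst.
  exact: (rcontD (rcont_cst _ _) (rcontN (rcont_cabs z))).
exact: (rcontD (rcont_cabs z) (rcont_cst _ _)).
Qed.

Lemma annulus_regionP (r1 r2 : R) z :
  region (fun z => r1 - cabs z) (fun z => cabs z - r2) (fun=> -1) (fun=> -1) z <->
  r1 <= cabs z <= r2.
Proof.
rewrite /region /= !subr_le0 lerN10.
by split=> [[-> ->]|/andP[-> ->]].
Qed.

Lemma annulus_max_principle (r1 r2 : R) u :
  (forall z, r1 <= cabs z <= r2 -> rcont u z) ->
  (forall z, r1 <= r2 -> cabs z = r1 -> u z <= 0) -> (forall z, r1 <= r2 -> cabs z = r2 -> u z <= 0) ->
  (forall z, r1 < cabs z < r2 -> exists2 c, 0 < c & lap_ge u z c) ->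
  forall z, r1 <= cabs z <= r2 -> u z <= 0.
Proof.
move=> uc u1 u2 ul z /annulus_regionP zK.
apply: (max_principle (annulus_rcont r1 r2) (M := r2) _ _ _ zK).
- by move=> w /annulus_regionP/andP[].
- by move=> w /annulus_regionP /uc.
- move=> w /annulus_regionP /andP[w1 w2]; have r12 := le_trans w1 w2.
  have [w1'|w1'] := eqVneq (cabs w) r1; first by left; exact: u1.
  have [w2'|w2'] := eqVneq (cabs w) r2; first by left; exact: u2.
  right; have lt1 : r1 < cabs w by rewrite lt_neqAle eq_sym w1'.
  have lt2 : cabs w < r2 by rewrite lt_neqAle w2'.
  by rewrite !subr_lt0 lt1 lt2 ltrN10; split => //; apply: ul; rewrite lt1.
Qed.

Lemma annulus_max (r1 r2 : R) u : 0 <= r1 -> r1 <= r2 ->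
  (forall z, r1 <= cabs z <= r2 -> rcont u z) ->
  exists2 z, r1 <= cabs z <= r2 & forall w, r1 <= cabs w <= r2 -> u w <= u z.
Proof.
move=> r10 r12 uc.
have [|||z /annulus_regionP zP zmax] := region_max (annulus_rcont r1 r2) (M := r2) (u := u).
- by move=> w /annulus_regionP/andP[].
- by move=> w /annulus_regionP /uc.
- exists r1%:C; apply/annulus_regionP.
  by rewrite cabs_real ger0_norm// lexx.
by exists z => // w /annulus_regionP; exact: zmax.
Qed.

End MaximumPrinciple.

(** * The Poincare density and its potential *)

Section PoincareBarrier.
Variable R : realType.
Local Notation C := R[i].

(* [kap] is the density of the Poincare metric of the punctured disc and [bar] a
   potential for it. *)
Definition kap (z : C) : R := (cabs z ^+ 2 * ln (cabs z ^+ 2) ^+ 2)^-1.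
Definition bar (z : C) : R := - ln (- ln (cabs z ^+ 2)).

Lemma sqr_cabs_bnd (z : C) : 0 < cabs z < 1 -> 0 < cabs z ^+ 2 < 1.
Proof. by move=> /andP[z0 z1]; rewrite exprn_gt0//= exprn_ilt1// ltW. Qed.

Lemma ln_sqr_cabs (z : C) : 0 < cabs z -> ln (cabs z ^+ 2) = 2 * ln (cabs z).
Proof. by move=> z0; rewrite lnXn// mulr_natl. Qed.

Lemma kap_gt0 (z : C) : 0 < cabs z < 1 -> 0 < kap z.
Proof.
move=> zP; have /andP[s0 s1] := sqr_cabs_bnd zP.
rewrite invr_gt0 mulr_gt0// exprn_even_gt0//=.
by apply: ltr0_neq0; rewrite ln_lt0// s0.
Qed.

(** As a function [b] of s = |z|^2 the left side gives b' + s b'' = A / (s ln^2 s). The harmonic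
    term in ln |z| is included because the comparison functions on annuli need a free logarithmic
    slope. *)
Lemma lap_ge_bar (A k : R) (z0 : C) : 0 < cabs z0 < 1 ->
  lap_ge (fun z => A * bar z + k * ln (cabs z)) z0 (A * kap z0).
Proof.
move=> zP; have /andP[s0 s1] := sqr_cabs_bnd zP.
pose b (s : R) := A * - ln (- ln s) + k / 2 * ln s.
pose b1 (s : R) := A * (- (s * ln s)^-1) + k / 2 * s^-1.
pose s := cabs z0 ^+ 2; pose q := ln s.
have q0 : q < 0 by apply: ln_lt0; rewrite s0.
have qn : q != 0 by exact: ltr0_neq0.
have sn : s != 0 by exact: lt0r_neq0.
have derN (f : R -> R) (x a : R) : is_derive x 1 f a -> is_derive x 1 (fun t => - f t) (- a).
  by move=> fa; exact: (@is_deriveN R R R f x 1 a fa).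
have derV (f : R -> R) (x a : R) : f x != 0 -> is_derive x 1 f a ->
    is_derive x 1 (fun t => (f t)^-1) (- (a / f x ^+ 2)).
  move=> f0 [fd fv]; split; first exact: derivableV.
  by have := @deriveV R R f x 1 f0 fd; rewrite fv => ->; rewrite /GRing.scale /= mulNr mulrC.
have lnd (t : R) : 0 < t -> is_derive t 1 (@ln R) t^-1 by exact: is_derive1_ln.
have db (t : R) : 0 < t < 1 -> is_derive t 1 b (b1 t).
  move=> /andP[t0 t1]; have lt0 : ln t < 0 by apply: ln_lt0; rewrite t0.
  have l1 : is_derive t 1 (fun x => ln (- ln x)) ((- ln t)^-1 * (- t^-1)).
    apply: (@is_derive1_comp R (@ln R) (fun x => - ln x)).
      by apply: lnd; rewrite oppr_gt0.
    exact: derN (lnd t t0).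
  have H := derD (derZ A (derN _ _ _ l1)) (derZ (k / 2) (lnd t t0)).
  apply: is_derive_eq H _; rewrite /b1; congr (A * _ + _).
  by field; rewrite (ltr0_neq0 lt0) lt0r_neq0.
pose b2 := A * ((q + 1) / (s * q) ^+ 2) - k / 2 * (s ^+ 2)^-1.
have db1 : is_derive s 1 b1 b2.
  have sq : s * ln s != 0 by exact: mulf_neq0 sn qn.
  have H := derD (derZ A (derN _ _ _ (derV (fun t => t * ln t) s _ sq (derM (is_derive_id s (1:R)) (lnd s s0)))))
    (derZ (k / 2) (derV id s _ sn (is_derive_id s (1:R)))).
  apply: is_derive_eq H _; rewrite /b2 -/q.
  by field; rewrite qn sn.
have nb : \forall t \near s, is_derive (t : R) 1 b (b1 t).
  have : s \in `]0, 1[ by rewrite in_itv /= s0.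
  move=> /near_in_itvoo; apply: filterS => t; rewrite in_itv /=; exact: db.
have := taylor2_lap_ge (taylor2_radial nb db1); rewrite -/s.
have -> : b1 s + b2 * s = A * kap z0.
  by rewrite /b1 /b2 /kap -/s -/q; field; rewrite qn sn.
apply: lap_ge_near; have : 0 < cabs z0 by case/andP: zP.
move=> /(rcont_gt (rcont_cabs z0)); apply: filterS => z z0'.
by rewrite /b /bar ln_sqr_cabs//; congr (_ + _); field.
Qed.

Lemma rcont_ln_cabs (z : C) : 0 < cabs z -> rcont (fun w => ln (cabs w)) z.
Proof. by move=> z0; apply: rcont_comp (rcont_cabs z) _; exact: continuous_ln. Qed.

Lemma rcont_bar (z : C) : 0 < cabs z < 1 -> rcont (@bar) z.
Proof.
move=> zP; have /andP[s0 s1] := sqr_cabs_bnd zP.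
have zz : rcont (fun w => cabs w ^+ 2) z.
  by apply: rcont_near (rcontM (rcont_cabs z) (rcont_cabs z)); apply: filterE => w; rewrite expr2.
apply: rcontN; apply: (@rcont_comp R (@ln R) (fun w => - ln (cabs w ^+ 2))).
  apply: rcontN; apply: rcont_comp zz _; exact: continuous_ln.
by apply: continuous_ln; rewrite oppr_gt0 ln_lt0// s0.
Qed.

Lemma bar_le (z w : C) : 0 < cabs z -> cabs z <= cabs w -> cabs w < 1 -> bar z <= bar w.
Proof.
move=> z0 zw w1; have w0 := lt_le_trans z0 zw; have z1 := le_lt_trans zw w1.
have lw : ln (cabs w) < 0 by rewrite ln_lt0// w0.
have lz : ln (cabs z) < 0 by rewrite ln_lt0// z0.
have zw' : ln (cabs z) <= ln (cabs w) by rewrite ler_ln ?posrE.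
by rewrite /bar lerN2 ler_ln ?posrE !ln_sqr_cabs//; move: lw lz zw'; clear; lra.
Qed.

Lemma bar_eq (z w : C) : cabs z = cabs w -> bar z = bar w.
Proof. by rewrite /bar => ->. Qed.

End PoincareBarrier.

(** * Functions with Laplacian bounded by the Poincaré density *)

Section UnitCircle.
Variable R : realType.
Local Notation C := R[i].

Definition expi (t : R) : C := cos t +i* sin t.

Lemma expi0 : expi 0 = 1.
Proof. by rewrite /expi cos0 sin0. Qed.

Lemma expiD s t : expi (s + t) = expi s * expi t.
Proof. by apply: eqC; rewrite ?ReM ?ImM /= ?cosD ?sinD; ring. Qed.

Lemma cabs_expi t : cabs (expi t) = 1.
Proof.
by apply/eqP; rewrite -(eqrXn2 (n:=2)) ?cabs_ge0// sqr_cabs /= cos2Dsin2 expr1n.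
Qed.

Lemma expi_neq0 t : expi t != 0.
Proof. by rewrite -cabs_gt0 cabs_expi. Qed.

Lemma expiX t n : expi t ^+ n = expi (n%:R * t).
Proof.
elim: n => [|n IH]; first by rewrite mul0r expi0.
by rewrite exprS IH -expiD -natr1 mulrDl mul1r addrC.
Qed.

Lemma expi2pi : expi (2 * pi) = 1.
Proof. by rewrite /expi mulr_natl cos2pi sin2pi. Qed.

Lemma conj_expi t : (expi t)^*%C = expi (- t).
Proof. by rewrite /expi cosN sinN. Qed.

Lemma expiV t : (expi t)^-1 = expi (- t).
Proof. by apply: (mulfI (expi_neq0 t)); rewrite divff ?expi_neq0// -expiD subrr expi0. Qed.

Lemma cabsJ (z : C) : cabs z^*%C = cabs z.
Proof. by apply: (@complexI R); rewrite -!normC_cabs normcJ. Qed.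

Lemma polar_upper (z : C) : 0 <= complex.Im z ->
  exists2 t, 0 <= t <= pi & z = (cabs z)%:C * expi t.
Proof.
move=> z0; have [->|zn0] := eqVneq z (0 : C).
  by exists 0; rewrite ?lexx ?pi_ge0// cabs0 mul0r.
have zp : 0 < cabs z by rewrite cabs_gt0.
pose x := complex.Re z / cabs z.
have x1 : -1 <= x <= 1.
  by rewrite -ler_norml /x normrM normfV (ger0_norm (cabs_ge0 z)) ler_pdivrMr// mul1r normRe_le.
exists (acos x); first by rewrite acos_ge0// acos_lepi.
apply: eqC; rewrite ?ReM ?ImM /= mul0r ?subr0 ?addr0.
  by rewrite acosK ?in_itv//= /x mulrC divfK// gt_eqF.
rewrite sin_acos//; apply/eqP; rewrite -(eqrXn2 (n:=2))//; last first.
  by rewrite mulr_ge0 ?cabs_ge0 ?sqrtr_ge0.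
rewrite exprMn sqr_sqrtr; last by rewrite subr_ge0 -real_normK ?num_real// exprn_ile1// ler_norml.
have -> : cabs z ^+ 2 * (1 - x ^+ 2) = cabs z ^+ 2 - complex.Re z ^+ 2.
  by rewrite /x; field; rewrite gt_eqF.
by rewrite sqr_cabs addrC addKr.
Qed.

Lemma polar (z : C) : exists2 t, - pi <= t <= pi & z = (cabs z)%:C * expi t.
Proof.
have pi0 := pi_ge0 R; have [z0|z0] := leP 0 (complex.Im z).
  have [t /andP[t0 t1] zE] := polar_upper z0; exists t => //.
  by rewrite t1 andbT (le_trans _ t0)// oppr_le0.
have zJ0 : 0 <= complex.Im z^*%C by case: (z) z0 => x y /= /ltW; rewrite oppr_ge0.
have [t /andP[t0 t1] zE] := polar_upper zJ0; exists (- t).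
  by rewrite lerN2 t1 (le_trans (_ : _ <= 0))// oppr_le0.
rewrite -[LHS]conjcK zE cabsJ -conj_expi.
rewrite (rmorphM (@conjc R)); congr (_ * _).
by apply: eqC; rewrite /= ?oppr0.
Qed.

Lemma kap_eq (z w : C) : cabs z = cabs w -> kap z = kap w.
Proof. by rewrite /kap => ->. Qed.

(** The squaring map is a local isometry of the Poincare metric of the punctured disc, so Laplacian
    bounds pull back with the same constant. *)
Lemma kap_sqr (z : C) : 0 < cabs z < 1 -> kap (z ^+ 2) * (2 * cabs z) ^+ 2 = kap z.
Proof.
move=> zP; have /andP[s0 s1] := sqr_cabs_bnd zP; have /andP[z0 z1] := zP.
have l0 : ln (cabs z ^+ 2) != 0 by apply: ltr0_neq0; rewrite ln_lt0// s0.
have lnE : ln ((cabs z ^+ 2) ^+ 2) = 2 * ln (cabs z ^+ 2) by rewrite lnXn// mulr_natl.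
by rewrite /kap cabsX lnE; field; rewrite l0 lt0r_neq0.
Qed.

Lemma lap_ge_rot (u : C -> R) (a : R) (z0 : C) c : lap_ge u (expi a * z0) c ->
  lap_ge (fun z => u (expi a * z)) z0 c.
Proof.
move=> uc; have := @lap_ge_comp R u (fun z => expi a * z) (fun=> 1) z0 c _ _ _ uc.
rewrite expr1n mulr1; apply.
- by apply: filterE => z; exact: (cdiffM (cdiff_cst _ z) (cdiff_id z)).
- by move=> z; rewrite -mulrBr cabsM cabs_expi.
- exact: rcont_cst.
Qed.

Lemma lap_ge_sqr (u : C -> R) (z0 : C) M : 0 < cabs z0 < 1 ->
  lap_ge u (z0 ^+ 2) (M * kap (z0 ^+ 2)) ->
  lap_ge (fun z => u (z ^+ 2)) z0 (M * kap z0).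
Proof.
move=> z0P uc.
have := @lap_ge_comp R u (fun z => z ^+ 2) (fun z => cabs (z + z0)) z0 _ _ _ _ uc.
have -> : z0 + z0 = 2%:R * z0 by rewrite mulr_natl mulr2n.
have -> : cabs (2%:R * z0) = 2 * cabs z0.
  rewrite cabsM; have -> : (2%:R : C) = (2 : R)%:C by rewrite rmorph_nat.
  by rewrite cabs_real ger0_norm.
rewrite -mulrA kap_sqr//; apply.
- by apply: filterE => z; exact: (cdiffX 2 (cdiff_id z)).
- by move=> z; rewrite subr_sqr cabsM mulrC.
- apply: (rcont_ccomp (ccontD (ccont_id z0) (ccont_cst z0 z0))); exact: rcont_cabs.
Qed.

End UnitCircle.

(** * Rotation sums and a lower bound at one point of each circle *)

Section QuasiHarmonic.
Variable R : realType.
Local Notation C := R[i].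

(* The properties of log det H(h, v) on which the existence of its order of growth
   depends. *)
Variant quasi_harmonic (phi : C -> R) (rho M N : R) : Prop := QuasiHarmonic of
  [/\ 0 < rho < 1, 0 <= M & 0 <= N] &
  (forall z, 0 < cabs z < rho -> rcont phi z) &
  (forall z, 0 < cabs z < rho ->
     lap_ge phi z (- M * kap z) /\ lap_ge (fun w => - phi w) z (- M * kap z)) &
  (forall z, 0 < cabs z < rho -> phi z <= N * - ln (cabs z)).

Definition rotsum (phi : C -> R) (n : nat) (z : C) : R :=
  \sum_(j < n) phi (expi (j%:R * (2 * pi / n%:R)) * z).

Lemma rotsum_rot phi n z : (0 < n)%N ->
  rotsum phi n (expi (2 * pi / n%:R) * z) = rotsum phi n z.
Proof.
case: n => // n _; rewrite /rotsum big_ord_recr [RHS]big_ord_recl /= addrC; congr (_ + _).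
  congr phi; rewrite mulrA -expiD; congr (_ * _).
  rewrite mul0r expi0 -[X in _ + X]mul1r -mulrDl natr1 [X in expi X]mulrC divfK ?expi2pi//.
apply: eq_bigr => i _; congr phi; rewrite mulrA -expiD; congr (expi _ * _).
by rewrite -[X in _ + X]mul1r -mulrDl natr1.
Qed.

(** This invariance lets a difference of arguments be reduced modulo 2 pi / n. *)
Lemma rotsum_rotn phi n k z : (0 < n)%N ->
  rotsum phi n (expi (k%:R * (2 * pi / n%:R)) * z) = rotsum phi n z.
Proof.
move=> n0; elim: k => [|k IH]; first by rewrite mul0r expi0 mul1r.
by rewrite -natr1 mulrDl mul1r addrC expiD -mulrA rotsum_rot.
Qed.

Lemma rotsum1 phi z : rotsum phi 1 z = phi z.
Proof. by rewrite /rotsum big_ord1 mul0r expi0 mul1r. Qed.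

Lemma cabs_rot (a : R) (z : C) : cabs (expi a * z) = cabs z.
Proof. by rewrite cabsM cabs_expi mul1r. Qed.

Section Basics.
Variables (phi : C -> R) (rho M N : R).
Hypothesis qh : quasi_harmonic phi rho M N.

Lemma qh_rho : 0 < rho < 1. Proof. by case: qh => -[]. Qed.
Lemma qh_M : 0 <= M. Proof. by case: qh => -[]. Qed.
Lemma qh_N : 0 <= N. Proof. by case: qh => -[]. Qed.
Lemma qh_cont z : 0 < cabs z < rho -> rcont phi z.
Proof. by case: qh => _ + _ _; exact. Qed.
Lemma qh_lap z : 0 < cabs z < rho -> lap_ge phi z (- M * kap z).
Proof. by case: qh => _ _ + _ => /[apply] -[]. Qed.
Lemma qh_lapN z : 0 < cabs z < rho -> lap_ge (fun w => - phi w) z (- M * kap z).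
Proof. by case: qh => _ _ + _ => /[apply] -[]. Qed.
Lemma qh_le z : 0 < cabs z < rho -> phi z <= N * - ln (cabs z).
Proof. by case: qh => _ _ _; exact. Qed.

Lemma qh_lt1 z : 0 < cabs z < rho -> 0 < cabs z < 1.
Proof. by move=> /andP[-> zr]; case/andP: qh_rho => _; exact: lt_trans zr. Qed.

Lemma rotsum_cont n z : 0 < cabs z < rho -> rcont (rotsum phi n) z.
Proof.
move=> zP; apply: rcont_sum => i.
apply: (rcont_ccomp (ccontM (ccont_cst _ z) (ccont_id z))).
by apply: qh_cont; rewrite cabs_rot.
Qed.

Lemma rotsum_lap n z : 0 < cabs z < rho -> lap_ge (rotsum phi n) z (n%:R * (- M * kap z)).
Proof.
move=> zP; apply: lap_ge_sum => i.
apply: (lap_ge_rot (u := phi)).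
rewrite -(kap_eq (cabs_rot (i%:R * (2 * pi / n%:R)) z)).
by apply: qh_lap; rewrite cabs_rot.
Qed.
End Basics.

(* Were [rotsum phi n] below [- n K (-ln r)] on a whole circle, the maximum principle
   between this circle and a fixed one would bound it away from its values on a
   circle in between; [K] does not depend on [n]. *)
Lemma circle_lower phi rho M N : quasi_harmonic phi rho M N -> exists K rb, [/\ 0 <= K, 0 < rb < rho &
  forall n r, (0 < n)%N -> 0 < r < rb ->
    exists2 z, cabs z = r & - (n%:R * K * - ln r) <= rotsum phi n z].
Proof.
move=> qh; have /andP[rho0 rhol1] := qh_rho qh.
have M0 := qh_M qh; have phi_cont := qh_cont qh; have lt_rho1 := qh_lt1 qh.
pose ra := rho / 2; pose rb := rho / 4.
have ra0 : 0 < ra by rewrite divr_gt0.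
have rb0 : 0 < rb by rewrite divr_gt0.
have rba : rb < ra by rewrite /rb /ra; clear -rho0; lra.
have rar : ra < rho by rewrite /ra; clear -rho0; lra.
have cP r z : 0 < r -> r < rho -> r <= cabs z <= r -> 0 < cabs z < rho.
  by move=> r0 rr /andP[z1 z2]; rewrite (lt_le_trans r0 z1) (le_lt_trans z2 rr).
have [za zaP zamax] := annulus_max (ltW ra0) (lexx ra) (fun z zP => phi_cont z (cP ra z ra0 rar zP)).
have rbr := lt_trans rba rar.
have [zb zbP zbmax] := annulus_max (ltW rb0) (lexx rb)
  (fun z zP => rcontN (phi_cont z (cP rb z rb0 rbr zP))).
pose Ma := phi za; pose mb := phi zb.
have Ba z : cabs z = ra -> bar z = bar (ra%:C : C).
  by move=> zr; apply: bar_eq; rewrite cabs_real gtr0_norm.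
set ba := bar (ra%:C : C) in Ba; set bb := bar (rb%:C : C).
pose la := - ln ra; pose lb := - ln rb.
have la0 : 0 < la by rewrite oppr_gt0 ln_lt0// ra0 (lt_trans rar).
have lab : 0 < lb - la by rewrite subr_gt0 ltrN2 ltr_ln ?posrE.
(* [K1] makes the comparison function nonpositive on the inner circle, and [K2] makes the conclusion
   absurd at the radius [rb]. Every term of the comparison scales with [n], hence [K] does not
   depend on it. *)
pose K := Num.max (Num.max 0 (- Ma / la)) ((Ma + (M + 1) * ba - mb - (M + 1) * bb + 1) / (lb - la)).
have K0 : 0 <= K by rewrite !le_max lexx.
have K1 : 0 <= Ma + K * la.
  by rewrite -lerBlDl sub0r -ler_pdivrMr// !le_max lexx orbT.
have K2 : Ma + (M + 1) * ba - mb - (M + 1) * bb + 1 <= K * (lb - la).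
  by rewrite -ler_pdivrMr// le_max lexx orbT.
clearbody K; exists K, rb; split; rewrite ?rb0//.
move=> n r n0 /andP[r0 rrb]; have n0' : 0 < n%:R :> R by rewrite ltr0n.
apply: contrapT => noz.
have low z : cabs z = r -> rotsum phi n z < - (n%:R * K * - ln r).
  by move=> zr; rewrite ltNge; apply/negP => H; apply: noz; exists z.
pose D := n%:R * (Ma + (M + 1) * ba + K * la).
pose u z := rotsum phi n z + ((n%:R * (M + 1)) * bar z + (- (n%:R * K)) * ln (cabs z)) + (- D).
have inr z : r <= cabs z <= ra -> 0 < cabs z < rho.
  by move=> /andP[z1 z2]; rewrite (lt_le_trans r0 z1) (le_lt_trans z2 rar).
have uu : u (rb%:C : C) <= 0.
  have rbc : cabs (rb%:C : C) = rb by rewrite cabs_real gtr0_norm.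
  apply: (@annulus_max_principle R r ra); last by rewrite rbc (ltW rrb) (ltW rba).
  - move=> z /inr zP; have zP1 := lt_rho1 z zP; have /andP[z0 _] := zP.
    apply: rcontD (rcont_cst _ _); apply: rcontD (rotsum_cont qh n zP) _.
    apply: rcontD; apply: rcontM (rcont_cst _ _) _; first exact: rcont_bar.
    exact: rcont_ln_cabs.
  - move=> z _ zr; have := low z zr; rewrite /u zr.
    have bz : bar z <= ba.
      have rac : cabs (ra%:C : C) = ra by rewrite cabs_real gtr0_norm.
      apply: bar_le; rewrite ?rac ?zr//; first exact: ltW (lt_trans rrb rba).
      exact: lt_trans rar rhol1.
    have : n%:R * (M + 1) * bar z <= n%:R * (M + 1) * ba.
      by rewrite ler_wpM2l// mulr_ge0 ?addr_ge0// ltW.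
    have : 0 <= n%:R * (Ma + K * la) by rewrite mulr_ge0// ltW.
    rewrite /D; clear; lra.
  - move=> z _ zr; rewrite /u (Ba z zr) zr.
    have : rotsum phi n z <= n%:R * Ma.
      rewrite mulr_natl /rotsum -[n in leRHS]card_ord -sumr_const; apply: ler_sum => i _.
      by apply: zamax; rewrite cabs_rot zr lexx.
    rewrite /D /la; clear; lra.
  - move=> z /andP[z1 z2]; have zP : 0 < cabs z < rho by apply: inr; rewrite !ltW.
    have zP1 := lt_rho1 z zP.
    exists (n%:R * kap z); first by rewrite mulr_gt0 ?kap_gt0.
    have := lap_geD (lap_geD (rotsum_lap qh n zP) (lap_ge_bar (n%:R * (M + 1)) (- (n%:R * K)) zP1))
      (lap_ge_cst (- D) z).
    by apply: lap_ge_le; rewrite le_eqVlt; apply/orP; left; apply/eqP; ring.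
have rbc : cabs (rb%:C : C) = rb by rewrite cabs_real gtr0_norm.
have : n%:R * mb <= rotsum phi n rb%:C.
  rewrite mulr_natl /rotsum -[n in leLHS]card_ord -sumr_const; apply: ler_sum => i _.
  rewrite -lerN2; apply: (zbmax (expi (i%:R * (2 * pi / n%:R)) * rb%:C)).
  by rewrite cabs_rot rbc lexx.
move: uu; rewrite /u rbc -/bb /D.
have : n%:R * (Ma + (M + 1) * ba - mb - (M + 1) * bb + 1) <= n%:R * (K * (lb - la)).
  by rewrite ler_pM2l.
rewrite /lb; move: n0'; clear; lra.
Qed.

End QuasiHarmonic.

(** * Reflection in a sector *)

Section Oscillation.
Variable R : realType.
Local Notation C := R[i].

Lemma cos_ge_half (x : R) : - (pi / 4) <= x <= pi / 4 -> 2^-1 <= cos x.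
Proof.
move=> /andP[x1 x2]; have pi0 := pi_gt0 R.
have c0 : 0 <= cos x by apply: cos_ge0_pihalf; apply/andP; split; lra.
have : 0 <= cos (x + x) by apply: cos_ge0_pihalf; apply/andP; split; lra.
rewrite cosD -!expr2 sin2cos2 => H.
rewrite -ler_sqr ?nnegrE//; move: H; clear; lra.
Qed.

Lemma in_sector n (z : C) : (0 < n)%N -> 0 <= complex.Im z ->
  complex.Im (z * expi (- (pi / (2 * n%:R)))) <= 0 ->
  exists2 t, 0 <= t <= pi / (2 * n%:R) & z = (cabs z)%:C * expi t.
Proof.
move=> n0 z0 zn; have pi0 := pi_gt0 R; have n0' : 1 <= n%:R :> R by rewrite ler1n.
have [zz|zn0] := eqVneq z (0 : C).
  exists 0; last by rewrite zz cabs0 mul0r.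
  by rewrite lexx divr_ge0 ?mulr_ge0// ltW.
have zp : 0 < cabs z by rewrite cabs_gt0.
have [t /andP[t0 t1] zE] := polar_upper z0; exists t => //; rewrite t0 /=.
rewrite leNgt; apply/negP => lt.
move: zn; rewrite zE -mulrA -expiD ImM /= mul0r addr0 leNgt => /negP; apply.
rewrite mulr_gt0//; apply: sin_gt0_pi; rewrite subr_gt0 lt /=.
rewrite ltrBlDr; apply: le_lt_trans t1 _; rewrite ltrDl divr_gt0// mulr_gt0//.
exact: lt_le_trans n0'.
Qed.

(** Turning by - pi / (4 n) centres the sector 0 <= arg z <= pi / (2 n) on the real axis, so the
    n-th power has argument within pi / 4 of 0 and its cosine is at least 1/2. In the variable
    before squaring the sector would have angle pi / n and the same barrier would need the power n /
    2, perhaps not an integer. *)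
Definition sector_barrier (n : nat) (A B : R) (z : C) : R :=
  let w := (z * expi (- (pi / (4 * n%:R)))) ^+ n in
  complex.Re (A%:C * w + B%:C * w^-1).

Lemma sector_barrierE n A B (r t : R) : (0 < n)%N -> 0 < r ->
  sector_barrier n A B (r%:C * expi t) =
  (A * r ^+ n + B * (r ^+ n)^-1) * cos (n%:R * t - pi / 4).
Proof.
move=> n0 r0; rewrite /sector_barrier -mulrA -expiD exprMn expiX.
have -> : n%:R * (t - pi / (4 * n%:R)) = n%:R * t - pi / 4.
  by rewrite mulrBr; congr (_ - _); field; rewrite pnatr_eq0 -lt0n.
set a := n%:R * t - pi / 4.
have -> : (r%:C : C) ^+ n = (r ^+ n)%:C by rewrite rmorphXn.
have -> : ((r ^+ n)%:C * expi a)^-1 = ((r ^+ n)^-1)%:C * expi (- a) :> C.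
  by rewrite invfM expiV fmorphV.
by rewrite !(ReD, ReM, ImM) /= cosN; ring.
Qed.

Lemma sector_angle n (t : R) : (0 < n)%N -> 0 <= t <= pi / (2 * n%:R) ->
  2^-1 <= cos (n%:R * t - pi / 4).
Proof.
move=> n0 /andP[t0 t1]; apply: cos_ge_half; have n0' : 0 < n%:R :> R by rewrite ltr0n.
have : n%:R * t <= pi / 2.
  apply: (@le_trans _ _ (n%:R * (pi / (2 * n%:R)))); first by rewrite ler_pM2l.
  by rewrite le_eqVlt; apply/orP; left; apply/eqP; field; rewrite gt_eqF.
have : 0 <= n%:R * t by rewrite mulr_ge0// ltW.
by move=> h1 h2; apply/andP; split; move: h1 h2; clear; lra.
Qed.

Lemma lap_ge_sector_barrier n A B (z : C) : 0 < cabs z ->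
  lap_ge (fun w => - sector_barrier n A B w) z 0.
Proof.
move=> z0; pose w (z : C) := (z * expi (- (pi / (4 * n%:R)))) ^+ n.
pose g z := - (A%:C * w z + B%:C * (w z)^-1).
apply: (@lap_ge_near R (fun z => complex.Re (g z))).
  by apply: filterE => u; rewrite /g ReN.
apply: lap_ge_Re; have := rcont_gt (rcont_cabs z) z0; apply: filterS => u u0.
have wd : cdiff w u by apply: cdiffX; exact: (cdiffM (cdiff_id u) (cdiff_cst _ u)).
have w0 : w u != 0 by rewrite expf_neq0// mulf_neq0 ?expi_neq0// -cabs_gt0.
apply: cdiffN; exact: (cdiffD (cdiffM (cdiff_cst _ u) wd) (cdiffM (cdiff_cst _ u) (cdiffV w0 wd))).
Qed.

Lemma rcont_sector_barrier n A B (z : C) : 0 < cabs z -> rcont (sector_barrier n A B) z.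
Proof.
move=> z0; pose w (z : C) := (z * expi (- (pi / (4 * n%:R)))) ^+ n.
have wd : cdiff w z by apply: cdiffX; exact: (cdiffM (cdiff_id z) (cdiff_cst _ z)).
have w0 : w z != 0 by rewrite expf_neq0// mulf_neq0 ?expi_neq0// -cabs_gt0.
have gd : cdiff (fun z => A%:C * w z + B%:C * (w z)^-1) z.
  exact: (cdiffD (cdiffM (cdiff_cst _ z) wd) (cdiffM (cdiff_cst _ z) (cdiffV w0 wd))).
exact: (rcont_ccomp (cdiff_cont gd) (rcont_Re _)).
Qed.

Lemma ccont_conj (z : C) : ccont (@conjc R) z.
Proof.
apply/ccontP => e e0; exists e => // w; rewrite -cabsJ.
by rewrite (rmorphB (@conjc R)).
Qed.

(** The unimodular [c] acts as a rotation and squaring is an isometry for [kap], so the bound keeps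
    its form in the new variable. *)
Lemma rotsum_sqr_lap phi rho M N n (c z : C) : quasi_harmonic phi rho M N -> cabs c = 1 -> 0 < cabs (z ^+ 2) < rho ->
  lap_ge (fun w => rotsum phi n ((c * w) ^+ 2)) z (n%:R * (- M * kap z)) /\
  lap_ge (fun w => - rotsum phi n ((c * w) ^+ 2)) z (n%:R * (- M * kap z)).
Proof.
move=> qh c1 zP.
have z1 : 0 < cabs z < 1.
  have /andP[z0 zr] := zP; have /andP[r0 r1] := qh_rho qh.
  move: z0 zr; rewrite cabsX => z0 zr.
  have zz : 0 < cabs z by rewrite lt_def cabs_ge0 andbT; apply: contraTneq z0 => ->; rewrite expr0n ltxx.
  by rewrite zz /= -(expr_lt1 (n:=2)) ?cabs_ge0// (lt_trans zr).
have [a _ cE] := polar c; rewrite c1 mul1r in cE.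
have key (u : C -> R) j : (forall w, 0 < cabs w < rho -> lap_ge u w (- M * kap w)) ->
    lap_ge (fun w => u (expi (j%:R * (2 * pi / n%:R)) * (c * w) ^+ 2)) z (- M * kap z).
  move=> ul; pose b := j%:R * (2 * pi / n%:R) + (a + a).
  have bE w : expi (j%:R * (2 * pi / n%:R)) * (c * w) ^+ 2 = expi b * w ^+ 2.
    rewrite exprMn [LHS]mulrA cE expiX -expiD /b; congr (expi (_ + _) * _).
    by rewrite mulr_natl mulr2n.
  apply: (@lap_ge_near R (fun w => (fun v => u (expi b * v)) (w ^+ 2))).
    by apply: filterE => w; rewrite bE.
  apply: (@lap_ge_sqr R (fun v => u (expi b * v)) z (- M) z1); apply: (@lap_ge_rot R u b).
  by rewrite -(kap_eq (cabs_rot b (z ^+ 2))); apply: ul; rewrite cabs_rot.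
split.
  by apply: lap_ge_sum => j; apply: key => w wP; exact: (qh_lap qh).
apply: (@lap_ge_near R (fun w => \sum_(j < n) - phi (expi (j%:R * (2 * pi / n%:R)) * (c * w) ^+ 2))).
  by apply: filterE => w; rewrite /rotsum sumrN.
apply: lap_ge_sum => j; apply: (key (fun w => - phi w)) => w wP; exact: (qh_lapN qh).
Qed.

Lemma rotsum_abs (phi : C -> R) n z S : (forall j, `|phi (expi j * z)| <= S) -> `|rotsum phi n z| <= n%:R * S.
Proof.
move=> phiS; apply: le_trans (ler_norm_sum _ _ _) _.
rewrite [leRHS]mulr_natl -[n in leRHS]card_ord -sumr_const; apply: ler_sum => i _; exact: phiS.
Qed.

(* [u z = rotsum phi n ((c * z) ^+ 2)] is invariant under rotation by [pi / n], so
   [u z - u z^*] vanishes on both sides of the sector [0 <= arg z <= pi / (2 n)];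
   the barrier dominates it on the two arcs, with a real part of [z ^+ n] and
   [z ^- n] that decays exponentially in [n] inside. *)
Lemma sector_osc phi rho M N n (c : C) (R1 R2 S : R) : quasi_harmonic phi rho M N ->
  (0 < n)%N -> cabs c = 1 ->
  0 < R1 -> R2 ^+ 2 < rho -> R1 <= R2 -> 0 <= S ->
  (forall z, R1 ^+ 2 <= cabs z <= R2 ^+ 2 -> `|phi z| <= S) ->
  forall t r, 0 <= t <= pi / (2 * n%:R) -> R1 <= r <= R2 ->
  rotsum phi n ((c * (r%:C * expi t)) ^+ 2) - rotsum phi n ((c * (r%:C * expi (- t))) ^+ 2) <=
  2 * n%:R * (M + 1) * (bar (R2%:C : C) - bar (r%:C : C)) +
  4 * n%:R * S * ((r / R2) ^+ n + (R1 / r) ^+ n).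
Proof.
move=> qh n0 c1 R10 R2r R12 S0 phiS t r tP rP.
have R20 := lt_le_trans R10 R12; have /andP[rho0 rho1] := qh_rho qh.
have n0' : 0 < n%:R :> R by rewrite ltr0n.
have M0 := qh_M qh; have R21 : R2 < 1.
  by rewrite -(expr_lt1 (n:=2)) ?ltW// (lt_trans R2r).
have R1ge := ltW R10; have R2ge := ltW R20.
(* On the outer arc the [A] term of the barrier, on the inner arc the [B] term, has amplitude 4 n S;
   half of it, the least the cosine leaves, dominates the bound 2 n S of [U]. *)
pose A := 4 * n%:R * S / R2 ^+ n; pose B := 4 * n%:R * S * R1 ^+ n.
have A0 : 0 <= A by rewrite divr_ge0 ?exprn_ge0 ?mulr_ge0.
have B0 : 0 <= B by rewrite !mulr_ge0 ?exprn_ge0.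
(* Each of the two rotation sums in [U] loses n M in the Laplacian; the excess 2 n makes [T]
   strictly subharmonic. *)
pose m := 2 * n%:R * (M + 1).
have m0 : 0 <= m by rewrite !mulr_ge0 ?addr_ge0.
pose U z := rotsum phi n ((c * z) ^+ 2) - rotsum phi n ((c * z^*%C) ^+ 2).
pose T z := U z + (m * bar z + 0 * ln (cabs z)) + (- (m * bar (R2%:C : C))) + - sector_barrier n A B z.
pose g1 (z : C) := R1 - cabs z; pose g2 (z : C) := cabs z - R2.
pose g3 (z : C) := - complex.Im z.
pose g4 (z : C) := complex.Im (z * expi (- (pi / (2 * n%:R)))).
have gc z : [/\ rcont g1 z, rcont g2 z, rcont g3 z & rcont g4 z].
  split.
  - exact: (rcontD (rcont_cst _ _) (rcontN (rcont_cabs z))).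
  - exact: (rcontD (rcont_cabs z) (rcont_cst _ _)).
  - exact: rcontN (rcont_Im z).
  - exact: (rcont_ccomp (ccontM (ccont_id z) (ccont_cst _ z)) (rcont_Im _)).
have regP z : region g1 g2 g3 g4 z -> [/\ R1 <= cabs z, cabs z <= R2 &
    exists2 s, 0 <= s <= pi / (2 * n%:R) & z = (cabs z)%:C * expi s].
  rewrite /region /g1 /g2 /g3 /g4 /= !subr_le0 oppr_le0 => -[? ? z0 zn]; split => //.
  exact: in_sector.
have sqr_in z : R1 <= cabs z -> cabs z <= R2 -> R1 ^+ 2 <= cabs (z ^+ 2) <= R2 ^+ 2.
  by move=> z1 z2; rewrite cabsX !lerXn2r ?nnegrE ?cabs_ge0.
have sqr_rho z : R1 <= cabs z -> cabs z <= R2 -> 0 < cabs (z ^+ 2) < rho.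
  move=> z1 z2; have /andP[h1 h2] := sqr_in z z1 z2.
  by rewrite (le_lt_trans h2)// andbT (lt_le_trans _ h1)// exprn_gt0.
have bnd z : R1 <= cabs z -> cabs z <= R2 -> `|rotsum phi n ((c * z) ^+ 2)| <= n%:R * S.
  move=> z1 z2; apply: rotsum_abs => j; apply: phiS; rewrite cabs_rot cabsX cabsM c1 mul1r -cabsX.
  exact: sqr_in.
have Ubnd z : R1 <= cabs z -> cabs z <= R2 -> U z <= 2 * n%:R * S.
  move=> z1 z2; have := bnd z z1 z2; have := bnd z^*%C; rewrite cabsJ => /(_ z1 z2).
  rewrite !ler_norml /U => /andP[h1 h2] /andP[h3 h4]; move: h1 h2 h3 h4; clear.
  by move: (rotsum _ _ _) (rotsum _ _ _) => x y; lra.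
have barE (z : C) (s : R) : cabs z = s -> 0 < s -> bar z = bar (s%:C : C).
  by move=> zs s0; apply: bar_eq; rewrite cabs_real gtr0_norm.
have bar_neg z : R1 <= cabs z -> cabs z <= R2 -> m * bar z <= m * bar (R2%:C : C).
  move=> z1 z2; rewrite ler_wpM2l//; apply: bar_le; first exact: lt_le_trans z1.
    by rewrite cabs_real gtr0_norm.
  by rewrite cabs_real gtr0_norm.
have sbE z : region g1 g2 g3 g4 z -> (A * cabs z ^+ n + B * (cabs z ^+ n)^-1) / 2 <= sector_barrier n A B z.
  move=> /regP[z1 z2 [s sP zE]]; have z0 : 0 < cabs z by exact: lt_le_trans z1.
  rewrite [in leRHS]zE sector_barrierE// ler_wpM2l ?sector_angle//.
  by rewrite addr_ge0 ?mulr_ge0 ?invr_ge0 ?exprn_ge0 ?cabs_ge0.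
have sb0 z : region g1 g2 g3 g4 z -> 0 <= sector_barrier n A B z.
  move=> zK; apply: le_trans (sbE z zK).
  by rewrite divr_ge0// addr_ge0 ?mulr_ge0 ?invr_ge0 ?exprn_ge0 ?cabs_ge0.
have zK : region g1 g2 g3 g4 (r%:C * expi t).
  have /andP[r1 r2] := rP; have r0 : 0 < r := lt_le_trans R10 r1.
  have /andP[t0 t1] := tP; have pi0 := pi_gt0 R.
  have pn : pi / (2 * n%:R) <= pi :> R.
    have p2 : 1 <= 2 * n%:R :> R.
      by have : 1 <= n%:R :> R; [rewrite ler1n|clear; lra].
    rewrite (ler_pdivrMr _ _ (lt_le_trans ltr01 p2)); exact: (ler_peMr (ltW pi0) p2).
  have rt : cabs (r%:C * expi t) = r by rewrite cabsM cabs_expi mulr1 cabs_real gtr0_norm.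
  split; rewrite /g1 /g2 /g3 /g4 ?rt ?subr_le0//.
    by rewrite ImM /= mul0r addr0 oppr_le0 mulr_ge0 ?(ltW r0)// sin_ge0_pi// t0 (le_trans t1).
  rewrite -mulrA -expiD ImM /= mul0r addr0 mulr_ge0_le0 ?(ltW r0)//.
  rewrite -opprB sinN oppr_le0 sin_ge0_pi// subr_ge0 t1 /= lerBlDr.
  by apply: le_trans pn _; rewrite lerDl.
have TP : T (r%:C * expi t) <= 0.
  apply: (max_principle gc (M := R2) _ _ _ zK).
  - by move=> z /regP[].
  - move=> z zreg; have [z1 z2 _] := regP z zreg.
    have z0 : 0 < cabs z := lt_le_trans R10 z1.
    have zr := sqr_rho z z1 z2.
    have rc (f : C -> C) : ccont f z -> cabs (f z) = cabs z ->
        rcont (fun w => rotsum phi n ((c * f w) ^+ 2)) z.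
      move=> fc fz; have cc : ccont (fun w => (c * f w) ^+ 2) z.
        by apply: (ccontM (ccontM (ccont_cst _ _) fc) (ccontM (ccont_cst _ _) fc)).
      apply: (rcont_ccomp cc); apply: (rotsum_cont qh).
      by rewrite cabsX cabsM c1 mul1r fz -cabsX.
    apply: rcontD; last exact: rcontN (rcont_sector_barrier _ _ _ z0).
    apply: rcontD (rcont_cst _ _); apply: rcontD.
      apply: rcontD; first exact: (rc _ (ccont_id z)).
      apply: rcontN; exact: (rc _ (ccont_conj z) (cabsJ z)).
    apply: rcontD; apply: rcontM (rcont_cst _ _) _; last exact: rcont_ln_cabs.
    by apply: rcont_bar; rewrite z0 (le_lt_trans z2).
  - move=> z zreg; have [z1 z2 _] := regP z zreg.
    have z0 : 0 < cabs z := lt_le_trans R10 z1.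
    have sb := sb0 z zreg; have sb' := sbE z zreg; have bz := bar_neg z z1 z2.
    have [e1|ne1] := eqVneq (cabs z) R1.
      left; have Uz := Ubnd z z1 z2.
      have : 4 * n%:R * S <= A * cabs z ^+ n + B * (cabs z ^+ n)^-1.
        rewrite e1 /B mulfK ?expf_neq0 ?gt_eqF// lerDr mulr_ge0// exprn_ge0//.
      by move: sb' bz Uz; rewrite /T; clear; lra.
    have [e2|ne2] := eqVneq (cabs z) R2.
      left; have Uz := Ubnd z z1 z2.
      have : 4 * n%:R * S <= A * cabs z ^+ n + B * (cabs z ^+ n)^-1.
        rewrite e2 /A divfK ?expf_neq0 ?gt_eqF// lerDl mulr_ge0// invr_ge0 exprn_ge0//.
      by move: sb' bz Uz; rewrite /T; clear; lra.
    have [e3|ne3] := eqVneq (complex.Im z) 0.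
      left; have -> : T z = m * bar z - m * bar (R2%:C : C) - sector_barrier n A B z.
        have zJ : z^*%C = z by case: (z) e3 => x y /= ->; rewrite oppr0.
        by rewrite /T /U zJ subrr; ring.
      by move: bz sb; clear; lra.
    have [e4|ne4] := eqVneq (complex.Im (z * expi (- (pi / (2 * n%:R))))) 0.
      left; have -> : T z = m * bar z - m * bar (R2%:C : C) - sector_barrier n A B z.
        (* On the upper ray, [z] is its mirror image turned by pi / n; squaring doubles the angle to
           2 pi / n, under which the rotation sum is invariant. *)
        have zJ : z = expi (pi / n%:R) * z^*%C.
          set e := expi _ in e4.
          have wJ : (z * e)^*%C = z * e by case: (z * e) e4 => x y /= ->; rewrite oppr0.
          have eE : e * expi (pi / (2 * n%:R)) = 1 by rewrite -expiD addNr expi0.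
          have -> : expi (pi / n%:R) = expi (pi / (2 * n%:R)) * e^*%C.
            rewrite conj_expi opprK -expiD; congr expi; field.
            by rewrite gt_eqF.
          have JM (u v : C) : u^*%C * v^*%C = (u * v)^*%C by rewrite (rmorphM (@conjc R)).
          by rewrite -mulrA (mulrC e^*%C) JM wJ mulrC -mulrA eE mulr1.
        rewrite /T /U.
        have -> : rotsum phi n ((c * z) ^+ 2) = rotsum phi n ((c * z^*%C) ^+ 2).
          rewrite {1}zJ mulrCA exprMn expiX -[RHS](rotsum_rot phi _ n0); congr rotsum.
          by congr (expi _ * _); rewrite mulrA.
        by rewrite subrr; ring.
      by move: bz sb; clear; lra.
    right; split.
      have [h1 h2 h3 h4] := zreg; split.
      - by rewrite lt_neqAle h1 andbT subr_eq0 eq_sym.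
      - by rewrite lt_neqAle h2 andbT subr_eq0.
      - by rewrite lt_neqAle h3 andbT oppr_eq0.
      - by rewrite lt_neqAle h4 andbT.
    have z01 : 0 < cabs z < 1 by rewrite z0 (le_lt_trans z2).
    exists (2 * n%:R * kap z); first by rewrite !mulr_gt0 ?kap_gt0.
    have [l1 _] := rotsum_sqr_lap n qh c1 (sqr_rho z z1 z2).
    have zJr : 0 < cabs (z^*%C ^+ 2) < rho by rewrite cabsX cabsJ -cabsX; exact: sqr_rho.
    have [_ l2] := rotsum_sqr_lap n qh c1 zJr.
    have {}l2 := lap_ge_conj (z0 := z) l2; rewrite (kap_eq (cabsJ z)) in l2.
    have := lap_geD (lap_geD (lap_geD (lap_geD l1 l2) (lap_ge_bar m 0 z01))
      (lap_ge_cst (- (m * bar (R2%:C : C))) z)) (lap_ge_sector_barrier n A B z0).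
    by apply: lap_ge_le; rewrite le_eqVlt; apply/orP; left; apply/eqP; rewrite /m; ring.
move: TP; rewrite /T /U.
have /andP[r1 r2] := rP; have r0 : 0 < r := lt_le_trans R10 r1.
have -> : (r%:C * expi t)^*%C = r%:C * expi (- t).
  have -> : (r%:C * expi t)^*%C = (r%:C)^*%C * (expi t)^*%C by rewrite (rmorphM (@conjc R)).
  by rewrite conj_expi; congr (_ * _); apply: eqC; rewrite /= ?oppr0.
have rt : cabs (r%:C * expi t) = r by rewrite cabsM cabs_expi mulr1 cabs_real gtr0_norm.
rewrite (barE _ _ rt r0) sector_barrierE// => H.
have : (A * r ^+ n + B * (r ^+ n)^-1) * cos (n%:R * t - pi / 4) <=
    4 * n%:R * S * ((r / R2) ^+ n + (R1 / r) ^+ n).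
  have -> : 4 * n%:R * S * ((r / R2) ^+ n + (R1 / r) ^+ n) = A * r ^+ n + B * (r ^+ n)^-1.
    rewrite /A /B !expr_div_n; field.
    by rewrite !expf_neq0 ?gt_eqF.
  have r0' := ltW r0; have AB : 0 <= A * r ^+ n + B * (r ^+ n)^-1.
    by apply: addr_ge0; apply: mulr_ge0 => //; rewrite ?invr_ge0 exprn_ge0.
  exact: (ler_piMr AB (cos_le1 _)).
move: H; rewrite -/m; clear -m.
rewrite /m; move: (rotsum _ _ _) (rotsum _ _ _) (bar _) (bar _) ((_ + _) * cos _) (ln _) (_ ^+ n + _).
by clear; move=> x1 x2 x3 x4 x5 x6 x7; lra.
Qed.

End Oscillation.

(** * Oscillation of rotation sums on a circle *)

Section CircleOscillation.
Variable R : realType.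
Local Notation C := R[i].

(** The angle from [g] to [b], made nonnegative by adding 2 pi, is divided by 2 pi / n. The
    remainder is written 4 t because points at angles t and - t have squares whose arguments differ
    by 4 t. *)
Lemma sector_angles (n : nat) (b g : R) : (0 < n)%N -> - pi <= b <= pi -> - pi <= g <= pi ->
  exists k : nat, exists2 t : R, 0 <= t <= pi / (2 * n%:R) &
    expi b = expi (k%:R * (2 * pi / n%:R)) * expi (g + 4 * t).
Proof.
move=> n0 /andP[b1 b2] /andP[g1 g2].
have nR : 0 < n%:R :> R by rewrite ltr0n.
have pi0 := pi_gt0 R.
pose dlt : R := b + 2 * pi - g; have d0 : 0 <= dlt by rewrite /dlt; lra.
pose p : R := 2 * pi / n%:R; have p0 : 0 < p by rewrite divr_gt0// mulr_gt0.
pose k := Num.truncn (dlt / p).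
have /andP[k1 k2] : k%:R <= dlt / p < k.+1%:R by apply: truncn_itv; rewrite divr_ge0// ltW.
exists k; exists ((dlt - k%:R * p) / 4).
  have {}k1 : k%:R * p <= dlt by rewrite -ler_pdivlMr.
  have {}k2 : dlt < (k%:R + 1) * p by rewrite natr1 -ltr_pdivrMr.
  have -> : pi / (2 * n%:R) = p / 4 by rewrite /p; field; rewrite gt_eqF.
  by move: k1 k2; clear; lra.
rewrite -expiD.
have -> : k%:R * (2 * pi / n%:R) + (g + 4 * ((dlt - k%:R * p) / 4)) = b + 2 * pi.
  by rewrite -/p /dlt; field.
by rewrite expiD expi2pi mulr1.
Qed.

(** Up to an n-th root of unity, the two points are squares of mirror images: [c] turns the mean
    direction onto the axis and R0 = sqrt |z|. The condition 2 d <= - ln |z| keeps the variation of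
    [bar] below ln 2 <= 1, and each arc contributes the factor exp(- n d / 2). *)
Lemma rotsum_osc (phi : C -> R) rho M N n (S d : R) z w : quasi_harmonic phi rho M N ->
  (0 < n)%N -> 0 < d -> cabs w = cabs z -> 0 < cabs z -> cabs z * expR d < rho ->
  2 * d <= - ln (cabs z) -> 0 <= S ->
  (forall y, cabs z * expR (- d) <= cabs y <= cabs z * expR d -> `|phi y| <= S) ->
  rotsum phi n z - rotsum phi n w <=
    2 * n%:R * (M + 1) + 8 * n%:R * S * expR (- (n%:R * (d / 2))).
Proof.
move=> qh n0 d0 wz z0 zrho dl S0 phiS.
have [b bP zE] := polar z; have [g gP wE] := polar w.
have [k [t tP bE]] := sector_angles n0 bP gP.
set r := cabs z in zE z0 zrho dl phiS.
pose R0 := Num.sqrt r; have R00 : 0 < R0 by rewrite sqrtr_gt0.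
have R0r : R0 * R0 = r by rewrite -expr2 sqr_sqrtr// ltW.
pose R1 := R0 * expR (- (d / 2)); pose R2 := R0 * expR (d / 2).
have ed (x : R) : (R0 * expR x) ^+ 2 = r * expR (2 * x).
  by rewrite exprMn expr2 R0r -expRM_natl.
have R1E : R1 ^+ 2 = r * expR (- d) by rewrite ed; congr (_ * expR _); field.
have R2E : R2 ^+ 2 = r * expR d by rewrite ed; congr (_ * expR _); field.
have R10 : 0 < R1 by rewrite mulr_gt0 ?expR_gt0.
have R20 : 0 < R2 by rewrite mulr_gt0 ?expR_gt0.
have d2 : 0 <= d / 2 by rewrite divr_ge0// ltW.
have R01 : R1 <= R0 by rewrite /R1 ler_piMr ?(ltW R00)// -[leRHS]expR0 ler_expR oppr_le0.
have R02 : R0 <= R2 by rewrite /R2 ler_peMr ?(ltW R00)// -[leLHS]expR0 ler_expR.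
pose c : C := expi ((g + 2 * t) / 2).
have cE s : (c * (R0%:C * expi s)) ^+ 2 = r%:C * expi (g + 2 * t + 2 * s).
  have rE : r%:C = R0%:C ^+ 2 :> C by rewrite -R0r; apply: eqC; rewrite /= ?mulr0; ring.
  rewrite !exprMn !expiX mulrCA -expiD rE.
  by congr (_ * expi _); field.
have zR : rotsum phi n z = rotsum phi n ((c * (R0%:C * expi t)) ^+ 2).
  rewrite cE zE bE mulrCA rotsum_rotn//; congr (rotsum _ _ (_ * expi _)); ring.
have wR : rotsum phi n w = rotsum phi n ((c * (R0%:C * expi (- t))) ^+ 2).
  by rewrite cE wE wz; congr (rotsum _ _ (_ * expi _)); ring.
have R0P : R1 <= R0 <= R2 by rewrite R01.
have phiS' y : R1 ^+ 2 <= cabs y <= R2 ^+ 2 -> `|phi y| <= S by rewrite R1E R2E; exact: phiS.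
have R2rho : R2 ^+ 2 < rho by rewrite R2E.
have c1 : cabs c = 1 by exact: cabs_expi.
have := sector_osc qh n0 c1 R10 R2rho (le_trans R01 R02) S0 phiS' tP R0P.
rewrite -zR -wR => H; apply: le_trans H _.
have n0' : 0 <= n%:R :> R by rewrite ler0n.
have M0 := qh_M qh.
apply: lerD.
  rewrite -[leRHS]mulr1; apply: ler_wpM2l; first by rewrite !mulr_ge0 ?addr_ge0.
  rewrite /bar !cabs_real !gtr0_norm// R2E expr2 R0r lnM ?posrE ?expR_gt0// expRK.
  set l := - ln r in dl; have l0 : 0 < l - d by move: d0 dl; clear; lra.
  have -> : - (ln r + d) = l - d by rewrite /l; ring.
  have : ln l <= ln (2 * (l - d)).
    by rewrite ler_ln ?posrE; move: d0 dl l0; clear; lra.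
  rewrite lnM ?posrE// => h.
  have : ln 2 <= 1 :> R by apply: (@le_ln1Dx R 1); lra.
  move: h; clear; lra.
have q1 : R0 / R2 = expR (- (d / 2)).
  by rewrite expRN /R2; field; rewrite !gt_eqF ?expR_gt0.
have q2 : R1 / R0 = expR (- (d / 2)).
  by rewrite /R1; field; rewrite !gt_eqF.
rewrite q1 q2 -expRM_natl mulrN le_eqVlt; apply/orP; left; apply/eqP; ring.
Qed.

(** An upper bound on [phi] for the other n - 1 summands converts a lower bound on the rotation sum
    into one on a single value. *)
Lemma rotsum_le (phi : C -> R) n z B : (0 < n)%N -> 0 <= B ->
  (forall w, cabs w = cabs z -> phi w <= B) -> rotsum phi n z <= phi z + n%:R * B.
Proof.
case: n => // n _ B0 phiB; rewrite /rotsum big_ord_recl mul0r expi0 mul1r lerD2l.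
apply: le_trans (_ : n%:R * B <= _); last by rewrite ler_wpM2r// ler_nat.
have -> : n%:R * B = \sum_(i < n) B by rewrite sumr_const card_ord mulr_natl.
by apply: ler_sum => i _; apply: phiB; rewrite cabs_rot.
Qed.

Lemma expRN_le (x : R) : 0 < x -> expR (- x) <= 2 / x ^+ 2.
Proof.
move=> x0; rewrite expRN -[leRHS]invrK lef_pV2 ?posrE ?expR_gt0 ?invr_gt0 ?divr_gt0 ?exprn_gt0//.
apply: le_trans (expR_ge1Dxn 1 (ltW x0)).
by rewrite invf_div lerDr.
Qed.

Lemma ln_cabs_le (z : C) (s : R) : 0 < cabs z -> (expR (- s) <= cabs z) = (- ln (cabs z) <= s).
Proof. by move=> z0; rewrite -{1}(lnK z0) ler_expR lerNl. Qed.

Lemma ln_cabs_ge (z : C) (s : R) : 0 < cabs z -> (cabs z <= expR (- s)) = (s <= - ln (cabs z)).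
Proof. by move=> z0; rewrite -{1}(lnK z0) ler_expR lerNr. Qed.

End CircleOscillation.

(** * A quadratic bound in the logarithm *)

Section CrudeBound.
Variable R : realType.
Local Notation C := R[i].

(** The absorption step. From n d1^2 > 12 q one gets n e <= 32 / (n d1^2) < 32 / (12 q), which is at
    most 1/64 once q > 171, so the term in q^2 on the right is at most q^2 / 2. Then n d1^2 <= 13 q
    gives q^2 / 2 <= 13 q K2 t1. *)
Lemma crude_alg (q d1 t1 K2 n e : R) : 171 < q -> 0 < d1 -> d1 <= 1 -> 0 <= K2 -> 0 <= t1 ->
  12 * q / d1 ^+ 2 < n -> n <= 12 * q / d1 ^+ 2 + 1 -> 0 <= e -> e <= 2 / (n * (d1 / 4)) ^+ 2 ->
  q ^+ 2 <= n * (K2 * t1 * d1 ^+ 2 + 32 * q ^+ 2 * e) -> q <= 26 * K2 * t1.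
Proof.
move=> q171 d10 d1l K20 t10; rewrite ltr_pdivrMr ?exprn_gt0// => nl nu e0 eb H.
have q0 : 0 < q by lra.
have d120 : 0 < d1 ^+ 2 by rewrite exprn_gt0.
have d12 : d1 ^+ 2 <= 1 by rewrite exprn_ile1// ltW.
have n0 : 0 < n by rewrite -(pmulr_lgt0 _ d120); apply: lt_trans nl; rewrite mulr_gt0.
have ne : 32 * (n * e) <= 1 / 2.
  have : n * e <= n * (2 / (n * (d1 / 4)) ^+ 2) by rewrite ler_wpM2l// ltW.
  have -> : n * (2 / (n * (d1 / 4)) ^+ 2) = 32 / (n * d1 ^+ 2).
    by field; rewrite !gt_eqF.
  have : 32 / (n * d1 ^+ 2) <= 1 / 64.
    rewrite ler_pdivrMr ?mulr_gt0//; move: nl q171; clear; lra.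
  clear; lra.
have nd : n * d1 ^+ 2 <= 13 * q.
  have : n * d1 ^+ 2 <= (12 * q / d1 ^+ 2 + 1) * d1 ^+ 2 by rewrite ler_wpM2r// ltW.
  rewrite mulrDl divfK ?gt_eqF// mul1r; move: d12 q171; clear; lra.
have : n * d1 ^+ 2 * (K2 * t1) <= 13 * q * (K2 * t1) by rewrite ler_wpM2r// mulr_ge0.
have : 32 * (n * e) * q ^+ 2 <= 1 / 2 * q ^+ 2 by rewrite ler_wpM2r// exprn_ge0// ltW.
move=> h1 h2; rewrite -(ler_pM2r q0).
move: H h1 h2; rewrite expr2; clear.
move: (q * q) => qq.
have -> : n * (K2 * t1 * d1 ^+ 2 + 32 * qq * e) = n * d1 ^+ 2 * (K2 * t1) + 32 * (n * e) * qq by ring.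
have -> : 26 * K2 * t1 * q = 2 * (13 * q * (K2 * t1)) by ring.
lra.
Qed.

(* Maximise [D ^+ 2 * |phi|] over the annulus of logarithmic half-width 1, with [D]
   the logarithmic distance to its boundary; at the maximum [z1], [|phi|] is at most
   [4 X / d1 ^+ 2] on the annulus of half-width [d1 / 2], so that [rotsum_osc] with
   [n] of order [sqrt X / d1 ^+ 2] bounds [X]. *)
Lemma crude_bound (phi : C -> R) rho M N : quasi_harmonic phi rho M N ->
  exists L B, [/\ 1 <= L, expR (- L) < rho, 0 <= B &
    forall z, 0 < cabs z -> L < - ln (cabs z) -> `|phi z| <= B * ln (cabs z) ^+ 2].
Proof.
move=> qh; have [K [rb [K0 /andP[rb0 rbrho] low]]] := circle_lower qh.
have M0 := qh_M qh; have N0 := qh_N qh; have /andP[rho0 rho1] := qh_rho qh.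
have lrb : ln rb < 0 by rewrite ln_lt0// rb0 (lt_trans rbrho).
(* The three terms come from the lower bound at one point of the circle, the curvature part of the
   oscillation, and the upper bound on the remaining summands. *)
pose K2 := K + 2 * (M + 1) + N.
have K20 : 0 <= K2 by rewrite !addr_ge0 ?mulr_ge0 ?addr_ge0.
(* The value 2 - ln rb leaves room for the annulus of half-width 1 inside radius [rb]. In the
   constant, 171 covers small [q], and 52 is twice the 26 of [crude_alg] because t1 <= 2 t0. *)
exists (2 - ln rb), ((171 + 52 * K2) ^+ 2); split.
- by move: lrb; clear; lra.
- apply: lt_trans rbrho; rewrite -[ltRHS]lnK// ltr_expR; clear; lra.
- exact: sqr_ge0.
move=> z0 z00; set t0 := - ln (cabs z0) => Lt0.
pose D (z : C) : R := 1 - `|ln (cabs z) + t0|.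
pose r1 : R := expR (- (t0 + 1)); pose r2 : R := expR (- (t0 - 1)).
have r2rb : r2 < rb by rewrite -[ltRHS]lnK// ltr_expR; move: Lt0; clear; lra.
have r12 : r1 <= r2 by rewrite ler_expR; clear; lra.
have annP z : r1 <= cabs z <= r2 -> 0 < cabs z /\ `|ln (cabs z) + t0| <= 1.
  move=> /andP[zr1 zr2]; have zp : 0 < cabs z := lt_le_trans (expR_gt0 _) zr1.
  split=> //; move: zr1 zr2; rewrite ln_cabs_le// ln_cabs_ge// ler_norml; clear; lra.
have annI z : 0 < cabs z -> `|ln (cabs z) + t0| <= 1 -> r1 <= cabs z <= r2.
  move=> zp; rewrite ln_cabs_le// ln_cabs_ge// ler_norml; clear; lra.
have annrho z : r1 <= cabs z <= r2 -> 0 < cabs z < rho.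
  move=> zP; have [-> _] := annP z zP; have /andP[_ zr2] := zP.
  by rewrite (le_lt_trans zr2)// (lt_trans r2rb).
have [|z1 z1P zmax] := annulus_max (ltW (expR_gt0 _)) r12 (u := fun z => D z * D z * `|phi z|).
  move=> z zP; have [zp _] := annP z zP.
  have Dc : rcont D z.
    apply: rcontD (rcont_cst _ _) (rcontN _).
    by apply: (rcont_comp (rcontD (rcont_ln_cabs zp) (rcont_cst t0 z))); exact: norm_continuous.
  apply: rcontM (rcontM Dc Dc) _.
  by apply: (rcont_comp (qh_cont qh (annrho z zP))); exact: norm_continuous.
pose X := D z1 * D z1 * `|phi z1|.
have X0 : 0 <= X by rewrite mulr_ge0// -expr2 sqr_ge0.
have phi0X : `|phi z0| <= X.
  have -> : `|phi z0| = D z0 * D z0 * `|phi z0|.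
    by rewrite /D /t0 subrr normr0 subr0 !mul1r.
  by apply: zmax; apply: annI => //; rewrite /t0 subrr normr0.
apply: le_trans phi0X _.
have [z1p z1t] := annP z1 z1P.
pose q := Num.sqrt X; have q0 : 0 <= q by rewrite sqrtr_ge0.
have qX : q ^+ 2 = X by rewrite sqr_sqrtr.
have t02 : 2 <= t0 by move: Lt0 lrb; clear; lra.
suff qb : q <= (171 + 52 * K2) * t0.
  have -> : ln (cabs z0) ^+ 2 = t0 ^+ 2 by rewrite sqrrN.
  have b0 := le_trans q0 qb.
  by rewrite -/X -qX -exprMn ler_sqr ?nnegrE.
have [q171|q171] := leP q 171.
  apply: le_trans q171 _; rewrite mulrDl -[leLHS]addr0; apply: lerD.
    by move: t02; clear; lra.
  by rewrite !mulr_ge0//; move: t02; clear; lra.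
pose t1 := - ln (cabs z1); pose d1 := D z1.
have d1E : `|t1 - t0| = 1 - d1 by rewrite /d1 /D /t1 distrC opprK addrC; ring.
have d10 : 0 < d1.
  rewrite lt_neqAle subr_ge0 z1t andbT; apply/eqP => d1e.
  by move: q171; rewrite /q /X -/d1 -d1e !mul0r sqrtr0; clear; lra.
have d1l : d1 <= 1 by have := normr_ge0 (t1 - t0); rewrite d1E; clear; lra.
have /andP[t1a t1b] : t0 - 1 + d1 <= t1 <= t0 + 1 - d1.
  have : `|t1 - t0| <= 1 - d1 by rewrite d1E.
  by rewrite ler_norml; clear; lra.
have t11 : 1 <= t1 by move: t1a t02 d10; clear; lra.
have t10 : 0 <= t1 by rewrite (le_trans _ t11).
suff qb : q <= 26 * K2 * t1.
  apply: le_trans qb _.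
  have : K2 * t1 <= K2 * (2 * t0) by rewrite ler_wpM2l//; move: t1b d10 t02; clear; lra.
  by move: t02; clear; lra.
pose n := (Num.truncn (12 * q / d1 ^+ 2)).+1.
have /andP[nu nl] : (Num.truncn (12 * q / d1 ^+ 2))%:R <= 12 * q / d1 ^+ 2 < n%:R.
  by apply: truncn_itv; apply: divr_ge0 (mulr_ge0 _ q0) (sqr_ge0 _).
have {}nu : n%:R <= 12 * q / d1 ^+ 2 + 1 by rewrite /n -natr1 lerD2r.
pose e : R := expR (- (n%:R * (d1 / 2 / 2))).
have e0 : 0 <= e by rewrite expR_ge0.
have nR : 0 < n%:R :> R by rewrite ltr0n.
have eb : e <= 2 / (n%:R * (d1 / 4)) ^+ 2.
  have -> : n%:R * (d1 / 4) = n%:R * (d1 / 2 / 2) by field.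
  by apply: expRN_le; rewrite !mulr_gt0 ?invr_gt0.
apply: (crude_alg q171 d10 d1l K20 t10 nl nu e0 eb).
pose S := 4 * X / d1 ^+ 2.
have d120 : 0 < d1 ^+ 2 by rewrite exprn_gt0.
have S0 : 0 <= S by rewrite divr_ge0 ?mulr_ge0// ltW.
have phi1 : d1 ^+ 2 * `|phi z1| = q ^+ 2 by rewrite qX expr2.
have z1E : cabs z1 = expR (- t1) by rewrite opprK lnK.
have z1rb : 0 < cabs z1 < rb by case/andP: z1P => _ /le_lt_trans ->//; rewrite z1p.
(* The lower bound is known at an uncontrolled point [w] of the circle; the oscillation estimate
   carries it to [z1]. *)
have [w wE wl] := low n (cabs z1) isT z1rb.
have osc : rotsum phi n w - rotsum phi n z1 <= 2 * n%:R * (M + 1) + 8 * n%:R * S * e.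
  apply: (@rotsum_osc R phi rho M N n S (d1 / 2) w z1 qh isT); rewrite ?wE// ?divr_gt0//.
  - apply: lt_trans rbrho; apply: le_lt_trans r2rb.
    by rewrite z1E -expRD ler_expR; move: t1a d10; clear; lra.
  - by move: d1l t11; rewrite -/t1; clear; lra.
  - move=> y; rewrite z1E -!expRD.
    have -> : - t1 + - (d1 / 2) = - (t1 + d1 / 2) by ring.
    have -> : - t1 + d1 / 2 = - (t1 - d1 / 2) by ring.
    move=> /andP[y1 y2].
    have yp : 0 < cabs y := lt_le_trans (expR_gt0 _) y1.
    move: y1 y2; rewrite ln_cabs_le// ln_cabs_ge// => y1 y2.
    have yt : `|ln (cabs y) + t0| <= 1 - d1 / 2.
      rewrite ler_norml; move: y1 y2 t1a t1b; clear; lra.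
    have yD : d1 / 2 <= D y by move: yt; rewrite /D; clear; lra.
    have yann : r1 <= cabs y <= r2 by apply: annI => //; move: yt d10; clear; lra.
    rewrite /S ler_pdivlMr//; have := zmax y yann; rewrite -/X.
    have : d1 / 2 * (d1 / 2) * `|phi y| <= D y * D y * `|phi y|.
      by rewrite ler_wpM2r// ler_pM// divr_ge0// ltW.
    have -> : d1 / 2 * (d1 / 2) * `|phi y| = (`|phi y| * d1 ^+ 2) / 4 by field.
    by clear; lra.
have phiN y : cabs y = cabs z1 -> phi y <= N * t1.
  move=> yE; have := qh_le qh (z := y); rewrite yE; apply.
  exact: annrho.
have rl : rotsum phi n z1 <= phi z1 + n%:R * (N * t1).
  by apply: rotsum_le => //; rewrite mulr_ge0.
have phl : `|phi z1| <= n%:R * (K2 * t1 + 8 * S * e).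
  have n1 : 1 <= n%:R :> R by rewrite ler1n.
  have Mt : M + 1 <= (M + 1) * t1 by rewrite ler_peMr// addr_ge0.
  have nMt : n%:R * (M + 1) <= n%:R * ((M + 1) * t1) by rewrite ler_wpM2l.
  rewrite ler_norml; apply/andP; split.
    move: osc wl rl; rewrite -[- ln _]/t1.
    have -> : n%:R * (K2 * t1 + 8 * S * e) = n%:R * K * t1 + 2 * (n%:R * ((M + 1) * t1)) +
       n%:R * (N * t1) + 8 * n%:R * S * e by rewrite /K2; ring.
    have -> : 2 * n%:R * (M + 1) = 2 * (n%:R * (M + 1)) by rewrite mulrA.
    by move: nMt; clear; lra.
  apply: le_trans (phiN z1 erefl) _.
  have : N * t1 <= K2 * t1 + 8 * S * e.
    have Se : 0 <= 8 * S * e by apply: (mulr_ge0 _ e0); apply: mulr_ge0 S0.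
    move: Se.
    have : N * t1 <= K2 * t1 by rewrite ler_wpM2r// /K2 lerDr addr_ge0// mulr_ge0// addr_ge0.
    by clear; lra.
  move=> h; apply: le_trans h _; apply: ler_peMl n1.
  by rewrite addr_ge0//; [exact: mulr_ge0|apply: (mulr_ge0 _ e0); exact: mulr_ge0 S0].
have : d1 ^+ 2 * `|phi z1| <= d1 ^+ 2 * (n%:R * (K2 * t1 + 8 * S * e)).
  by rewrite ler_wpM2l// ltW.
rewrite phi1 => h; apply: le_trans h _; rewrite le_eqVlt; apply/orP; left; apply/eqP.
rewrite /S qX; field.
by rewrite gt_eqF.
Qed.

End CrudeBound.

(** * Existence of the order of growth *)

Section GrowthLimit.
Variable R : realType.
Local Notation C := R[i].

(** With n = 1 and half-width t / 4, where t = - ln |z|, the crude bound makes S quadratic in t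
    while its factor exp(- t / 8) decays faster, so the oscillation stays bounded. *)
Lemma circle_osc (phi : C -> R) rho M N : quasi_harmonic phi rho M N ->
  exists L B, [/\ 1 <= L, expR (- L) < rho, 0 <= B &
    forall z w, 0 < cabs z -> L < - ln (cabs z) -> cabs w = cabs z -> phi w - phi z <= B].
Proof.
move=> qh; have [L [B [L1 Lrho B0 cb]]] := crude_bound qh; have M0 := qh_M qh.
(* Doubling [L] keeps 3 t / 4, the least logarithmic radius met, above [L]. The constant is 8
   (5/4)^2 128 = 1600, from S = B (5 t / 4)^2 and exp(- t / 8) <= 128 / t^2. *)
exists (2 * L), (2 * (M + 1) + 1600 * B); split.
- by move: L1; clear; lra.
- by apply: lt_trans Lrho; rewrite ltr_expR; move: L1; clear; lra.
- by move: M0 B0; clear; lra.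
move=> z w z0; set t := - ln (cabs z) => Lt wz.
have t2 : 2 <= t by move: Lt L1; clear; lra.
have t0 : 0 < t by move: t2; clear; lra.
have zE : cabs z = expR (- t) by rewrite opprK lnK.
pose S := B * (5 / 4 * t) ^+ 2.
have S0 : 0 <= S by rewrite mulr_ge0// sqr_ge0.
have t40 : 0 < t / 4 by rewrite divr_gt0.
have := @rotsum_osc R phi rho M N 1 S (t / 4) w z qh isT t40 (esym wz).
rewrite !rotsum1 wz !mul1r !mulr1 => /(_ z0) osc; apply: le_trans (osc _ _ S0 _) _.
- by apply: lt_trans Lrho; rewrite zE -expRD ltr_expR; move: Lt L1; clear; lra.
- by rewrite -/t; move: t0; clear; lra.
- move=> y; rewrite zE -!expRD.
  have -> : - t + - (t / 4) = - (t + t / 4) by ring.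
  have -> : - t + t / 4 = - (t - t / 4) by ring.
  move=> /andP[y1 y2].
  have yp : 0 < cabs y := lt_le_trans (expR_gt0 _) y1.
  move: y1 y2; rewrite ln_cabs_le// ln_cabs_ge// => y1 y2.
  apply: le_trans (cb y yp _) _; first by move: y2 Lt L1; clear; lra.
  rewrite /S; apply: ler_wpM2l => //; rewrite -sqrrN ler_sqr ?nnegrE; move: y1 y2 t0; clear; lra.
rewrite lerD2l.
have t80 : 0 < t / 4 / 2 by rewrite divr_gt0.
apply: le_trans (_ : 8 * S * (2 / (t / 4 / 2) ^+ 2) <= _).
  by apply: ler_wpM2l (expRN_le t80); apply: mulr_ge0.
rewrite le_eqVlt; apply/orP; left; apply/eqP; rewrite /S; field.
by rewrite gt_eqF.
Qed.

(** The point supplied by [circle_lower] with n = 1 now controls its whole circle through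
    [circle_osc]. *)
Lemma growth_lower (phi : C -> R) rho M N : quasi_harmonic phi rho M N ->
  exists L B, [/\ 1 <= L, expR (- L) < rho, 0 <= B &
    forall z, 0 < cabs z -> L < - ln (cabs z) -> - (B * - ln (cabs z)) <= phi z].
Proof.
move=> qh; have [L [B [L1 Lrho B0 osc]]] := circle_osc qh.
have [K [rb [K0 /andP[rb0 rbrho] low]]] := circle_lower qh.
have lrb : ln rb < 0.
  by rewrite ln_lt0// rb0 (lt_trans rbrho)//; case/andP: (qh_rho qh).
exists (L - ln rb), (K + B); split.
- by move: lrb L1; clear; lra.
- by apply: lt_trans Lrho; rewrite ltr_expR; move: lrb; clear; lra.
- exact: addr_ge0.
move=> z z0 Lt.
have zrb : 0 < cabs z < rb.
  by rewrite z0 -ltr_ln ?posrE//; move: Lt L1; clear; lra.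
have [w wz wl] := low 1 (cabs z) isT zrb.
move: wl; rewrite rotsum1 mul1r => wl.
have LL : L < - ln (cabs z) by move: Lt lrb; clear; lra.
have := osc z w z0 LL wz; rewrite mulrDl opprD.
have : B <= B * - ln (cabs z) by rewrite ler_peMr//; move: LL L1; clear; lra.
by move: wl; clear; lra.
Qed.

(* [mu] is the upper limit of [phi / (- ln |z|)].  Points approaching it occur
   arbitrarily close to 0 and, by [circle_osc], control their whole circles; the
   maximum principle between two such circles gives the lower bound. *)
Lemma growth_limit (phi : C -> R) rho M N : quasi_harmonic phi rho M N ->
  exists mu, forall e, 0 < e -> exists L, forall z, 0 < cabs z -> L < - ln (cabs z) ->
    `|phi z - mu * - ln (cabs z)| <= e * - ln (cabs z).
Proof.
move=> qh; have M0 := qh_M qh; have N0 := qh_N qh.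
have [L [B [L1 Lrho B0 osc]]] := circle_osc qh.
have [L' [A [L'1 L'rho A0 low]]] := growth_lower qh.
have inrho z : 0 < cabs z -> L < - ln (cabs z) -> 0 < cabs z < rho.
  move=> z0 Lz; rewrite z0; apply: lt_trans Lrho.
  by rewrite -{1}(lnK z0) ltr_expR ltrNr.
pose Sg : set R := [set x | exists L, forall z, 0 < cabs z -> L < - ln (cabs z) ->
  phi z <= x * - ln (cabs z)].
have SgN : Sg N by exists L => z z0 Lz; exact: (qh_le qh (inrho z z0 Lz)).
have Sglb : lbound Sg (- A).
  move=> x [Lx xP]; pose t := Num.max (Num.max Lx L') 1 + 1.
  have : Num.max (Num.max Lx L') 1 < t by rewrite ltrDl.
  rewrite !gt_max => /andP[/andP[tx tl] t1].
  have ct : cabs ((expR (- t))%:C : C) = expR (- t) by rewrite cabs_real gtr0_norm ?expR_gt0.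
  have := xP ((expR (- t))%:C : C); have := low ((expR (- t))%:C : C).
  rewrite ct expRK opprK expR_gt0 => /(_ isT tl) h1 /(_ isT tx) h2.
  have t0 : 0 < t := lt_trans ltr01 t1.
  by rewrite -(ler_pM2r t0) mulNr; apply: le_trans h1 h2.
have Sginf : has_inf Sg by split; [exists N|exists (- A)].
pose mu := inf Sg; exists mu => e e0.
have [x [Lx xP] xmu] : exists2 x, Sg x & x < mu + e by exact: inf_adherent.
have e2 : 0 < e / 2 by rewrite divr_gt0.
(* Otherwise mu - e / 2 would belong to [Sg], below its infimum. *)
have large (Lb : R) : exists z : C, [/\ 0 < cabs z, Lb < - ln (cabs z) & (mu - e / 2) * - ln (cabs z) < phi z].
  apply: contrapT => nz; have : Sg (mu - e / 2).
    exists Lb => z z0 Lz; rewrite leNgt; apply/negP => h; apply: nz; by exists z.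
  move=> /(inf_lbound Sginf.2); rewrite -/mu; move: e2; clear; lra.
have [z1 [z10 Lz1 z1P]] := large L.
pose t1 := - ln (cabs z1).
have M1 : 0 < M + 1 by rewrite ltr_wpDl.
(* [a] and [D] make (M + 1) ln(2 t) + B, the cost of the barrier and of the oscillation, at most (e
   / 2) t for large t; the other e / 2 is spent in choosing [z1] and [z2]. *)
pose a := e / (8 * (M + 1)); have a0 : 0 < a by rewrite divr_gt0// mulr_gt0.
pose D := B - (M + 1) * ln a.
exists (Num.max (Num.max Lx t1) (4 * D / e)) => z z0; rewrite !gt_max => /andP[/andP[zx zt1] zD].
set t := - ln (cabs z) in zx zt1 zD *.
have Lt : L < t := lt_trans Lz1 zt1.
have t0 : 0 < t by apply: lt_trans Lt; apply: lt_le_trans L1.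
rewrite ler_distl; apply/andP; split; last first.
  apply: le_trans (xP z z0 zx) _; rewrite -mulrDl ler_wpM2r ?(ltW t0)//; exact: ltW.
have [z2 [z20 Lz2 z2P]] := large t.
pose k := - (mu - e / 2).
pose u w := - phi w + ((M + 1) * bar w + k * ln (cabs w)) + - B.
have ub i (zi w : C) : 0 < cabs zi -> L < - ln (cabs zi) -> (mu - e / 2) * - ln (cabs zi) < phi zi ->
    cabs w = i -> i = cabs zi -> u w <= 0.
  move=> zi0 Lzi ziP wi izi; have wz : cabs zi = cabs w by rewrite wi izi.
  have w0 : 0 < cabs w by rewrite -wz.
  have Lw : L < - ln (cabs w) by rewrite -wz.
  have h := osc w zi w0 Lw wz; move: ziP; rewrite wz.
  have b0 : bar w <= 0.
    by rewrite /bar oppr_le0 ln_ge0// ln_sqr_cabs//; move: Lw L1; clear; lra.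
  have Mb : (M + 1) * bar w <= 0 by rewrite pmulr_rle0.
  by rewrite /u /k; move: h Mb; clear; lra.
have zP : cabs z2 <= cabs z <= cabs z1.
  have tz (w : C) : 0 < cabs w -> cabs w = expR (- - ln (cabs w)) by move=> ?; rewrite opprK lnK.
  rewrite (tz z2)// (tz z)// (tz z1)// !ler_expR -/t -/t1.
  by move: Lz2 zt1; clear; lra.
have annL w : cabs z2 <= cabs w <= cabs z1 -> 0 < cabs w /\ L < - ln (cabs w).
  move=> /andP[w2 w1]; have w0 := lt_le_trans z20 w2; split=> //.
  by apply: lt_le_trans Lz1 _; rewrite lerN2 ler_ln ?posrE.
have uz : u z <= 0.
  apply: (@annulus_max_principle R (cabs z2) (cabs z1) u _ _ _ _ z zP).
  - move=> w /annL[w0 Lw]; have wr := inrho w w0 Lw.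
    have w1 := qh_lt1 qh wr.
    apply: rcontD (rcont_cst _ _); apply: rcontD (rcontN (qh_cont qh wr)) _.
    by apply: rcontD; apply: rcontM (rcont_cst _ _) _; [exact: rcont_bar|exact: rcont_ln_cabs].
  - by move=> w _ wi; apply: (ub (cabs z2) z2 w) => //; exact: lt_trans Lt Lz2.
  - by move=> w _ wi; apply: (ub (cabs z1) z1 w).
  - move=> w /andP[w2 w1]; have [w0 Lw] : 0 < cabs w /\ L < - ln (cabs w).
      by apply: annL; rewrite !ltW.
    have wr := inrho w w0 Lw; have wl1 := qh_lt1 qh wr.
    exists (kap w); first exact: kap_gt0.
    have := lap_geD (lap_geD (qh_lapN qh wr) (lap_ge_bar (M + 1) k wl1)) (lap_ge_cst (- B) w).
    by apply: lap_ge_le; rewrite le_eqVlt; apply/orP; left; apply/eqP; ring.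
move: uz; rewrite /u /k /bar ln_sqr_cabs// => uz.
have lnb : (M + 1) * ln (2 * t) <= e / 4 * t - (M + 1) * ln a.
  have -> : e / 4 * t = (M + 1) * (a * (2 * t)) by rewrite /a; field; rewrite gt_eqF.
  have t2 : 0 < 2 * t by rewrite mulr_gt0.
  have := ln_sublinear (mulr_gt0 a0 t2); rewrite lnM ?posrE// => h.
  by rewrite -mulrBr (ler_pM2l M1) lerBrDl ltW.
have Dt : D <= e / 4 * t.
  by move: zD; rewrite ltr_pdivrMr// => zD; move: zD; clear; lra.
move: uz lnb Dt; rewrite -mulrN -/t /D; clear.
have -> : ln (cabs z) = - t by rewrite opprK.
by clear; lra.
Qed.

End GrowthLimit.

(** * Smooth functions and Wirtinger derivatives *)

Section CkCalculus.
Variable R : realType.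
Local Notation C := R[i].
Local Notation Co := (R[i]^o).

Lemma rderP (v : C) (u : C -> R) z : derivable (rline u z v) 0 1 ->
  is_derive (0 : R) 1 (rline u z v) (rder v u z).
Proof. by move=> ud; rewrite /rder derive1E; exact: derivableP. Qed.

Lemma rder_val (v : C) (u : C -> R) z l : is_derive (0 : R) 1 (rline u z v) l -> rder v u z = l.
Proof. by move=> ul; rewrite /rder derive1E; exact: derive_val. Qed.

Lemma rline0 (v : C) (u : C -> R) z : rline u z v 0 = u z.
Proof. by rewrite /rline mul0r addr0. Qed.

Lemma copenP (U : set C) z : copen U -> U z -> \forall w \near (z : Co), U w.
Proof. by move=> Uo Uz; exact: open_nbhs_nbhs. Qed.

Lemma near_line (P : set C) (z v : C) : (\forall w \near (z : Co), P w) ->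
  \forall t \near (0 : R), P (z + t%:C * v).
Proof.
move=> /nbhsC[e e0 eP]; apply/nbhs_ballP; exists (e / (1 + cabs v)) => /=.
  by rewrite divr_gt0// ltr_wpDr// cabs_ge0.
move=> t; rewrite /ball /= sub0r normrN => te; apply: eP.
rewrite addrAC subrr add0r cabsM cabs_real.
have v1 : 0 < 1 + cabs v by rewrite ltr_wpDr// cabs_ge0.
rewrite ltr_pdivlMr// in te; apply: le_lt_trans te; rewrite ler_wpM2l//.
by rewrite lerDr.
Qed.

Lemma rline_near (v : C) (u w : C -> R) z : (\forall y \near (z : Co), u y = w y) ->
  \forall t \near (0 : R), rline u z v t = rline w z v t.
Proof. by move=> /near_line; apply. Qed.

Lemma rder_near (v : C) (u w : C -> R) z : (\forall y \near (z : Co), u y = w y) ->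
  rder v u z = rder v w z.
Proof. by move=> /rline_near uw; rewrite /rder !derive1E; exact: near_eq_derive. Qed.

Definition pdiff (u : C -> R) z := derivable (rline u z 1) 0 1 /\ derivable (rline u z 'i%C) 0 1.

Lemma CkE n (U : set C) (u : C -> R) : Ck n U u <-> (forall z, U z -> rcont u z) /\
  (if n is m.+1 then
    [/\ forall z, U z -> pdiff u z, Ck m U (rder 1 u) & Ck m U (rder 'i%C u)] else True).
Proof.
by case: n => [|n]; split=> -[uc ud]; split=> // z /uc; [split|case|split|case].
Qed.

Lemma Ck_cont n (U : set C) (u : C -> R) z : Ck n U u -> U z -> rcont u z.
Proof. by move=> /CkE[uc _]; exact: uc. Qed.

Lemma Ck_pdiff n (U : set C) (u : C -> R) z : Ck n.+1 U u -> U z -> pdiff u z.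
Proof. by move=> /CkE[_ [ud _ _]]; exact: ud. Qed.

Lemma Ck_rder n (U : set C) (u : C -> R) : Ck n.+1 U u -> Ck n U (rder 1 u) /\ Ck n U (rder 'i%C u).
Proof. by move=> /CkE[_ []]. Qed.

Lemma Ck_eq n (U : set C) (u w : C -> R) : copen U -> (forall z, U z -> u z = w z) -> Ck n U u -> Ck n U w.
Proof.
move=> Uo; elim: n => [|n IH] in u w * => uw /CkE[uc ud]; apply/CkE.
  by split=> // z Uz; apply: rcont_near (uc z Uz); apply: filterS (copenP Uo Uz) => y /uw.
have nuw z : U z -> \forall y \near (z : Co), u y = w y.
  by move=> Uz; apply: filterS (copenP Uo Uz) => y /uw.
have [ud1 u1 ui] := ud; split; first by move=> z Uz; exact: rcont_near (nuw z Uz) (uc z Uz).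
split.
- move=> z Uz; have [h1 hi] := ud1 z Uz.
  by split; [move: h1|move: hi]; apply: near_eq_derivable; exact: rline_near (nuw z Uz).
- by apply: IH u1 => z Uz; exact: rder_near (nuw z Uz).
- by apply: IH ui => z Uz; exact: rder_near (nuw z Uz).
Qed.

Lemma Ck_le n (U : set C) (u : C -> R) : Ck n.+1 U u -> Ck n U u.
Proof.
elim: n u => [|n IH] u /CkE[uc [ud u1 ui]]; apply/CkE; split=> //.
by split=> //; exact: IH.
Qed.

Lemma pdiff_cst (c : R) (z : C) : pdiff (fun=> c) z.
Proof. by split; exact: derivable_cst. Qed.

Lemma rder_cst (v : C) (c : R) (z : C) : rder v (fun=> c) z = 0.
Proof. by apply: rder_val; exact: is_derive_cst. Qed.

Lemma Ck_cst n (U : set C) (c : R) : copen U -> Ck n U (fun=> c).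
Proof.
move=> Uo; elim: n c => [|n IH] c; apply/CkE; split=> //; try by move=> *; exact: rcont_cst.
split; first by move=> z _; exact: pdiff_cst.
  by apply: (Ck_eq Uo) (IH 0) => z _; rewrite rder_cst.
by apply: (Ck_eq Uo) (IH 0) => z _; rewrite rder_cst.
Qed.

Lemma pdiffD (u w : C -> R) z : pdiff u z -> pdiff w z -> pdiff (fun y => u y + w y) z.
Proof.
move=> [u1 ui] [w1 wi]; split.
  have [H _] := derD (rderP u1) (rderP w1); exact: H.
have [H _] := derD (rderP ui) (rderP wi); exact: H.
Qed.

Lemma pdiffM (u w : C -> R) z : pdiff u z -> pdiff w z -> pdiff (fun y => u y * w y) z.
Proof.
move=> [u1 ui] [w1 wi]; split.
  have [H _] := derM (rderP u1) (rderP w1); exact: H.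
have [H _] := derM (rderP ui) (rderP wi); exact: H.
Qed.

(** [pdiff] provides derivatives along the two coordinate axes only, so the differentiation rules
    are restricted to these directions. *)
Variant dir : C -> Prop := Dir1 : dir 1 | Diri : dir 'i%C.

Lemma pdiffP (v : C) (u : C -> R) z : dir v -> pdiff u z -> is_derive (0 : R) 1 (rline u z v) (rder v u z).
Proof. by case=> -[h1 hi]; exact: rderP. Qed.

Lemma pdiff_intro (u : C -> R) z : (forall v, dir v -> exists l : R, is_derive (0 : R) 1 (rline u z v) l) ->
  pdiff u z.
Proof.
by move=> h; have [l1 h1] := h _ Dir1; have [li hi] := h _ Diri; split; exact: ex_derive.
Qed.

Lemma rderD (v : C) (u w : C -> R) z : dir v -> pdiff u z -> pdiff w z ->
  rder v (fun y => u y + w y) z = rder v u z + rder v w z.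
Proof.
move=> dv ud wd; apply: rder_val.
exact: (derD (pdiffP dv ud) (pdiffP dv wd)).
Qed.

Lemma rderM (v : C) (u w : C -> R) z : dir v -> pdiff u z -> pdiff w z ->
  rder v (fun y => u y * w y) z = rder v u z * w z + u z * rder v w z.
Proof.
move=> dv ud wd; apply: rder_val.
apply: is_derive_eq; first exact: (derM (pdiffP dv ud) (pdiffP dv wd)).
by rewrite !rline0.
Qed.

Lemma CkD n (U : set C) (u w : C -> R) : copen U -> Ck n U u -> Ck n U w -> Ck n U (fun z => u z + w z).
Proof.
move=> Uo; elim: n u w => [|n IH] u w uC wC; apply/CkE; split=> //.
- by move=> z Uz; exact: rcontD (Ck_cont uC Uz) (Ck_cont wC Uz).
- by move=> z Uz; exact: rcontD (Ck_cont uC Uz) (Ck_cont wC Uz).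
have [u1 ui] := Ck_rder uC; have [w1 wi] := Ck_rder wC; split.
- by move=> z Uz; exact: pdiffD (Ck_pdiff uC Uz) (Ck_pdiff wC Uz).
- apply: (Ck_eq Uo) (IH _ _ u1 w1) => z Uz.
  by rewrite (rderD Dir1 (Ck_pdiff uC Uz) (Ck_pdiff wC Uz)).
- apply: (Ck_eq Uo) (IH _ _ ui wi) => z Uz.
  by rewrite (rderD Diri (Ck_pdiff uC Uz) (Ck_pdiff wC Uz)).
Qed.

Lemma CkM n (U : set C) (u w : C -> R) : copen U -> Ck n U u -> Ck n U w -> Ck n U (fun z => u z * w z).
Proof.
move=> Uo; elim: n u w => [|n IH] u w uC wC; apply/CkE; split=> //.
- by move=> z Uz; exact: rcontM (Ck_cont uC Uz) (Ck_cont wC Uz).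
- by move=> z Uz; exact: rcontM (Ck_cont uC Uz) (Ck_cont wC Uz).
have [u1 ui] := Ck_rder uC; have [w1 wi] := Ck_rder wC.
have u0 := Ck_le uC; have w0 := Ck_le wC; split.
- by move=> z Uz; exact: pdiffM (Ck_pdiff uC Uz) (Ck_pdiff wC Uz).
- apply: (Ck_eq Uo) (CkD Uo (IH _ _ u1 w0) (IH _ _ u0 w1)) => z Uz.
  by rewrite (rderM Dir1 (Ck_pdiff uC Uz) (Ck_pdiff wC Uz)).
- apply: (Ck_eq Uo) (CkD Uo (IH _ _ ui w0) (IH _ _ u0 wi)) => z Uz.
  by rewrite (rderM Diri (Ck_pdiff uC Uz) (Ck_pdiff wC Uz)).
Qed.

Lemma CkN n (U : set C) (u : C -> R) : copen U -> Ck n U u -> Ck n U (fun z => - u z).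
Proof.
move=> Uo uC; apply: (Ck_eq Uo) (CkM Uo (Ck_cst n (-1) Uo) uC) => z _.
by rewrite mulN1r.
Qed.

Lemma rder_comp (v : C) (b : R -> R) l (u : C -> R) z : dir v -> pdiff u z -> is_derive (u z) 1 b l ->
  is_derive (0 : R) 1 (rline (fun y => b (u y)) z v) (l * rder v u z).
Proof.
move=> dv ud bl; have H := pdiffP dv ud; rewrite -(rline0 v u z) in bl.
exact: (is_derive1_comp bl H).
Qed.

Lemma CkV n (U : set C) (u : C -> R) : copen U -> (forall z, U z -> u z != 0) -> Ck n U u -> Ck n U (fun z => (u z)^-1).
Proof.
move=> Uo u0; have dV z : U z -> is_derive (u z) 1 (fun x : R => x^-1) (- (u z ^- 2)).
  move=> Uz; have H := @is_deriveV R id (u z) 1 1 (u0 z Uz) (is_derive_id (u z) 1).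
  by apply: is_derive_eq H _; rewrite /GRing.scale /= mulr1.
have cV z : U z -> rcont u z -> rcont (fun y => (u y)^-1) z.
  move=> Uz uc; apply: (@rcont_comp R (fun x : R => x^-1) u z uc).
  exact: (inv_continuous (u0 z Uz)).
elim: n u u0 dV cV => [|n IH] u u0 dV cV uC; apply/CkE; split=> //.
- by move=> z Uz; exact: cV (Ck_cont uC Uz).
- by move=> z Uz; exact: cV (Ck_cont uC Uz).
have [u1 ui] := Ck_rder uC; have uV := IH u u0 dV cV (Ck_le uC).
have key v : dir v -> Ck n U (rder v u) -> Ck n U (rder v (fun z => (u z)^-1)).
  move=> dv uv; apply: (Ck_eq Uo) (CkN Uo (CkM Uo (CkM Uo uV uV) uv)) => z Uz.
  rewrite (rder_val (rder_comp dv (Ck_pdiff uC Uz) (dV z Uz))).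
  by rewrite mulNr -invfM -expr2.
split; [|exact: key Dir1 u1|exact: key Diri ui].
move=> z Uz; apply: pdiff_intro => v dv; exists (- u z ^- 2 * rder v u z).
exact: rder_comp (Ck_pdiff uC Uz) (dV z Uz).
Qed.

Lemma rder_ln (v : C) (u : C -> R) z : dir v -> 0 < u z -> pdiff u z ->
  is_derive (0 : R) 1 (rline (fun y => ln (u y)) z v) (rder v u z / u z).
Proof.
by move=> dv u0 ud; rewrite mulrC; exact: rder_comp dv ud (is_derive1_ln u0).
Qed.

Lemma Ck_ln n (U : set C) (u : C -> R) : copen U -> (forall z, U z -> 0 < u z) -> Ck n.+1 U u -> Ck n.+1 U (fun z => ln (u z)).
Proof.
move=> Uo u0 uC; have [u1 ui] := Ck_rder uC.
have uV : Ck n U (fun z => (u z)^-1).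
  by apply: (CkV Uo) (Ck_le uC) => z /u0; rewrite lt0r => /andP[].
apply/CkE; split.
  by move=> z Uz; apply: rcont_comp (Ck_cont uC Uz) _; exact: continuous_ln (u0 z Uz).
split.
- move=> z Uz; apply: pdiff_intro => v dv; exists (rder v u z / u z).
  exact: rder_ln (u0 z Uz) (Ck_pdiff uC Uz).
- apply: (Ck_eq Uo) (CkM Uo u1 uV) => z Uz.
  by rewrite (rder_val (rder_ln Dir1 (u0 z Uz) (Ck_pdiff uC Uz))).
- apply: (Ck_eq Uo) (CkM Uo ui uV) => z Uz.
  by rewrite (rder_val (rder_ln Diri (u0 z Uz) (Ck_pdiff uC Uz))).
Qed.

End CkCalculus.

(** * Wirtinger derivatives of determinants *)

Section SmoothCalculus.
Variable R : realType.
Local Notation C := R[i].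
Local Notation Co := (R[i]^o).

Definition cpdiff (f : C -> C) z :=
  pdiff (fun w => complex.Re (f w)) z /\ pdiff (fun w => complex.Im (f w)) z.

Lemma cpdiff_cst (c z : C) : cpdiff (fun=> c) z.
Proof. by split; exact: pdiff_cst. Qed.

Lemma ReM_fun (f g : C -> C) : (fun w => complex.Re (f w * g w)) =
  (fun w => complex.Re (f w) * complex.Re (g w) + -1 * (complex.Im (f w) * complex.Im (g w))).
Proof. by apply/funext => w; rewrite ReM mulN1r. Qed.

Lemma ImM_fun (f g : C -> C) : (fun w => complex.Im (f w * g w)) =
  (fun w => complex.Re (f w) * complex.Im (g w) + complex.Im (f w) * complex.Re (g w)).
Proof. by apply/funext => w; rewrite ImM. Qed.

Lemma ReD_fun (f g : C -> C) : (fun w => complex.Re (f w + g w)) =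
  (fun w => complex.Re (f w) + complex.Re (g w)).
Proof. by apply/funext => w; rewrite ReD. Qed.

Lemma ImD_fun (f g : C -> C) : (fun w => complex.Im (f w + g w)) =
  (fun w => complex.Im (f w) + complex.Im (g w)).
Proof. by apply/funext => w; rewrite ImD. Qed.

Lemma cpdiffD (f g : C -> C) z : cpdiff f z -> cpdiff g z -> cpdiff (fun w => f w + g w) z.
Proof.
by move=> [f1 f2] [g1 g2]; split; rewrite (ReD_fun, ImD_fun); exact: pdiffD.
Qed.

Lemma cpdiffM (f g : C -> C) z : cpdiff f z -> cpdiff g z -> cpdiff (fun w => f w * g w) z.
Proof.
move=> [f1 f2] [g1 g2]; split.
  rewrite ReM_fun; apply: pdiffD (pdiffM f1 g1) _.
  exact: pdiffM (pdiff_cst _ _) (pdiffM f2 g2).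
by rewrite ImM_fun; exact: pdiffD (pdiffM f1 g2) (pdiffM f2 g1).
Qed.

Lemma cder_cst (v c z : C) : cder v (fun=> c) z = 0.
Proof. by rewrite /cder !rder_cst. Qed.

Lemma cderD (v : C) (f g : C -> C) z : dir v -> cpdiff f z -> cpdiff g z ->
  cder v (fun w => f w + g w) z = cder v f z + cder v g z.
Proof.
move=> dv [f1 f2] [g1 g2]; rewrite /cder ReD_fun ImD_fun.
by rewrite (rderD dv f1 g1) (rderD dv f2 g2); apply: eqC.
Qed.

Lemma cderM (v : C) (f g : C -> C) z : dir v -> cpdiff f z -> cpdiff g z ->
  cder v (fun w => f w * g w) z = cder v f z * g z + f z * cder v g z.
Proof.
move=> dv [f1 f2] [g1 g2]; rewrite /cder ReM_fun ImM_fun.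
rewrite (rderD dv (pdiffM f1 g1) (pdiffM (pdiff_cst _ _) (pdiffM f2 g2))).
rewrite (rderD dv (pdiffM f1 g2) (pdiffM f2 g1)).
rewrite (rderM dv (pdiff_cst _ _) (pdiffM f2 g2)) (rderM dv f1 g1) (rderM dv f2 g2).
rewrite (rderM dv f1 g2) (rderM dv f2 g1) rder_cst.
by apply: eqC; rewrite (ReD, ImD) !(ReM, ImM) /=; ring.
Qed.

(* [wirt 'i] is d/d(zbar) and [wirt (- 'i)] is d/dz. *)
Definition wirt (s : C) (f : C -> C) (z : C) : C := (cder 1 f z + s * cder 'i%C f z) / 2%:R.

Lemma dzE (f : C -> C) z : dz f z = wirt (- 'i%C) f z.
Proof. by rewrite /dz /wirt mulNr. Qed.

Lemma wirt_cst (s c z : C) : wirt s (fun=> c) z = 0.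
Proof. by rewrite /wirt !cder_cst mulr0 addr0 mul0r. Qed.

Lemma wirtD s (f g : C -> C) z : cpdiff f z -> cpdiff g z ->
  wirt s (fun w => f w + g w) z = wirt s f z + wirt s g z.
Proof.
move=> fd gd; rewrite /wirt (cderD (@Dir1 R) fd gd) (cderD (@Diri R) fd gd).
by rewrite mulrDr addrACA mulrDl.
Qed.

Lemma wirtM s (f g : C -> C) z : cpdiff f z -> cpdiff g z ->
  wirt s (fun w => f w * g w) z = wirt s f z * g z + f z * wirt s g z.
Proof.
move=> fd gd; rewrite /wirt (cderM (@Dir1 R) fd gd) (cderM (@Diri R) fd gd).
move: (cder _ _ _) (cder _ _ _) (cder _ _ _) (cder _ _ _) => a b c d.
by clear; ring.
Qed.

Lemma wirt_near s (f g : C -> C) z : (\forall w \near (z : Co), f w = g w) ->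
  wirt s f z = wirt s g z.
Proof.
move=> fg.
have e1 : \forall w \near (z : Co), complex.Re (f w) = complex.Re (g w) by apply: filterS fg => w ->.
have e2 : \forall w \near (z : Co), complex.Im (f w) = complex.Im (g w) by apply: filterS fg => w ->.
by rewrite /wirt /cder !(rder_near _ e1) !(rder_near _ e2).
Qed.

Lemma cpdiff_prod n (F : 'I_n -> C -> C) z : (forall i, cpdiff (F i) z) ->
  cpdiff (fun w => \prod_(i < n) F i w) z.
Proof.
elim: n F => [|n IH] F Fd.
  have -> : (fun w => \prod_(i < 0) F i w) = fun=> 1 by apply/funext => w; rewrite big_ord0.
  exact: cpdiff_cst.
have -> : (fun w => \prod_(i < n.+1) F i w) =
    fun w => F ord0 w * \prod_(i < n) F (lift ord0 i) w.
  by apply/funext => w; rewrite big_ord_recl.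
apply: cpdiffM (Fd _) _; exact: IH.
Qed.

Lemma cpdiff_sum (I : Type) (r : seq I) (F : I -> C -> C) z : (forall i, cpdiff (F i) z) ->
  cpdiff (fun w => \sum_(i <- r) F i w) z.
Proof.
move=> Fd; elim: r => [|i r IH].
  have -> : (fun w => \sum_(i <- [::]) F i w) = fun=> 0 by apply/funext => w; rewrite big_nil.
  exact: cpdiff_cst.
have -> : (fun w => \sum_(j <- i :: r) F j w) = fun w => F i w + \sum_(j <- r) F j w.
  by apply/funext => w; rewrite big_cons.
exact: cpdiffD (Fd i) IH.
Qed.

Lemma wirt_sum s (I : Type) (r : seq I) (F : I -> C -> C) z : (forall i, cpdiff (F i) z) ->
  wirt s (fun w => \sum_(i <- r) F i w) z = \sum_(i <- r) wirt s (F i) z.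
Proof.
move=> Fd; elim: r => [|i r IH].
  have -> : (fun w => \sum_(i <- [::]) F i w) = fun=> 0 by apply/funext => w; rewrite big_nil.
  by rewrite wirt_cst big_nil.
have -> : (fun w => \sum_(j <- i :: r) F j w) = fun w => F i w + \sum_(j <- r) F j w.
  by apply/funext => w; rewrite big_cons.
by rewrite wirtD ?IH ?big_cons//; exact: cpdiff_sum.
Qed.

Lemma wirt_prod s n (F : 'I_n -> C -> C) z : (forall i, cpdiff (F i) z) ->
  wirt s (fun w => \prod_(i < n) F i w) z =
  \sum_(k < n) \prod_(i < n) (if i == k then wirt s (F i) z else F i z).
Proof.
elim: n F => [|n IH] F Fd.
  have -> : (fun w => \prod_(i < 0) F i w) = fun=> 1 by apply/funext => w; rewrite big_ord0.
  by rewrite wirt_cst big_ord0.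
have -> : (fun w => \prod_(i < n.+1) F i w) =
    fun w => F ord0 w * \prod_(i < n) F (lift ord0 i) w.
  by apply/funext => w; rewrite big_ord_recl.
have dP : cpdiff (fun w => \prod_(i < n) F (lift ord0 i) w) z by exact: cpdiff_prod.
rewrite (wirtM s (Fd ord0) dP) (IH _ (fun i => Fd (lift ord0 i))) big_ord_recl; congr (_ + _).
  by rewrite big_ord_recl eqxx.
rewrite mulr_sumr; apply: eq_bigr => k _; rewrite [RHS]big_ord_recl; congr (_ * _).
Qed.

(** The Leibniz rule yields one determinant per differentiated row; expanding along that row
    produces the cofactors, which do not involve it. *)
Lemma wirt_det s n (H : C -> 'M[C]_n) z : (forall i j, cpdiff (fun w => H w i j) z) ->
  wirt s (fun w => \det (H w)) z = \tr ((\matrix_(i, j) wirt s (fun w => H w i j) z) *m \adj (H z)).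
Proof.
move=> Hd; pose M k := \matrix_(i, j) (if i == k then wirt s (fun w => H w i j) z else H z i j).
transitivity (\sum_k \det (M k)).
  rewrite wirt_sum; last first.
    move=> t; apply: cpdiffM (cpdiff_cst _ _) _; apply: cpdiff_prod => i; exact: Hd.
  rewrite exchange_big /=; apply: eq_bigr => t _.
  rewrite wirtM; [|exact: cpdiff_cst|by apply: cpdiff_prod => i; exact: Hd].
  rewrite wirt_cst mul0r add0r wirt_prod; last by move=> i; exact: Hd.
  rewrite mulr_sumr; apply: eq_bigr => k _; congr (_ * _); apply: eq_bigr => i _.
  by rewrite mxE.
rewrite /mxtrace; apply: eq_bigr => k _.
rewrite (expand_det_row _ k) mxE; apply: eq_bigr => j _.
rewrite !mxE eqxx; congr (_ * _); rewrite /cofactor; congr (_ * \det _).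
by apply/matrixP => a b; rewrite !mxE eq_sym (negbTE (neq_lift _ _)).
Qed.

Lemma smooth_cpdiff (U : set C) (f : C -> C) z : smooth U f -> U z -> cpdiff f z.
Proof. by move=> /(_ 1)[f1 f2] Uz; split; [exact: Ck_pdiff f1 Uz|exact: Ck_pdiff f2 Uz]. Qed.

Lemma smooth_eq (U : set C) (f g : C -> C) : copen U -> (forall z, U z -> f z = g z) ->
  smooth U f -> smooth U g.
Proof.
by move=> Uo fg fs n; have [f1 f2] := fs n; split; [apply: Ck_eq f1|apply: Ck_eq f2] => // z /fg ->.
Qed.

Lemma smooth_cst (U : set C) (c : C) : copen U -> smooth U (fun=> c).
Proof. by move=> Uo n; split; exact: Ck_cst. Qed.

Lemma smoothD (U : set C) (f g : C -> C) : copen U -> smooth U f -> smooth U g ->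
  smooth U (fun z => f z + g z).
Proof.
move=> Uo fs gs n; have [f1 f2] := fs n; have [g1 g2] := gs n.
by split; rewrite (ReD_fun, ImD_fun); exact: CkD.
Qed.

Lemma smoothM (U : set C) (f g : C -> C) : copen U -> smooth U f -> smooth U g ->
  smooth U (fun z => f z * g z).
Proof.
move=> Uo fs gs n; have [f1 f2] := fs n; have [g1 g2] := gs n; split.
  rewrite ReM_fun; apply: CkD (CkM Uo f1 g1) _ => //.
  exact: CkM (Ck_cst _ _ Uo) (CkM Uo f2 g2).
by rewrite ImM_fun; exact: CkD (CkM Uo f1 g2) (CkM Uo f2 g1).
Qed.

Lemma smooth_sum (U : set C) (I : Type) (r : seq I) (F : I -> C -> C) : copen U ->
  (forall i, smooth U (F i)) -> smooth U (fun z => \sum_(i <- r) F i z).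
Proof.
move=> Uo Fs; elim: r => [|i r IH].
  by apply: (smooth_eq Uo) (smooth_cst 0 Uo) => z _; rewrite big_nil.
by apply: (smooth_eq Uo) (smoothD Uo (Fs i) IH) => z _; rewrite big_cons.
Qed.

Lemma smooth_prod (U : set C) (I : Type) (r : seq I) (F : I -> C -> C) : copen U ->
  (forall i, smooth U (F i)) -> smooth U (fun z => \prod_(i <- r) F i z).
Proof.
move=> Uo Fs; elim: r => [|i r IH].
  by apply: (smooth_eq Uo) (smooth_cst 1 Uo) => z _; rewrite big_nil.
by apply: (smooth_eq Uo) (smoothM Uo (Fs i) IH) => z _; rewrite big_cons.
Qed.

Lemma smooth_det (U : set C) n (H : C -> 'M[C]_n) : copen U ->
  (forall i j, smooth U (fun z => H z i j)) -> smooth U (fun z => \det (H z)).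
Proof.
move=> Uo Hs; apply: smooth_sum => // t; apply: (smoothM Uo (smooth_cst _ Uo)).
by apply: smooth_prod => // i; exact: Hs.
Qed.

Lemma smoothV (U : set C) (f : C -> C) : copen U -> (forall z, U z -> f z != 0) ->
  smooth U f -> smooth U (fun z => (f z)^-1).
Proof.
move=> Uo f0 fs n; have [f1 f2] := fs n.
pose d z := complex.Re (f z) * complex.Re (f z) + complex.Im (f z) * complex.Im (f z).
have dC : Ck n U d by exact: CkD (CkM Uo f1 f1) (CkM Uo f2 f2).
have dV : Ck n U (fun z => (d z)^-1).
  apply: CkV => // z Uz; rewrite /d -!expr2 -sqr_cabs expf_neq0// cabs_eq0; exact: f0.
split; [apply: (Ck_eq Uo) (CkM Uo f1 dV)|apply: (Ck_eq Uo) (CkN Uo (CkM Uo f2 dV))] => z Uz.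
  by rewrite /d -!expr2; case: (f z).
by rewrite /d -!expr2; case: (f z).
Qed.

Lemma smooth_cder (U : set C) v (f : C -> C) : dir v -> smooth U f -> smooth U (cder v f).
Proof.
move=> dv fs n; have [/Ck_rder[f11 f1i] /Ck_rder[f21 f2i]] := fs n.+1.
by case: dv.
Qed.

Lemma smooth_wirt (U : set C) s (f : C -> C) : copen U -> smooth U f -> smooth U (wirt s f).
Proof.
move=> Uo fs; apply: (smoothM Uo _ (smooth_cst _ Uo)).
apply: (smoothD Uo (smooth_cder (@Dir1 R) fs)).
exact: (smoothM Uo (smooth_cst _ Uo) (smooth_cder (@Diri R) fs)).
Qed.

(** Since H^-1 = adj H / det H, Jacobi's formula identifies the trace of the connection matrix near
    [z]; smoothness of its entries lets the trace pass through d/d(zbar). *)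
Lemma curvature_trace (U : set C) n (H : C -> 'M[C]_n) z : copen U -> U z ->
  (forall i j, smooth U (fun w => H w i j)) -> (forall w, U w -> \det (H w) != 0) ->
  \tr (dzbar_mx (fun w => dz_mx H w *m invmx (H w)) z) =
  dzbar (fun w => dz (fun y => \det (H y)) w / \det (H w)) z.
Proof.
move=> Uo Uz Hs H0.
have detS := smooth_det Uo Hs.
have detV : smooth U (fun w => (\det (H w))^-1) by exact: smoothV.
have invE w : U w -> invmx (H w) = (\det (H w))^-1 *: \adj (H w).
  by move=> Uw; rewrite /invmx unitmxE unitfE H0.
have adjS i j : smooth U (fun w => (\adj (H w)) i j).
  have := @smooth_det U _ (fun w => row' j (col' i (H w))) Uo _.
  move=> h; apply: (smooth_eq Uo) (smoothM Uo (smooth_cst ((-1) ^+ (j + i)) Uo) (h _)).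
    by move=> w _; rewrite mxE.
  by move=> a b; apply: (smooth_eq Uo) (Hs (lift j a) (lift i b)) => w _; rewrite !mxE.
have invS i j : smooth U (fun w => invmx (H w) i j).
  by apply: (smooth_eq Uo) (smoothM Uo detV (adjS i j)) => w Uw; rewrite (invE w Uw) [RHS]mxE.
have eS i j : smooth U (fun w => (dz_mx H w *m invmx (H w)) i j).
  have := @smooth_sum U _ (index_enum 'I_n) (fun k w => dz (fun y => H y i k) w * invmx (H w) k j) Uo.
  move=> h; apply: (smooth_eq Uo) (h _).
    by move=> w _; rewrite mxE; apply: eq_bigr => k _; rewrite mxE.
  move=> k; apply: (smoothM Uo _ (invS k j)).
  by apply: (smooth_eq Uo) (smooth_wirt (- 'i%C) Uo (Hs i k)) => w _; rewrite dzE.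
transitivity (wirt 'i%C (fun w => \sum_i (dz_mx H w *m invmx (H w)) i i) z).
  rewrite wirt_sum; last by move=> i; exact: smooth_cpdiff (eS i i) Uz.
  by apply: eq_bigr => i _; rewrite mxE.
apply: wirt_near; apply: filterS (copenP Uo Uz) => w Uw.
rewrite dzE wirt_det; last by move=> i j; exact: smooth_cpdiff (Hs i j) Uw.
rewrite -[LHS]/(\tr _) (invE w Uw) -scalemxAr linearZ /= mulrC; congr (\tr (_ *m _) * _).
by apply/matrixP => i j; rewrite !mxE dzE.
Qed.

End SmoothCalculus.

(** * Second-order expansions of C^2 functions of two variables *)

Section TaylorC2.
Variable R : realType.
Local Notation C := R[i].
Local Notation Co := (R[i]^o).

Lemma rline_derive (v : C) (u : C -> R) z (t : R) : dir v -> pdiff u (z + t%:C * v) ->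
  is_derive t 1 (rline u z v) (rder v u (z + t%:C * v)).
Proof.
move=> dv ud; have H := pdiffP dv ud; rewrite -(addNr t) in H.
have := der_shift H; have -> : (fun s => rline u (z + t%:C * v) v (- t + s)) = rline u z v => //.
apply/funext => s; rewrite /rline -addrA -mulrDl; congr (u (z + _ * v)).
by apply: eqC => /=; ring.
Qed.

Let pt (z0 : C) (x y : R) : C := z0 + x%:C * 1 + y%:C * 'i%C.

Lemma pt_near (P : set C) z0 : (\forall w \near (z0 : Co), P w) ->
  exists2 d : R, 0 < d & forall x y, `|x| < d -> `|y| < d -> P (pt z0 x y).
Proof.
move=> /nbhsC[d d0 dP]; exists (d / 2); first by rewrite divr_gt0.
move=> x y xd yd; apply: dP; apply: le_lt_trans (cabs_le _) _.
rewrite /pt; case: (z0) => a b /=.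
rewrite [d]splitr; apply: le_lt_trans (lerD _ _) (ltrD xd yd).
  by rewrite le_eqVlt; apply/orP; left; apply/eqP; congr (`| _ |); ring.
by rewrite le_eqVlt; apply/orP; left; apply/eqP; congr (`| _ |); ring.
Qed.

(** The horizontal increment uses the derivative at [z0], the vertical one the mean value theorem
    and the continuity of the derivative along i. *)
Lemma C1_expand (U : set C) (h : C -> R) z0 (e : R) : copen U -> Ck 1 U h -> U z0 -> 0 < e ->
  exists2 d : R, 0 < d & forall x y, `|x| < d -> `|y| < d ->
  `|h (pt z0 x y) - h z0 - rder 1 h z0 * x - rder 'i%C h z0 * y| <= e * (`|x| + `|y|).
Proof.
move=> Uo hC Uz e0; have hp z : U z -> pdiff h z by move=> Uz'; exact: Ck_pdiff hC Uz'.
have [_ hi] := Ck_rder hC.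
have [d1 d10 d1P] := is_derive_eps (pdiffP (@Dir1 R) (hp _ Uz)) e0.
have near_e : \forall w \near (z0 : Co), U w /\ `|rder 'i%C h w - rder 'i%C h z0| < e.
  apply: filterI (copenP Uo Uz) _; apply/nbhsC.
  exact: (proj1 (rcontP _ _) (Ck_cont hi Uz) e e0).
have [d2 d20 d2P] := pt_near near_e.
exists (Num.min d1 d2) => [|x y]; first by rewrite lt_min d10.
rewrite !lt_min => /andP[x1 x2] /andP[y1 y2].
have hx := d1P x x1; rewrite add0r rline0 in hx.
pose f t := rline h (z0 + x%:C * 1) 'i%C t - rder 'i%C h z0 * t.
have := @mvt_le R f (fun t => rder 'i%C h (pt z0 x t) - rder 'i%C h z0 * 1) y e.
have fd (t : R) : `|t| <= `|y| -> is_derive t 1 f (rder 'i%C h (pt z0 x t) - rder 'i%C h z0 * 1).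
  move=> ty; apply: derB (derZ _ (is_derive_id t 1)).
  apply: rline_derive; first exact: Diri.
  by apply: hp; have [] := d2P x t x2 (le_lt_trans ty y2).
have fb (t : R) : `|t| <= `|y| -> `|rder 'i%C h (pt z0 x t) - rder 'i%C h z0 * 1| <= e.
  by move=> ty; rewrite mulr1 ltW//; have [] := d2P x t x2 (le_lt_trans ty y2).
move=> /(_ fd fb); rewrite /f rline0 mulr0 subr0 => H.
have -> : h (pt z0 x y) - h z0 - rder 1 h z0 * x - rder 'i%C h z0 * y =
  (rline h z0 1 x - h z0 - rder 1 h z0 * x) +
  (rline h (z0 + x%:C * 1) 'i%C y - rder 'i%C h z0 * y - h (z0 + x%:C * 1)).
  by rewrite /rline /pt; ring.
apply: le_trans (ler_normD _ _) _; rewrite mulrDr; apply: lerD => //.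
Qed.

(* The increment is followed along a horizontal and then a vertical segment, so only
   [rder 1 (rder 'i g)] occurs and no symmetry of second derivatives is needed. *)
Lemma taylor2_C2 (U : set C) (g : C -> R) z0 : copen U -> Ck 2 U g -> U z0 ->
  exists a b, taylor2 g z0 a b
    ((rder 1 (rder 1 g) z0 + rder 'i%C (rder 'i%C g) z0) / 4).
Proof.
move=> Uo gC Uz; have gp z : U z -> pdiff g z by move=> Uz'; exact: Ck_pdiff gC Uz'.
have [g1C giC] := Ck_rder gC.
set gxx := rder 1 (rder 1 g) z0; set gyy := rder _ (rder 'i%C g) z0.
set gx := rder 1 g z0; set gy := rder 'i%C g z0; set gyx := rder 1 (rder 'i%C g) z0.
exists (gx +i* - gy), (((gxx - gyy) / 4) +i* - (gyx / 2)); split=> e e0.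
have nU := copenP Uo Uz.
have nx : \forall s \near (0 : R), is_derive (s : R) 1 (rline g z0 1) (rder 1 g (z0 + s%:C * 1)).
  by apply: filterS (near_line 1 nU) => s Us; exact: rline_derive (@Dir1 R) (gp _ Us).
have dxx : is_derive (0 : R) 1 (fun s : R => rder 1 g (z0 + s%:C * 1)) gxx.
  exact: pdiffP (@Dir1 R) (Ck_pdiff g1C Uz).
have e4 : 0 < e / 4 by rewrite divr_gt0.
have [d1 d10 d1P] := taylor2_line nx dxx e4.
have [d2 d20 d2P] := C1_expand Uo giC Uz e4.
have [d3 d30 d3P] := pt_near nU.
apply/nbhsC; exists (Num.min (Num.min d1 d2) d3); first by rewrite !lt_min d10 d20.
move=> z zz0.
pose x := complex.Re (z - z0); pose y := complex.Im (z - z0).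
have zE : z = pt z0 x y.
  by rewrite /pt /x /y; case: (z) (z0) => [a b] [c d]; apply: eqC => /=; ring.
have : `|x| < Num.min (Num.min d1 d2) d3 by apply: le_lt_trans (normRe_le _) zz0.
have : `|y| < Num.min (Num.min d1 d2) d3 by apply: le_lt_trans (normIm_le _) zz0.
rewrite !lt_min => /andP[/andP[y1 y2] y3] /andP[/andP[x1 x2] x3].
have hx := d1P x x1; rewrite !add0r rline0 mul0r addr0 -/gx in hx.
pose f (t : R) : R := rline g (z0 + x%:C * 1) 'i%C t - (gy + gyx * x) * t - gyy / 2 * (t * t).
pose df (t : R) : R := rder 'i%C g (pt z0 x t) - (gy + gyx * x) * 1 - gyy / 2 * (1 * t + t * 1).
have fd (t : R) : `|t| <= `|y| -> is_derive t 1 f (df t).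
  move=> ty; apply: derB; last first.
    exact: derZ (derM (is_derive_id t 1) (is_derive_id t 1)).
  apply: derB (derZ _ (is_derive_id t 1)).
  apply: rline_derive; first exact: Diri.
  by apply: gp; exact: d3P x3 (le_lt_trans ty y3).
have fb (t : R) : `|t| <= `|y| -> `|df t| <= e / 4 * (`|x| + `|y|).
  move=> ty; have := d2P x t x2 (le_lt_trans ty y2).
  have -> : df t = rder 'i%C g (pt z0 x t) - rder 'i%C g z0 - rder 1 (rder 'i%C g) z0 * x -
      rder 'i%C (rder 'i%C g) z0 * t by rewrite /df -/gy -/gyx -/gyy; field.
  by move=> h; apply: le_trans h _; rewrite ler_pM2l// lerD2l.
have := mvt_le fd fb; rewrite /f rline0 !mulr0 !subr0 => H.
have rE : cabs (z - z0) ^+ 2 = x ^+ 2 + y ^+ 2 by rewrite sqr_cabs.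
have -> : g z - g z0 - complex.Re ((gx +i* - gy) * (z - z0) +
      ((gxx - gyy) / 4 +i* - (gyx / 2)) * (z - z0) ^+ 2) -
    (gxx + gyy) / 4 * cabs (z - z0) ^+ 2 =
  (rline g z0 1 x - g z0 - gx * x - gxx / 2 * x ^+ 2) +
  (rline g (z0 + x%:C * 1) 'i%C y - (gy + gyx * x) * y - gyy / 2 * (y * y) - g (z0 + x%:C * 1)).
  rewrite rE expr2 !(ReD, ReM, ImM) -/x -/y /rline -/(pt z0 x y) -zE /=.
  by move: (g z) (g z0) (g _) => q1 q2 q3; field.
apply: le_trans (ler_normD _ _) _; rewrite rE.
apply: le_trans (lerD hx H) _.
have nx2 : `|x| ^+ 2 = x ^+ 2 by rewrite real_normK ?num_real.
have ny2 : `|y| ^+ 2 = y ^+ 2 by rewrite real_normK ?num_real.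
have : 0 <= e * (`|x| - `|y|) ^+ 2 by rewrite mulr_ge0 ?sqr_ge0// ltW.
have : 0 <= e * (`|x| ^+ 2 + `|y| ^+ 2) by rewrite mulr_ge0 ?addr_ge0 ?sqr_ge0// ltW.
rewrite -nx2 -ny2; move: (`|x|) (`|y|) => X Y; clear.
by rewrite !expr2; nra.
Qed.

Lemma half_C : 2%:R^-1 = (2^-1)%:C :> C.
Proof.
have h : 2%:R != 0 :> C by rewrite pnatr_eq0.
by apply: (mulfI h); rewrite divff//; apply: eqC => /=; field.
Qed.

(** Because f is real and positive, dz f / f is the derivative of ln f. Applying d/d(zbar) gives a
    quarter of the Laplacian as real part, and a difference of mixed partials as imaginary part;
    taking the real part avoids comparing these. *)
Lemma dzbar_dz_ln (U : set C) (f : C -> C) z0 : copen U -> U z0 -> smooth U f ->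
  (forall z, U z -> 0 < complex.Re (f z)) -> (forall z, U z -> complex.Im (f z) = 0) ->
  exists a b, taylor2 (fun z => ln (complex.Re (f z))) z0 a b
    (complex.Re (dzbar (fun w => dz f w / f w) z0)).
Proof.
move=> Uo Uz fs f0 fi; pose D z := complex.Re (f z).
have DC n : Ck n U D by have [] := fs n.
pose g z := ln (D z); have gC : Ck 2 U g by exact: (Ck_ln Uo f0 (DC 2)).
have [a [b T]] := taylor2_C2 Uo gC Uz; exists a, b.
have Dd z : U z -> pdiff D z by exact: Ck_pdiff (DC 1).
have gv v z : dir v -> U z -> rder v g z = rder v D z / D z.
  by move=> dv Uz'; have H := @rder_ln R v D z dv (f0 z Uz') (Dd z Uz'); rewrite (rder_val H).
have fr z : U z -> rder 1 (fun w => complex.Im (f w)) z = 0 /\ rder 'i%C (fun w => complex.Im (f w)) z = 0.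
  move=> Uz'; have n0 : \forall w \near (z : Co), complex.Im (f w) = 0.
    by apply: filterS (copenP Uo Uz') => w /fi.
  by rewrite !(rder_near _ n0) !rder_cst.
have E z : U z -> dz f z / f z = (rder 1 g z / 2) +i* - (rder 'i%C g z / 2).
  move=> Uz'; rewrite (gv _ _ (@Dir1 R) Uz') (gv _ _ (@Diri R) Uz') /dz /cder.
  have [-> ->] := fr z Uz'; have := fi z Uz'; have := f0 z Uz'.
  rewrite /D; move: (rder _ _ _) (rder _ _ _) => dx dy; case: (f z) => p q /= p0 ->.
  have pn0 : p%:C != 0 :> C by rewrite -cabs_gt0 cabs_real normr_gt0 gt_eqF.
  rewrite half_C; apply: (mulIf pn0); rewrite divfK//.
  by apply: eqC => /=; field; rewrite gt_eqF.
move: T; congr (taylor2 _ _ _ _ _).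
have n1 : \forall w \near (z0 : Co), complex.Re (dz f w / f w) = 1 / 2 * rder 1 g w.
  by apply: filterS (copenP Uo Uz) => w /E ->; rewrite /= mulrC mul1r.
have n2 : \forall w \near (z0 : Co), complex.Im (dz f w / f w) = - 1 / 2 * rder 'i%C g w.
  by apply: filterS (copenP Uo Uz) => w /E ->; rewrite /=; field.
have [g1C giC] := Ck_rder gC.
rewrite /dzbar /cder !(rder_near _ n1) !(rder_near _ n2).
have rZ v (k : R) u : dir v -> pdiff u z0 -> rder v (fun w => k * u w) z0 = k * rder v u z0.
  by move=> dv ud; rewrite (rderM dv (pdiff_cst _ _) ud) rder_cst mul0r add0r.
rewrite !(rZ _ _ _ (@Dir1 R) (Ck_pdiff g1C Uz)) !(rZ _ _ _ (@Dir1 R) (Ck_pdiff giC Uz)).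
rewrite !(rZ _ _ _ (@Diri R) (Ck_pdiff g1C Uz)) !(rZ _ _ _ (@Diri R) (Ck_pdiff giC Uz)).
rewrite half_C; move: (rder _ _ _) (rder _ _ _) (rder _ _ _) (rder _ _ _) => p q r t.
by rewrite /=; field.
Qed.

End TaylorC2.

(** * Positive definite Hermitian matrices *)

Lemma mulmx_adj (C : numClosedFieldType) m n p (A : 'M[C]_(m, n)) (B : 'M[C]_(n, p)) :
  (A *m B)^t* = B^t* *m A^t*.
Proof. by rewrite trmx_mul map_mxM. Qed.

(** By the spectral theorem G is the unitary change of basis times the square roots of the
    eigenvalues. It carries the form of H to the standard one, where the later inequalities are read
    off entries. *)
Lemma posdef_factor (C : numClosedFieldType) n (H : 'M[C]_n) : H^t* = H ->
  (forall x : 'rV[C]_n, x != 0 -> 0 < (x *m H *m x^t*) 0 0) ->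
  exists2 G : 'M[C]_n, G \in unitmx & H = G *m G^t*.
Proof.
move=> HH Hpos.
have /orthomx_spectralP HE : H \is normalmx by apply/normalmxP; rewrite HH.
have PU : spectralmx H \is unitarymx by exact: spectral_unitarymx.
move: (spectralmx H) (spectral_diag H) HE PU => P d HE PU.
have PP : P *m P^t* = 1%:M by exact/unitarymxP.
rewrite (invmx_unitary PU) in HE.
have d0 k : 0 < d 0 k.
  have rP : row k P != 0.
    apply/eqP => rk; have := congr1 (fun M : 'M[C]_n => M k k) PP.
    rewrite !mxE eqxx big1 => [/esym/eqP|j _]; first by rewrite oner_eq0.
    by have := congr1 (fun M : 'rV[C]_n => M 0 j) rk; rewrite !mxE => ->; rewrite mul0r.
  have := Hpos _ rP; rewrite HE rowE mulmx_adj.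
  set v : 'rV[C]_n := delta_mx 0 k.
  have -> : v *m P *m (P^t* *m diag_mx d *m P) *m (P^t* *m v^t*) = v *m diag_mx d *m v^t*.
    by rewrite !mulmxA -[in LHS](mulmxA _ P (P^t*)) PP mulmx1 -(mulmxA _ P (P^t*)) PP mulmx1.
  have -> : v^t* = delta_mx k 0 :> 'cV[C]_n.
    by rewrite trmx_delta map_delta_mx.
  by rewrite -rowE -colE !mxE eqxx.
pose s : 'rV[C]_n := \row_k sqrtC (d 0 k).
have sd : diag_mx s *m diag_mx s = diag_mx d.
  rewrite mulmx_diag; congr diag_mx; apply/rowP => k; rewrite !mxE.
  by rewrite -expr2 sqrtCK.
have sC : (diag_mx s)^t* = diag_mx s.
  rewrite tr_diag_mx map_diag_mx; congr diag_mx; apply/rowP => k; rewrite !mxE.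
  by apply/CrealP/ger0_real; rewrite sqrtC_ge0 ltW.
exists (P^t* *m diag_mx s).
  rewrite unitmx_mul unitarymx_unit ?trmxC_unitary//= unitmxE det_diag unitfE.
  by apply/prodf_neq0 => k _; rewrite mxE sqrtC_eq0 gt_eqF.
by rewrite mulmx_adj sC trmxCK mulmxA -(mulmxA _ (diag_mx s) (diag_mx s)) sd.
Qed.

Section HermitianForms.
Variable R : realType.
Local Notation C := R[i].
Variable n : nat.
Implicit Types (G H A : 'M[C]_n).

Lemma mul_conj_cabs (z : C) : z * z^* = (cabs z ^+ 2)%:C.
Proof. by rewrite -normCK normC_cabs; apply: eqC; rewrite expr2 /=; ring. Qed.

Lemma Re_sum (I : Type) (r : seq I) (F : I -> C) :
  complex.Re (\sum_(i <- r) F i) = \sum_(i <- r) complex.Re (F i).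
Proof. by elim: r => [|i r IH]; rewrite ?big_nil// !big_cons ReD IH. Qed.

Lemma cabs_sum (I : Type) (r : seq I) (F : I -> C) :
  cabs (\sum_(i <- r) F i) <= \sum_(i <- r) cabs (F i).
Proof.
elim: r => [|i r IH]; first by rewrite !big_nil cabs0.
by rewrite !big_cons (le_trans (cabsD _ _))// lerD2l.
Qed.

(** Conjugation by G turns the adjoint for H into the ordinary adjoint, so [end_norm] is the
    Frobenius norm of G^-1 A G. *)
Lemma mxtrace_adj G H A : H = G *m G^t* -> G \in unitmx ->
  complex.Re (\tr (A *m (H *m A^t* *m invmx H))) =
  \sum_k \sum_l cabs ((invmx G *m A *m G) k l) ^+ 2.
Proof.
move=> HG Gu; set B := invmx G *m A *m G.
have Gu' : G^t* \in unitmx by rewrite map_unitmx unitmx_tr.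
have -> : \tr (A *m (H *m A^t* *m invmx H)) = \tr (B *m B^t*).
  have -> : invmx H = (invmx G)^t* *m invmx G.
    have HI : H *m ((invmx G)^t* *m invmx G) = 1%:M.
      rewrite HG -mulmxA (mulmxA (G^t*)) -mulmx_adj mulVmx// trmx1 map_mx1 mul1mx.
      by rewrite mulmxV.
    have Hu : H \in unitmx by have [] := mulmx1_unit HI.
    by rewrite -[RHS]mul1mx -(mulVmx Hu) -mulmxA HI mulmx1.
  rewrite HG /B !mulmx_adj !mulmxA mxtrace_mulC !mulmxA; congr (\tr _).
rewrite /mxtrace Re_sum; apply: eq_bigr => k _.
rewrite mxE Re_sum; apply: eq_bigr => l _.
by rewrite !mxE mul_conj_cabs.
Qed.

Lemma cabs_trace_le G H A : H = G *m G^t* -> G \in unitmx ->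
  cabs (\tr A) <= n%:R * end_norm H A.
Proof.
move=> HG Gu; rewrite /end_norm (mxtrace_adj A HG Gu).
set B := invmx G *m A *m G; set S := \sum_k _.
have -> : \tr A = \tr B by rewrite /B mxtrace_mulC mulmxA mulmxV// mul1mx.
apply: le_trans (cabs_sum _ _) _.
have -> : n%:R * Num.sqrt S = \sum_(k < n) Num.sqrt S by rewrite sumr_const card_ord mulr_natl.
apply: ler_sum => k _.
have S0 : 0 <= S by apply: sumr_ge0 => a _; apply: sumr_ge0 => b _; exact: sqr_ge0.
rewrite -(ler_pXn2r (n := 2)) ?nnegrE ?cabs_ge0 ?sqrtr_ge0// sqr_sqrtr//.
rewrite /S (bigD1 k)//= (bigD1 k)//= -addrA lerDl addr_ge0//; first by apply: sumr_ge0 => b _; exact: sqr_ge0.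
by apply: sumr_ge0 => a _; apply: sumr_ge0 => b _; exact: sqr_ge0.
Qed.

Lemma det_posdef G H : H = G *m G^t* -> G \in unitmx ->
  0 < complex.Re (\det H) /\ complex.Im (\det H) = 0.
Proof.
move=> -> Gu; rewrite det_mulmx det_map_mx det_tr mul_conj_cabs /=; split=> //.
by rewrite exprn_gt0// cabs_gt0 -unitfE -unitmxE.
Qed.

Lemma form_sum G H (x y : 'rV[C]_n) : H = G *m G^t* ->
  (x *m H *m y^t*) 0 0 = \sum_k (x *m G) 0 k * ((y *m G) 0 k)^*.
Proof.
move=> ->; rewrite mulmxA -mulmxA -mulmx_adj mxE; apply: eq_bigr => k _.
by rewrite !mxE.
Qed.

Lemma form_diag_ge G H (x : 'rV[C]_n) : H = G *m G^t* ->
  forall k, cabs ((x *m G) 0 k) ^+ 2 <= complex.Re ((x *m H *m x^t*) 0 0).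
Proof.
move=> HG k; rewrite (form_sum x x HG) Re_sum (bigD1 k)//= mul_conj_cabs lerDl.
by apply: sumr_ge0 => i _; rewrite mul_conj_cabs sqr_ge0.
Qed.

(** The extra factor n of this Cauchy-Schwarz inequality comes from bounding the sum term by term,
    and is absorbed in growth estimates. *)
Lemma form_cauchy G H (x y : 'rV[C]_n) : H = G *m G^t* ->
  cabs ((x *m H *m y^t*) 0 0) <= n%:R *
    (Num.sqrt (complex.Re ((x *m H *m x^t*) 0 0)) * Num.sqrt (complex.Re ((y *m H *m y^t*) 0 0))).
Proof.
move=> HG; rewrite (form_sum x y HG); apply: le_trans (cabs_sum _ _) _.
set a := Num.sqrt _; set b := Num.sqrt _.
have -> : n%:R * (a * b) = \sum_(k < n) a * b by rewrite sumr_const card_ord mulr_natl.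
have le_sqrt (z : 'rV[C]_n) k : cabs ((z *m G) 0 k) <= Num.sqrt (complex.Re ((z *m H *m z^t*) 0 0)).
  have h := form_diag_ge z HG k.
  rewrite -(ler_pXn2r (n := 2)) ?nnegrE ?cabs_ge0 ?sqrtr_ge0// sqr_sqrtr//.
  exact: le_trans (sqr_ge0 _) h.
apply: ler_sum => k _; rewrite cabsM; apply: ler_pM; rewrite ?cabs_ge0//.
by rewrite (cabsJ ((y *m G) 0 k)).
Qed.

End HermitianForms.

(** * The determinant bundle *)

Section DetBundle.
Variable R : realType.
Local Notation C := R[i].

Lemma cdiff_det n (A : C -> 'M[C]_n) z : (forall i j, cdiff (fun w => A w i j) z) ->
  cdiff (fun w => \det (A w)) z.
Proof.
move=> Ad; apply: cdiff_sum => t _; apply: (cdiffM (cdiff_cst _ z)).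
by apply: cdiff_prod => i _; exact: Ad.
Qed.

Variables (r : nat) (E : bundle R r) (h : metric E).

Lemma metric_factor (i : chart E) z : hermitian_metric h -> dom i z ->
  exists2 G : 'M[C]_r, G \in unitmx & h i z = G *m G^t*.
Proof. by move=> [_ hH hpos _] iz; apply: posdef_factor => [|x]; [exact: hH|exact: hpos]. Qed.

Lemma det_metric_pos (i : chart E) z : hermitian_metric h -> dom i z ->
  0 < complex.Re (\det (h i z)) /\ complex.Im (\det (h i z)) = 0.
Proof. by move=> hh iz; have [G Gu GE] := metric_factor hh iz; exact: det_posdef GE Gu. Qed.

Lemma det_metric_neq0 (i : chart E) z : hermitian_metric h -> dom i z -> \det (h i z) != 0.
Proof.
move=> hh iz; have [p0 _] := det_metric_pos hh iz.
by apply/eqP => d0; move: p0; rewrite d0 ltxx.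
Qed.

Lemma det_metric_real (i : chart E) z : hermitian_metric h -> dom i z ->
  \det (h i z) = (complex.Re (\det (h i z)))%:C.
Proof. by move=> hh iz; have [_ q0] := det_metric_pos hh iz; apply: eqC. Qed.

Lemma det_holomorphic : holomorphic_bundle E -> holomorphic_bundle (det_bundle E).
Proof.
move=> [domo domU tho tid tco]; split=> //.
- move=> i j k l z ijz; apply/cdiffP.
  have dd : cdiff (fun w => \det (@trans _ _ E i j w)) z.
    apply: (@cdiff_det r (@trans _ _ E i j) z) => a b.
    exact: (proj1 (cdiffP _ _) (tho i j a b z ijz)).
  apply: cdiff_near dd; apply: filterE => w.
  by rewrite mxE !ord1 eqxx mulr1n.
- by move=> i z iz; rewrite /= (tid i z iz) det1.
- by move=> i j k z iz jz kz; rewrite /= -scalar_mxM -det_mulmx tco.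
Qed.

Lemma det_hermitian : holomorphic_bundle E -> hermitian_metric h -> hermitian_metric (det_metric h).
Proof.
move=> [domo _ _ _ _] hh; have [hs hH hpos ht] := hh; split.
- move=> i k l; apply: (smooth_eq (domo i)) (smooth_det (domo i) (hs i)) => z _.
  by rewrite !ord1 mxE eqxx mulr1n.
- move=> i z iz; rewrite /det_metric tr_scalar_mx map_scalar_mx; congr (_%:M).
  by rewrite (det_metric_real hh iz); apply: eqC; rewrite /= ?oppr0.
- move=> i z xi iz xi0; rewrite /det_metric mul_mx_scalar -scalemxAl mxE mxE big_ord1 !mxE.
  have [p0 _] := det_metric_pos hh iz; rewrite (det_metric_real hh iz) mul_conj_cabs -rmorphM ltcR.
  rewrite mulr_gt0// exprn_gt0// cabs_gt0; apply: contra xi0 => /eqP x0.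
  by apply/eqP/rowP => j; rewrite ord1 mxE.
- move=> i j z iz jz; rewrite /det_metric /= (ht i j z iz jz) !det_mulmx.
  rewrite !scalar_mxM det_map_mx det_tr; congr (_ *m _).
  by rewrite tr_scalar_mx map_scalar_mx.
Qed.

Lemma det_curvature_trace (i : chart E) z : holomorphic_bundle E -> hermitian_metric h -> dom i z ->
  \tr (curvature h i z) =
  - dzbar (fun w => dz (fun y => \det (h i y)) w / \det (h i w)) z.
Proof.
move=> [domo _ _ _ _] hh iz; have [hs _ _ _] := hh.
rewrite -(curvature_trace (domo i) iz (hs i)); last by move=> w; exact: det_metric_neq0.
by rewrite /curvature linearN.
Qed.

Lemma acceptable_trace : acceptable h -> exists2 M : R, 0 <= M & forall (i : chart E) z, dom i z ->
  cabs (\tr (curvature h i z)) <= M * kap z.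
Proof.
move=> [[_ domU _ _ _] hh [M M0 Mb]]; exists (r%:R * M); first by rewrite mulr_ge0// ltW.
move=> i z iz; have [G Gu GE] := metric_factor hh iz.
apply: le_trans (cabs_trace_le _ GE Gu) _; rewrite -mulrA ler_wpM2l//.
have [z1 z0] : pdisc z by rewrite -domU; exists i.
have z0' : 0 < cabs z by rewrite cabs_gt0; apply/eqP.
have /kap_gt0 : 0 < cabs z < 1 by rewrite z0'.
rewrite /kap invr_gt0 => kp; rewrite ler_pdivlMr// mulrC.
by have := Mb i z iz; rewrite sqrrN.
Qed.

End DetBundle.

Lemma det_acceptable (R : realType) r (E : bundle R r) (h : metric E) :
  acceptable h -> acceptable (det_metric h).
Proof.
move=> ha; have [Eh hh [M M0 Mb]] := ha.
have dE := det_holomorphic Eh; have dh := det_hermitian Eh hh.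
split=> //; have [N N0 Nb] := acceptable_trace ha.
exists (N + 1); first by rewrite ltr_wpDl.
move=> i z iz; have iz' : dom (b := E) i z by [].
(* The same trace formula is applied to E and to the 1 x 1 metric of its determinant bundle; both
   express the trace through det h. *)
have trE : \tr (curvature (det_metric h) i z) = \tr (curvature h i z).
  have e1 := @det_curvature_trace R 1 (det_bundle E) (det_metric h) i z dE dh iz.
  have e2 := @det_curvature_trace R r E h i z Eh hh iz'.
  have d1 w : \det (det_metric h i w) = \det (h i w) by rewrite /det_metric det_scalar1.
  have d2 : (fun w => dz (fun y => \det (det_metric h i y)) w / \det (det_metric h i w)) =
      (fun w => dz (fun y => \det (h i y)) w / \det (h i w)).
    by apply/funext => w; rewrite d1 (funext d1).
  by rewrite d2 in e1; rewrite e1 e2.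
have -> : end_norm (det_metric h i z) (curvature (det_metric h) i z) = cabs (\tr (curvature h i z)).
  rewrite -trE; move: (curvature (det_metric h) i z) => A; rewrite /end_norm /det_metric.
  rewrite invmx_scalar mul_scalar_mx -scalemxAl mul_mx_scalar scalerA mulfV ?scale1r; last first.
    exact: det_metric_neq0 hh iz'.
  rewrite /mxtrace !big_ord1 mxE big_ord1 !mxE mul_conj_cabs /= sqrtr_sqr ger0_norm//.
  exact: cabs_ge0.
have [z1 z0] : pdisc z by case: Eh => _ <- _ _ _; exists i.
have z0' : 0 < cabs z by rewrite cabs_gt0; apply/eqP.
have zP : 0 < cabs z < 1 by rewrite z0'.
have /kap_gt0 kp := zP; rewrite /kap invr_gt0 in kp.
have := Nb i z iz'; rewrite /kap ler_pdivlMr// => H.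
by rewrite sqrrN mulrC (le_trans H)// lerDl.
Qed.

(** The mixed derivative of ln det h is, up to sign, the trace of the curvature, which acceptability
    bounds on both sides. *)
Lemma lap_ge_ln_det (R : realType) r (E : bundle R r) (h : metric E) :
  acceptable h -> exists2 M : R, 0 <= M & forall (i : chart E) z, dom i z ->
  lap_ge (fun w => ln (complex.Re (\det (h i w)))) z (- M * kap z) /\
  lap_ge (fun w => - ln (complex.Re (\det (h i w)))) z (- M * kap z).
Proof.
move=> ha; have [Eh hh _] := ha; have [M M0 Mb] := acceptable_trace ha; exists M => // i z iz.
have [domo _ _ _ _] := Eh; have [hs _ _ _] := hh.
have [||a [b T]] := dzbar_dz_ln (domo i) iz (smooth_det (domo i) (hs i)).
- by move=> w iw; case: (det_metric_pos hh iw).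
- by move=> w iw; case: (det_metric_pos hh iw).
have cb : `|complex.Re (dzbar (fun w => dz (fun z => \det (h i z)) w / \det (h i w)) z)| <= M * kap z.
  apply: le_trans (normRe_le _) _; rewrite -cabsN -det_curvature_trace//; exact: Mb.
move: cb; rewrite ler_norml -mulNr => /andP[c1 c2]; split.
  exact: lap_ge_le c1 (taylor2_lap_ge T).
apply: lap_ge_le (taylor2_lap_ge (taylor2N T)); by rewrite mulNr lerN2.
Qed.

(** * Frames of the prolongation *)

Section Frames.
Variable R : realType.
Local Notation C := R[i].

(** The transformation rules of sections and metric make the value the same in all charts, so [xget]
    selects from a singleton. *)
Lemma hprodE r (E : bundle R r) (h : metric E) (V : set C) (s t : local_data E) (i : chart E) z :
  hermitian_metric h -> section V s -> section V t -> V z -> dom i z ->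
  hprod h s t z = (s i z *m h i z *m (t i z)^t*) 0 0.
Proof.
move=> [_ _ _ hT] [_ sT] [_ tT] Vz iz; apply: xget_subset1; first by exists i.
move=> _ _ [j jz ->] [k kz ->].
have key (l : chart E) : dom l z ->
    s l z *m h l z *m (t l z)^t* = s i z *m h i z *m (t i z)^t*.
  move=> lz; rewrite (hT i l z iz lz) (sT i l z Vz iz lz) (tT i l z Vz iz lz).
  by rewrite mulmx_adj !mulmxA.
by rewrite (key j jz) (key k kz).
Qed.

Variables (r : nat) (E : bundle R r) (h : metric E).
Hypothesis Eh : holomorphic_bundle E.

Lemma section_subset (V V' : set C) (s : local_data E) : V' `<=` V -> section V s -> section V' s.
Proof.
move=> VV [sh st]; split=> [i k z [/VV Vz iz]|i j z /VV]; [exact: sh|exact: st].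
Qed.

Definition vmx (v : 'I_r -> local_data E) (i : chart E) (z : C) : 'M[C]_r := \matrix_(k < r) v k i z.

Lemma vmxT (V : set C) (v : 'I_r -> local_data E) (i j : chart E) z : (forall k, section V (v k)) ->
  V z -> dom i z -> dom j z -> vmx v j z = vmx v i z *m trans i j z.
Proof.
move=> vS Vz iz jz; apply/row_matrixP => k; rewrite rowK row_mul rowK.
by have [_ vT] := vS k; exact: vT.
Qed.

Lemma vmx_cdiff (V : set C) (v : 'I_r -> local_data E) (i : chart E) z k l :
  (forall k, section V (v k)) -> V z -> dom i z -> cdiff (fun w => vmx v i w k l) z.
Proof.
move=> vS Vz iz; have [vh _] := vS k; apply: cdiff_near (proj1 (cdiffP _ _) (vh i l z (conj Vz iz))).
by apply: filterE => w; rewrite mxE.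
Qed.

Lemma wedge_section (V : set C) (v : 'I_r -> local_data E) : (forall k, section V (v k)) ->
  section V (wedge v).
Proof.
move=> vS; split.
  move=> i k z [Vz iz]; apply/cdiffP.
  have dd : cdiff (fun w => \det (vmx v i w)) z.
    by apply: (@cdiff_det R r (vmx v i) z) => a b; exact: vmx_cdiff vS Vz iz.
  apply: cdiff_near dd; apply: filterE => w.
  by rewrite mxE !ord1 eqxx mulr1n.
move=> i j z Vz iz jz; rewrite /wedge /= -!/(vmx _ _ _) (vmxT vS Vz iz jz) det_mulmx.
by rewrite scalar_mxM.
Qed.

(** The k-th basis vector of chart [i], read in the coordinates of chart [j]. *)
Definition chart_frame (i : chart E) (k : 'I_r) : local_data E := fun j z => row k (trans i j z).

Lemma chart_frame_section (i : chart E) k : section (@dom R r E i) (chart_frame i k).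
Proof.
have [domo domU th t1 tc] := Eh; split.
  move=> j l z [iz jz]; apply/cdiffP.
  apply: cdiff_near (proj1 (cdiffP _ _) (th i j k l z (conj iz jz))).
  by apply: filterE => w; rewrite mxE.
by move=> j l z iz jz lz; rewrite /chart_frame -row_mul tc.
Qed.

Lemma gramE (V : set C) (v : 'I_r -> local_data E) (i : chart E) z : hermitian_metric h ->
  (forall k, section V (v k)) -> V z -> dom i z ->
  gram h v z = vmx v i z *m h i z *m (vmx v i z)^t*.
Proof.
move=> hh vS Vz iz; apply/matrixP => k l; rewrite mxE (hprodE hh (vS k) (vS l) Vz iz).
rewrite [LHS]mxE [RHS]mxE; apply: eq_bigr => j _; rewrite !mxE; congr (_ * _).
by apply: eq_bigr => m _; rewrite mxE.
Qed.

Lemma det_gramE (V : set C) (v : 'I_r -> local_data E) (i : chart E) z : hermitian_metric h ->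
  (forall k, section V (v k)) -> V z -> dom i z ->
  complex.Re (\det (gram h v z)) = cabs (\det (vmx v i z)) ^+ 2 * complex.Re (\det (h i z)).
Proof.
move=> hh vS Vz iz; rewrite (gramE hh vS Vz iz) !det_mulmx det_map_mx det_tr.
by rewrite mulrAC mul_conj_cabs ReM /= mul0r subr0.
Qed.

Lemma dom_neq0 (i : chart E) z : dom i z -> disc z /\ z != 0.
Proof.
have [_ domU _ _ _] := Eh => iz; have [z1 z0] : pdisc z by rewrite -domU; exists i.
by split=> //; apply/eqP.
Qed.

(** Away from 0 the growth condition is vacuous, so the frame of chart [i] consists of sections of
    _aE over dom i and U. Expressing it through [v] gives a left inverse of [vmx]. *)
Lemma wedge_neq0 a U v (i : chart E) z : local_frame h a U v -> U z -> dom i z ->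
  \det (vmx v i z) != 0.
Proof.
move=> [[Uo _] _ vp vf] Uz iz; have [domo _ _ t1 _] := Eh.
pose V := @dom R r E i `&` U.
have Vo : copen V by exact: openI (domo i) Uo.
have VU : V `<=` U by move=> w [].
have V0 : ~ V 0 by move=> [/dom_neq0[_ /eqP]].
have VV : V `\ 0 `<=` V by move=> w [].
have [frame _] := vf V Vo VU.
have cf k : exists2 c : 'I_r -> C -> C, forall l, holo V (c l) &
    eq_on (V `\ 0) (chart_frame i k) (lincomb c v).
  apply: frame; split=> [|/V0//]; apply: section_subset (chart_frame_section i k).
  by move=> w [[]].
have /choice[c cP] : forall k, exists c : 'I_r -> C -> C, eq_on (V `\ 0) (chart_frame i k) (lincomb c v).
  by move=> k; have [c _ cE] := cf k; exists c.
have zE : 1%:M = (\matrix_(k, l) c k l z) *m vmx v i z.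
  apply/row_matrixP => k; rewrite -(t1 i z iz).
  have -> : row k (trans i i z) = lincomb (c k) v i z.
    apply: cP => //; split=> //; have [_ z0] := dom_neq0 iz; exact/eqP.
  rewrite row_mul mulmx_sum_row; apply: eq_bigr => l _; rewrite rowK !mxE.
  by congr (_ *: _).
have [_] := mulmx1_unit (esym zE).
by rewrite unitmxE unitfE.
Qed.

End Frames.

(** * Growth of the Gram determinant of a frame *)

Section FrameGrowth.
Variable R : realType.
Local Notation C := R[i].
Local Notation Co := (R[i]^o).

Lemma cabs_prod (I : Type) (s : seq I) (F : I -> C) :
  cabs (\prod_(i <- s) F i) = \prod_(i <- s) cabs (F i).
Proof. by elim: s => [|i s IH]; rewrite ?big_nil ?cabs1// !big_cons cabsM IH. Qed.

Lemma cabs_det_le n (A : 'M[C]_n) (X : R) : (forall i j, cabs (A i j) <= X) ->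
  cabs (\det A) <= n`!%:R * X ^+ n.
Proof.
move=> AX; apply: le_trans (cabs_sum _ _) _.
have -> : n`!%:R * X ^+ n = \sum_(s : 'S_n) X ^+ n.
  by rewrite sumr_const card_Sn mulr_natl.
apply: ler_sum => s _; rewrite cabsM.
have -> : cabs ((-1) ^+ odd_perm s : C) = 1.
  by rewrite cabsX cabsN cabs1 expr1n.
rewrite mul1r cabs_prod -[n in X ^+ n]card_ord -prodr_const.
by apply: ler_prod => i _; rewrite cabs_ge0 AX.
Qed.

Variables (r : nat) (E : bundle R r) (h : metric E).

Lemma hnormE (V : set C) (s : local_data E) (i : chart E) z : hermitian_metric h ->
  section V s -> V z -> dom i z ->
  hnorm h s z = Num.sqrt (complex.Re ((s i z *m h i z *m (s i z)^t*) 0 0)).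
Proof. by move=> hh sS Vz iz; rewrite /hnorm (hprodE hh sS sS Vz iz). Qed.

(** The growth condition is taken with e = 1. Where - ln |z| >= 1 the multiplicative constants can
    be moved into the exponent, so one number [B] serves all members of the frame. *)
Lemma prolong_bound a U (v : 'I_r -> local_data E) : U 0 -> (forall k, prolong h a U (v k)) ->
  exists B d : R, [/\ 0 <= B, 0 < d & forall z k, 0 < cabs z < d ->
    hnorm h (v k) z <= expR (B * - ln (cabs z))].
Proof.
move=> U0 vp.
have /choice[M MP] : forall k, exists M : R, \forall z \near (near0 : set_system C),
    hnorm h (v k) z <= M * cabs z `^ (- (a + 1)).
  by move=> k; have [_ /(_ U0 1 ltr01)] := vp k.
have /dnbhsC[d d0 dP] : \forall z \near dnbhs (0 : Co), forall k,
    hnorm h (v k) z <= M k * cabs z `^ (- (a + 1)).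
  by apply: filter_forall => k; exact: MP.
pose B := \sum_k `|M k| + `|a + 1|.
exists B, (Num.min d (expR (- 1))); split.
- by rewrite addr_ge0// sumr_ge0.
- by rewrite lt_min d0 expR_gt0.
move=> z k /andP[z0]; rewrite lt_min => /andP[zd ze].
have zn0 : z != 0 by rewrite -cabs_gt0.
have l1 : 1 <= - ln (cabs z) by rewrite -ln_cabs_ge// ltW.
have l0 : 0 <= - ln (cabs z) by rewrite (le_trans _ l1).
apply: le_trans (dP z zn0 _ k) _; first by rewrite subr0.
rewrite /powR gt_eqF//.
apply: le_trans (_ : expR ((\sum_k `|M k|) * - ln (cabs z)) * expR (`|a + 1| * - ln (cabs z)) <= _);
  last by rewrite -expRD -mulrDl.
have Mk : M k <= expR ((\sum_k `|M k|) * - ln (cabs z)).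
  apply: le_trans (ler_norm _) _; apply: le_trans (_ : 1 + (\sum_k `|M k|) * - ln (cabs z) <= _).
    rewrite (le_trans (_ : _ <= \sum_k `|M k|))//.
      by rewrite (bigD1 k)//= lerDl sumr_ge0.
    by rewrite -[leLHS]add0r lerD// ler_peMr// sumr_ge0.
  exact: expR_ge1Dx.
apply: le_trans (ler_wpM2r (expR_ge0 _) Mk) _.
rewrite ler_pM2l ?expR_gt0// ler_expR mulNr -mulrN.
by rewrite ler_wpM2r// ler_norm.
Qed.

(** Cauchy-Schwarz bounds the entries and the Leibniz formula the determinant; the factor [c] is
    again absorbed by exp(c l), with l = - ln |z| >= 1. *)
Lemma gram_growth a U (v : 'I_r -> local_data E) : acceptable h -> U `<=` disc ->
  U 0 -> (forall k, prolong h a U (v k)) -> copen U ->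
  exists N d : R, [/\ 0 <= N, 0 < d & forall z, 0 < cabs z < d ->
    complex.Re (\det (gram h v z)) <= expR (N * - ln (cabs z))].
Proof.
move=> ha Ud U0 vp Uo; have [Eh hh _] := ha.
have [B [d [B0 d0 vB]]] := prolong_bound U0 vp.
have [d1 d10 d1U] := proj1 (nbhsC _ _) (copenP Uo U0).
pose c : R := r`!%:R * r%:R ^+ r; have c0 : 0 <= c by rewrite mulr_ge0// exprn_ge0.
exists (c + 2 * B * r%:R), (Num.min (Num.min d d1) (expR (- 1))); split.
- by rewrite addr_ge0// !mulr_ge0.
- by rewrite !lt_min d0 d10 expR_gt0.
move=> z /andP[z0]; rewrite !lt_min => /andP[/andP[zd zd1] ze].
have l1 : 1 <= - ln (cabs z) by rewrite -ln_cabs_ge// ltW.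
set l := - ln (cabs z) in l1 *.
have Uz : U z by apply: d1U; rewrite subr0.
have zn0 : z != 0 by rewrite -cabs_gt0.
have Vz : (U `\ 0) z by split=> //; exact/eqP.
have [i _ iz] : (\bigcup_(i in setT) @dom R r E i) z.
  by case: Eh => _ -> _ _ _; split; [exact: Ud|exact/eqP].
have [G Gu GE] := metric_factor hh iz.
have vS k : section (U `\ 0) (v k) by case: (vp k).
have hB k : hnorm h (v k) z <= expR (B * l) by apply: vB; rewrite z0.
have entry k m : cabs (gram h v z k m) <= r%:R * expR (2 * B * l).
  rewrite mxE (hprodE hh (vS k) (vS m) Vz iz); apply: le_trans (form_cauchy _ _ GE) _.
  rewrite -(hnormE hh (vS k) Vz iz) -(hnormE hh (vS m) Vz iz) ler_wpM2l//.
  have -> : 2 * B * l = B * l + B * l by ring.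
  rewrite expRD.
  by apply: ler_pM; rewrite ?sqrtr_ge0.
apply: le_trans (Re_le_cabs _) _; apply: le_trans (cabs_det_le entry) _.
have -> : (c + 2 * B * r%:R) * l = c * l + r%:R * (2 * B * l) by ring.
rewrite expRD exprMn -expRM_natl (mulrA r`!%:R) -/c.
rewrite ler_pM2r ?expR_gt0//; apply: le_trans (_ : 1 + c * l <= _); last exact: expR_ge1Dx.
by apply: le_trans (_ : c * l <= _); rewrite ?lerDr ?ler_peMr.
Qed.

Lemma gram_quasi_harmonic a U (v : 'I_r -> local_data E) : acceptable h -> local_frame h a U v ->
  exists rho M N, quasi_harmonic (fun z => ln (complex.Re (\det (gram h v z)))) rho M N /\
    forall z, cabs z < rho -> U z.
Proof.
move=> ha vf; have [Eh hh _] := ha; have [[Uo Ud] U0 vp _] := vf.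
have [N [d [N0 d0 NB]]] := gram_growth ha Ud U0 vp Uo.
have [d1 d10 d1U] := proj1 (nbhsC _ _) (copenP Uo U0).
have [M M0 Mlap] := lap_ge_ln_det ha.
have vS k : section (U `\ 0) (v k) by case: (vp k).
pose rho : R := Num.min (Num.min d d1) (1 / 2).
have rhoU z : cabs z < rho -> U z.
  by rewrite !lt_min => /andP[/andP[_ zd1] _]; apply: d1U; rewrite subr0.
have local z : 0 < cabs z < rho -> exists2 i : chart E, dom i z & (U `\ 0) z.
  move=> /andP[z0 zr]; have zn0 : z != 0 by rewrite -cabs_gt0.
  have Uz := rhoU z zr; have [i _ iz] : (\bigcup_(i in setT) @dom R r E i) z.
    by case: Eh => _ -> _ _ _; split; [exact: Ud|exact/eqP].
  by exists i => //; split=> //; exact/eqP.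
have gpos z : 0 < cabs z < rho -> 0 < complex.Re (\det (gram h v z)).
  move=> zP; have [i iz Vz] := local z zP; have [Uz _] := Vz.
  rewrite (det_gramE hh vS Vz iz) mulr_gt0//; last by case: (det_metric_pos hh iz).
  by rewrite exprn_gt0// cabs_gt0; exact: (wedge_neq0 Eh vf).
have domo i : copen (@dom R r E i) by case: Eh => + _ _ _ _; exact.
have nphi z (i : chart E) : dom i z -> (U `\ 0) z -> \forall w \near (z : Co),
    ln (cabs (\det (vmx v i w))) + ln (cabs (\det (vmx v i w))) + ln (complex.Re (\det (h i w))) =
    ln (complex.Re (\det (gram h v w))).
  move=> iz [Uz _]; apply: filterS (copenP (openI (domo i) Uo) (conj iz Uz)) => w [iw Uw].
  have [_ w0] := dom_neq0 Eh iw; have Vw : (U `\ 0) w by split=> //; exact/eqP.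
  have W0 : 0 < cabs (\det (vmx v i w)) by rewrite cabs_gt0; exact: (wedge_neq0 Eh vf).
  have [D0 _] := det_metric_pos hh iw.
  by rewrite (det_gramE hh vS Vw iw) lnM ?posrE ?exprn_gt0// lnXn// mulr2n.
have Wd z (i : chart E) : dom i z -> (U `\ 0) z ->
    \forall w \near (z : Co), cdiff (fun w => \det (vmx v i w)) w.
  move=> iz [Uz _]; apply: filterS (copenP (openI (domo i) Uo) (conj iz Uz)) => w [iw Uw].
  have [_ w0] := dom_neq0 Eh iw; have Vw : (U `\ 0) w by split=> //; exact/eqP.
  by apply: (@cdiff_det R r (vmx v i) w) => k l; exact: vmx_cdiff vS Vw iw.
exists rho, M, N; split=> //; split.
- split=> //; rewrite !lt_min d0 d10 divr_gt0//=.
  by apply: le_lt_trans (_ : 1 / 2 < 1); rewrite ?ge_min ?lexx ?orbT//; lra.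
- move=> z zP; have [i iz Vz] := local z zP; have [Uz _] := Vz.
  have W0 : 0 < cabs (\det (vmx v i z)) by rewrite cabs_gt0; exact: (wedge_neq0 Eh vf).
  have [D0 _] := det_metric_pos hh iz; have [hs _ _ _] := hh.
  have lnW : rcont (fun w => ln (cabs (\det (vmx v i w)))) z.
    apply: (@rcont_comp R (@ln R) (fun w => cabs (\det (vmx v i w)))); last exact: continuous_ln.
    exact: (rcont_ccomp (cdiff_cont (nbhs_singleton (Wd z i iz Vz))) (rcont_cabs _)).
  apply: rcont_near (nphi z i iz Vz) (rcontD (rcontD lnW lnW) _).
  apply: (@rcont_comp R (@ln R) (fun w => complex.Re (\det (h i w)))); last exact: continuous_ln.
  exact: (Ck_cont (proj1 (smooth_det (domo i) (hs i) 0)) iz).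
- move=> z zP; have [i iz Vz] := local z zP; have [Uz _] := Vz.
  have W0 : \det (vmx v i z) != 0 by exact: (wedge_neq0 Eh vf).
  have [l1 l2] := Mlap i z iz.
  have [k1 k2] := (lap_ge_ln_cabs (Wd z i iz Vz) W0, lap_geN_ln_cabs (Wd z i iz Vz) W0).
  split.
    apply: lap_ge_near (nphi z i iz Vz) _.
    by have := lap_geD (lap_geD k1 k1) l1; rewrite !add0r.
  have := lap_geD (lap_geD k2 k2) l2; rewrite !add0r; apply: lap_ge_near.
  by apply: filterS (nphi z i iz Vz) => w <-; rewrite !opprD.
- move=> z zP; have /andP[z0 zr] := zP; have zd : 0 < cabs z < d.
    by rewrite z0; move: zr; rewrite !lt_min => /andP[/andP[]].
  by rewrite -ler_expR lnK ?NB// posrE gpos.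
Qed.

End FrameGrowth.

(** * The invariant gamma as a two-sided order of growth *)

Section DetProlongation.
Variable R : realType.
Local Notation C := R[i].
Local Notation Co := (R[i]^o).

Lemma limf_einf_near0 (f : C -> R) (l : R) :
  (forall e : R, 0 < e -> exists2 d : R, 0 < d & forall z, 0 < cabs z < d -> `|f z - l| <= e) ->
  limf_einf (fun z : Co => (f z)%:E) (@near0 R) = l%:E.
Proof.
move=> fl; rewrite limf_einfE.
have nf (e : R) : 0 < e -> (@near0 R) [set z | `|f z - l| <= e].
  move=> e0; have [d d0 dP] := fl e e0; apply/dnbhsC; exists d => // w w0; rewrite subr0 => wd.
  by apply: dP; rewrite cabs_gt0 w0.
apply/eqP; rewrite eq_le; apply/andP; split.
  apply: ge_ereal_sup => _ [V FV <-]; apply/lee_addgt0Pr => e e0.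
  have [z [Vz ze]] := @filter_ex Co (dnbhs (0 : Co)) _ _ (filterI FV (nf e e0)).
  apply: le_trans (_ : ((f z)%:E <= _)%E); first by apply: ereal_inf_lbound; exists z.
  by rewrite -EFinD lee_fin; move: ze; rewrite /= ler_norml; clear; lra.
apply/lee_addgt0Pr => e e0; rewrite -leeBlDr//.
apply: (@le_trans _ _ (ereal_inf [set (f z)%:E | z in [set z : Co | `|f z - l| <= e]])).
  apply: le_ereal_inf_tmp => _ [z ze <-]; rewrite -EFinB lee_fin.
  by move: ze; rewrite /= ler_norml; clear; lra.
by apply: ereal_sup_ubound; exists [set z | `|f z - l| <= e] => //; exact: nf.
Qed.

Lemma lt_ln_cabs (z : C) (s : R) : 0 < cabs z -> cabs z < expR (- s) -> s < - ln (cabs z).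
Proof. by move=> z0; rewrite -{1}(lnK z0) ltr_expR ltrNr. Qed.

Lemma powR_ln_cabs (z : C) (x : R) : 0 < cabs z -> cabs z `^ (- x) = expR (x * - ln (cabs z)).
Proof. by move=> z0; rewrite /powR gt_eqF// mulNr mulrN. Qed.

Lemma sqrt_expR_ln (x : R) : 0 < x -> Num.sqrt x = expR (ln x / 2).
Proof.
move=> x0; have e : expR (ln x / 2) ^+ 2 = x by rewrite -expRM_natl mulrC divfK// lnK.
by rewrite -{1}e sqrtr_sqr ger0_norm// expR_ge0.
Qed.

Variables (r : nat) (E : bundle R r) (h : metric E).

Lemma gamma_growth a U (v : 'I_r -> local_data E) : acceptable h -> local_frame h a U v ->
  forall e : R, 0 < e -> exists2 d : R, 0 < d & forall z, 0 < cabs z < d ->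
    [/\ U z, 0 < complex.Re (\det (gram h v z)) &
    `|ln (complex.Re (\det (gram h v z))) / 2 - gamma h v * - ln (cabs z)| <= e * - ln (cabs z)].
Proof.
move=> ha vf; have [rho [M [N [qh rhoU]]]] := gram_quasi_harmonic ha vf.
have [mu muP] := growth_limit qh; have /andP[rho0 rho1] := qh_rho qh.
have [Eh hh _] := ha; have [[Uo Ud] U0 vp _] := vf.
have lim (e : R) : 0 < e -> exists2 d : R, 0 < d & forall z, 0 < cabs z < d ->
   [/\ cabs z < rho, 0 < - ln (cabs z) & `|ln (complex.Re (\det (gram h v z))) - mu * - ln (cabs z)| <= e * - ln (cabs z)].
  move=> e0; have [L LP] := muP e e0.
  exists (Num.min rho (expR (- Num.max L 0))); first by rewrite lt_min rho0 expR_gt0.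
  move=> z /andP[z0]; rewrite lt_min => /andP[zr zL].
  have := lt_ln_cabs z0 zL; rewrite gt_max => /andP[zL' zl0].
  by split=> //; exact: LP.
(* As ln |z| is negative, the quotient phi / ln |z| tends to - mu, and the factor - 1/2 in gamma
   restores the sign. *)
have gE : gamma h v = mu / 2.
  rewrite /gamma (@limf_einf_near0 _ (- mu)) -?EFinM /=; first by field.
  move=> e e0; have [d d0 dP] := lim e e0; exists d => // z zd.
  have [_ l0 H] := dP z zd.
  rewrite -(ler_pM2r l0); apply: le_trans H; rewrite -{1}(gtr0_norm l0) -normrM.
  rewrite le_eqVlt; apply/orP; left; apply/eqP; rewrite -normrN; congr (`|_|).
  field; by rewrite -oppr_eq0 gt_eqF.
move=> e e0; have e20 : 0 < 2 * e by rewrite mulr_gt0.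
have [d d0 dP] := lim _ e20; exists d => // z zd; have [zr l0 H] := dP z zd.
have Uz := rhoU z zr; have /andP[z0 _] := zd.
have zn0 : z != 0 by rewrite -cabs_gt0.
have [i _ iz] : (\bigcup_(i in setT) @dom R r E i) z.
  by case: Eh => _ -> _ _ _; split; [exact: Ud|exact/eqP].
have vS k : section (U `\ 0) (v k) by case: (vp k).
have Vz : (U `\ 0) z by split=> //; exact/eqP.
split=> //.
  rewrite (det_gramE hh vS Vz iz) mulr_gt0//; last by case: (det_metric_pos hh iz).
  by rewrite exprn_gt0// cabs_gt0; exact: (wedge_neq0 Eh vf).
move: H; rewrite gE !ler_norml; clear; lra.
Qed.

Lemma det_hprodE (V : set C) (s t : local_data (det_bundle E)) (i : chart E) z : acceptable h ->
  section V s -> section V t -> V z -> dom i z ->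
  hprod (det_metric h) s t z = s i z 0 0 * \det (h i z) * (t i z 0 0)^*.
Proof.
move=> ha sS tS Vz iz; have [Eh hh _] := ha.
rewrite (@hprodE R 1 (det_bundle E) (det_metric h) V s t i z (det_hermitian Eh hh) sS tS Vz iz).
by rewrite /det_metric mul_mx_scalar -scalemxAl mxE mxE big_ord1 !mxE mulrCA mulrA.
Qed.

Lemma det_hnormE (V : set C) (s : local_data (det_bundle E)) (i : chart E) z : acceptable h ->
  section V s -> V z -> dom i z ->
  hnorm (det_metric h) s z = cabs (s i z 0 0) * Num.sqrt (complex.Re (\det (h i z))).
Proof.
move=> ha sS Vz iz; rewrite /hnorm (det_hprodE ha sS sS Vz iz).
rewrite mulrAC mul_conj_cabs ReM /= mul0r subr0 sqrtrM ?sqr_ge0//.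
by rewrite sqrtr_sqr ger0_norm// cabs_ge0.
Qed.

Lemma det_hnorm_wedge (U : set C) (v : 'I_r -> local_data E) (s : local_data (det_bundle E))
    (i : chart E) z (f : C) : acceptable h -> section U s -> (forall k, section U (v k)) ->
  U z -> dom i z -> s i z 0 0 = f * \det (vmx v i z) ->
  hnorm (det_metric h) s z = cabs f * Num.sqrt (complex.Re (\det (gram h v z))).
Proof.
move=> ha sS vS Uz iz sE; have [Eh hh _] := ha.
rewrite (det_hnormE ha sS Uz iz) sE (det_gramE hh vS Uz iz) cabsM.
by rewrite sqrtrM ?sqr_ge0// sqrtr_sqr ger0_norm ?cabs_ge0// mulrA.
Qed.

End DetProlongation.

(** * Comparison of the two sheaves *)

Section Main.
Variable R : realType.
Local Notation C := R[i].
Local Notation Co := (R[i]^o).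
Variables (r : nat) (E : bundle R r) (h : metric E).

Lemma bounded_near0 (f : C -> C) : cdiff f 0 ->
  exists K d : R, [/\ 0 <= K, 0 < d & forall z, cabs z < d -> cabs (f z) <= K].
Proof.
move=> /cdiff_cont /ccontP /(_ 1 ltr01)[d d0 dP]; exists (1 + cabs (f 0)), d; split=> //.
  by rewrite addr_ge0 ?cabs_ge0.
move=> z zd; have := dP z; rewrite subr0 => /(_ zd) H.
by rewrite -lerBlDr (le_trans (ler_cabsB _ _))// ltW.
Qed.

(** Each section [w k l] has coefficients in the frame [v] that are holomorphic through 0, so every
    wedge of the [w k l] is the determinant of these coefficients times the wedge of [v]. One [f]
    thus serves all charts. *)
Lemma frame_factor a U (v : 'I_r -> local_data E) (V : set C) n (c : 'I_n -> C -> C)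
    (w : 'I_n -> 'I_r -> local_data E) (s : local_data (det_bundle E)) :
  local_frame h a U v -> copen V -> V 0 -> (forall k, holo V (c k)) ->
  (forall k l, prolong h a V (w k l)) -> eq_on (V `\ 0) s (lincomb c (fun k => wedge (w k))) ->
  exists2 f : C -> C, cdiff f 0 & forall (i : chart E) z, ((V `&` U) `\ 0) z -> dom i z ->
    s i z 0 0 = f z * \det (vmx v i z).
Proof.
move=> [[Uo Ud] U0 vp vf] Vo V0 ch wp sE.
pose V' := V `&` U; have V'o : copen V' by exact: openI Vo Uo.
have V'U : V' `<=` U by move=> z [].
have V'V z : (V' `\ 0) z -> (V `\ 0) z by move=> [[Vz _] z0].
have wp' k l : prolong h a V' (w k l).
  have [wS wG] := wp k l; split; first exact: section_subset V'V wS.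
  by move=> _; exact: wG.
have [frame _] := vf V' V'o V'U.
have /choice[b bP] : forall kl : 'I_n * 'I_r, exists b : 'I_r -> C -> C,
    (forall m, holo V' (b m)) /\ eq_on (V' `\ 0) (w kl.1 kl.2) (lincomb b v).
  by move=> [k l]; have [b bh bE] := frame _ (wp' k l); exists b.
pose B k z : 'M[C]_r := \matrix_(l, m) b (k, l) m z.
exists (fun z => \sum_k c k z * \det (B k z)).
  apply: cdiff_sum => k _; apply: cdiffM; first exact: (proj1 (cdiffP _ _) (ch k 0 V0)).
  apply: (@cdiff_det R r (B k) 0) => l m.
  have [bh _] := bP (k, l); apply: cdiff_near (proj1 (cdiffP _ _) (bh m 0 (conj V0 U0))).
  by apply: filterE => z; rewrite mxE.
move=> i z V'z iz; rewrite (sE i z (V'V z V'z) iz) /lincomb summxE mulr_suml.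
apply: eq_bigr => k _; rewrite !mxE eqxx mulr1n -mulrA; congr (_ * _).
rewrite -det_mulmx; congr (\det _); apply/row_matrixP => l.
rewrite rowK row_mul mulmx_sum_row; have [_ bE] := bP (k, l).
rewrite (bE i z V'z iz); apply: eq_bigr => m _; rewrite rowK !mxE.
by [].
Qed.

Lemma chart_of (W : set C) z : acceptable h -> W `<=` disc -> (W `\ 0) z ->
  exists i : chart E, dom i z.
Proof.
move=> [[_ domU _ _ _] _ _] Wd [Wz z0].
have [i _ iz] : (\bigcup_(i in setT) @dom R r E i) z by rewrite domU; split=> //; exact: Wd.
by exists i.
Qed.

(** The factor [f] is bounded near 0, and only the upper half of [gamma_growth] is used. *)
Lemma det_prolong_growth a U (v : 'I_r -> local_data E) (W : set C)
    (s : local_data (det_bundle E)) : acceptable h -> local_frame h a U v ->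
  copen W -> W `<=` disc -> det_prolong h a W s -> prolong (det_metric h) (gamma h v) W s.
Proof.
move=> ha vf Wo Wd [sS sL]; split=> // W0 e e0.
have [V [Vo V0 VW] [n [c [w [ch wp sE]]]]] := sL 0 W0.
have [f fd fE] := frame_factor vf Vo V0 ch wp sE.
have [K [d1 [K0 d10 fK]]] := bounded_near0 fd.
have [d2 d20 d2P] := gamma_growth ha vf e0.
have [[Uo Ud] U0 vp _] := vf.
have [d3 d30 d3P] := proj1 (nbhsC _ _) (copenP (openI Vo Uo) (conj V0 U0)).
exists K; apply/dnbhsC; exists (Num.min (Num.min d1 d2) d3); first by rewrite !lt_min d10 d20.
move=> z zn0; rewrite subr0 !lt_min => /andP[/andP[zd1 zd2] zd3].
have z0 : 0 < cabs z by rewrite cabs_gt0.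
have V'z : ((V `&` U) `\ 0) z by split; [apply: d3P; rewrite subr0|exact/eqP].
have Wz : (W `\ 0) z by case: V'z => -[/VW].
have Uz : (U `\ 0) z by case: V'z => -[].
have [i iz] := chart_of ha Wd Wz.
have vS k : section ((W `&` U) `\ 0) (v k).
  by apply: section_subset (proj1 (vp k)) => y [[]].
have sS' : section ((W `&` U) `\ 0) s by apply: section_subset sS => y [[]].
have WUz : ((W `&` U) `\ 0) z by case: Wz; case: Uz.
rewrite (det_hnorm_wedge ha sS' vS WUz iz (fE i z V'z iz)) powR_ln_cabs//.
have zd2' : 0 < cabs z < d2 by rewrite z0.
have [_ g0 gz] := d2P z zd2'.
apply: ler_pM; rewrite ?cabs_ge0 ?sqrtr_ge0 ?fK//.
rewrite sqrt_expR_ln// ler_expR mulrDl addrC -lerBlDr.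
exact: le_trans (ler_norm _) gz.
Qed.

(** Away from 0 growth imposes nothing: the frame of a chart around [p] consists of sections of _aE,
    and [s] is its own coordinate times their wedge. *)
Lemma growth_det_prolong_away a (W : set C) (s : local_data (det_bundle E)) p : acceptable h ->
  copen W -> section (W `\ 0) s -> (W `\ 0) p -> W `<=` disc ->
  exists2 V : set C, [/\ copen V, V p & V `<=` W] &
    exists n (c : 'I_n -> C -> C) (v : 'I_n -> 'I_r -> local_data E),
      [/\ forall k, holo V (c k), forall k l, prolong h a V (v k l)
        & eq_on (V `\ 0) s (lincomb c (fun k => wedge (v k)))].
Proof.
move=> ha Wo [sh sT] Wp Wd; have [i ip] := chart_of ha Wd Wp; have [Eh hh _] := ha.
have [domo _ _ _ _] := Eh; have [Wp1 _] := Wp.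
exists (W `&` @dom R r E i); first by split=> [|//|z []//]; exact: openI Wo (domo i).
have W0 z : (W `&` @dom R r E i) z -> (W `\ 0) z.
  by move=> [Wz iz]; split=> //; have [_ z0] := dom_neq0 Eh iz; exact/eqP.
exists 1, (fun _ z => s i z 0 0), (fun _ => chart_frame i); split.
- move=> _ z Vz; apply: sh; split; first exact: W0.
  by case: Vz.
- move=> _ l; split=> [|V0]; last by case: (W0 0 V0) => _ /(_ erefl).
  by apply: section_subset (chart_frame_section Eh i l) => z [[]].
- move=> j z [Vz _] jz; have [_ iz] := Vz.
  rewrite (sT i j z (W0 z Vz) iz jz) /lincomb big_ord1 /wedge.
  have -> : (\matrix_k chart_frame i k j z) = trans i j z by apply/row_matrixP => k; rewrite rowK.
  apply/rowP => k; rewrite ord1 !mxE big_ord1 !mxE eqxx mulr1n.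
  by [].
Qed.

(** A single product suffices, with the extension of the quotient of [s] by the wedge of [v] as
    coefficient; the lower half of [gamma_growth] bounds this quotient. *)
Lemma growth_det_prolong_origin a U (v : 'I_r -> local_data E) (W : set C)
    (s : local_data (det_bundle E)) : acceptable h -> local_frame h a U v ->
  copen W -> W `<=` disc -> W 0 -> prolong (det_metric h) (gamma h v) W s ->
  exists2 V : set C, [/\ copen V, V 0 & V `<=` W] &
    exists n (c : 'I_n -> C -> C) (v : 'I_n -> 'I_r -> local_data E),
      [/\ forall k, holo V (c k), forall k l, prolong h a V (v k l)
        & eq_on (V `\ 0) s (lincomb c (fun k => wedge (v k)))].
Proof.
move=> ha vf Wo Wd W0 [sS sG]; have [Eh hh _] := ha.
have [[Uo Ud] U0 vp _] := vf; have [domo _ _ _ _] := Eh.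
pose Y := (W `&` U) `\ 0.
have vS k : section Y (v k) by apply: section_subset (proj1 (vp k)) => y [[]].
have sY : section Y s by apply: section_subset sS => y [[]].
have wY := wedge_section vS.
have YW z : Y z -> (W `\ 0) z by move=> [[]].
have YU z : Y z -> U z by move=> [[]].
(* The quotient s / (v_1 /\ ... /\ v_r), expressed without choosing a chart. *)
pose f z := hprod (det_metric h) s (wedge v) z / hprod (det_metric h) (wedge v) (wedge v) z.
have W0' z (i : chart E) : Y z -> dom i z -> \det (vmx v i z) != 0.
  by move=> Yz iz; have Uz := YU z Yz; exact: (wedge_neq0 Eh vf).
have fE z (i : chart E) : Y z -> dom i z -> f z = s i z 0 0 / \det (vmx v i z).
  move=> Yz iz; rewrite /f (det_hprodE ha sY wY Yz iz) (det_hprodE ha wY wY Yz iz).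
  have -> : wedge v i z 0 0 = \det (vmx v i z) by rewrite mxE eqxx mulr1n.
  have n0 := W0' z i Yz iz; have c0 : (\det (vmx v i z))^* != 0 by rewrite conjC_eq0.
  have d0 := det_metric_neq0 hh iz.
  by field; rewrite n0 c0 d0.
have e14 : 0 < 1 / 4 :> R by rewrite divr_gt0.
have [d1 d10 d1P] := gamma_growth ha vf e14.
have [K /dnbhsC[d2 d20 d2P]] := sG W0 (1 / 4) e14.
have [d3 d30 d3P] := proj1 (nbhsC _ _) (copenP (openI Wo Uo) (conj W0 U0)).
pose rho : R := Num.min (Num.min d1 d2) d3.
have rho0 : 0 < rho by rewrite !lt_min d10 d20.
have rhoY z : 0 < cabs z < rho -> Y z.
  move=> /andP[z0]; rewrite !lt_min => /andP[_ zd3].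
  by split; [apply: d3P; rewrite subr0|apply/eqP; rewrite -cabs_gt0].
have Yo z : Y z -> \forall w \near (z : Co), Y w.
  move=> [WUz /eqP z0]; apply: filterI (copenP (openI Wo Uo) WUz) _.
  apply/nbhsC; exists (cabs z); first by rewrite cabs_gt0.
  by move=> w wz /= w0; move: wz; rewrite w0 sub0r cabsN ltxx.
have fd z : 0 < cabs z < rho -> cdiff f z.
  move=> /rhoY Yz; have [i iz] := chart_of ha Wd (YW z Yz).
  have near_i : \forall w \near (z : Co), s i w 0 0 / \det (vmx v i w) = f w.
    apply: filterS (filterI (Yo z Yz) (copenP (domo i) iz)) => w [Yw iw].
    by rewrite (fE w i Yw iw).
  apply: cdiff_near near_i _; apply: cdiffM.
    have [sh _] := sY; exact: (proj1 (cdiffP _ _) (sh i 0 z (conj Yz iz))).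
  apply: cdiffV; first exact: W0'.
  by apply: (@cdiff_det R r (vmx v i) z) => k l; exact: vmx_cdiff vS Yz iz.
have fK z : 0 < cabs z < rho -> cabs z * cabs (f z) ^+ 2 <= K ^+ 2.
  move=> zP; have Yz := rhoY z zP; have [i iz] := chart_of ha Wd (YW z Yz).
  have /andP[z0] := zP; rewrite !lt_min => /andP[/andP[zd1 zd2] _].
  have zn0 : z != 0 by rewrite -cabs_gt0.
  have zd1' : 0 < cabs z < d1 by rewrite z0.
  have [_ g0 gz] := d1P z zd1'.
  have sE : s i z 0 0 = f z * \det (vmx v i z) by rewrite (fE z i Yz iz) divfK// W0'.
  have := d2P z zn0; rewrite subr0 => /(_ zd2).
  rewrite /= (det_hnorm_wedge ha sY vS Yz iz sE) powR_ln_cabs// sqrt_expR_ln//.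
  set l := - ln (cabs z) in gz *; set q := ln _ / 2 in gz *; move=> H.
  have zE : cabs z = expR (- l) by rewrite opprK lnK.
  have fle : cabs (f z) <= K * expR (1 / 2 * l).
    have : expR (gamma h v * l - 1 / 4 * l) <= expR q.
      by rewrite ler_expR; move: gz; rewrite ler_norml; clear; lra.
    move=> /(ler_wpM2l (cabs_ge0 (f z))) h1; have {}H := le_trans h1 H.
    rewrite -(ler_pM2r (expR_gt0 (gamma h v * l - 1 / 4 * l))); apply: le_trans H _.
    rewrite -[leRHS]mulrA -expRD le_eqVlt; apply/orP; left; apply/eqP; congr (K * expR _).
    by field.
  apply: le_trans (_ : expR (- l) * (K * expR (1 / 2 * l)) ^+ 2 <= _).
    rewrite -zE ler_wpM2l ?cabs_ge0// ler_sqr ?nnegrE ?cabs_ge0//.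
    exact: le_trans (cabs_ge0 _) fle.
  rewrite exprMn -expRM_natl mulrCA -expRD.
  have -> : - l + 2 * (1 / 2 * l) = 0 by field.
  by rewrite expR0 mulr1.
have [r0 [g [r00 gd gE]]] := removable rho0 fd fK.
pose r1 : R := Num.min r0 rho.
pose V : set C := [set z | cabs z < r1].
have r10 : 0 < r1 by rewrite lt_min r00.
have Vr z : V z -> cabs z < r0 /\ cabs z < rho by rewrite /V /= lt_min => /andP[].
have Vo : copen V.
  move=> z Vz; apply/nbhsC; exists (r1 - cabs z); first by rewrite subr_gt0.
  move=> w wz; rewrite /V /=; apply: le_lt_trans (_ : cabs (w - z) + cabs z < r1).
    by rewrite -[w in leLHS](subrK z) cabsD.
  by rewrite -ltrBrDr.
have VY z : (V `\ 0) z -> Y z.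
  by move=> [/Vr[_ zr] /eqP z0]; apply: rhoY; rewrite cabs_gt0 z0.
have V0 : V 0 by change (is_true (cabs (0 : C) < r1)); rewrite cabs0.
have VW : V `<=` W `&` U.
  move=> z Vz; have [->|z0] := eqVneq z 0; first by split.
  by have [] : Y z by apply: VY; split=> //; exact/eqP.
exists V; first by split=> // z /VW[].
exists 1, (fun _ => g), (fun _ => v); split.
- by move=> _ z /Vr[zr _]; apply/cdiffP; exact: gd.
- move=> _ l; have [lS lG] := vp l; split=> [|_ e e0]; last exact: lG.
  by apply: section_subset (vS l) => z /VY.
- move=> i z Vz iz; have Yz := VY z Vz; have [Vz1 /eqP z0] := Vz; have [zr0 _] := Vr z Vz1.
  have zr : 0 < cabs z < r0 by rewrite cabs_gt0 z0.
  rewrite /lincomb big_ord1 (gE z zr) (fE z i Yz iz).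
  apply/rowP => k; rewrite ord1 !mxE eqxx mulr1n divfK//.
  exact: W0' Yz iz.
Qed.

End Main.

Theorem theorem1p10 (R : realType) (r : nat) (E : bundle R r) (h : metric E)
    (Eh_acceptable : acceptable h) :
  acceptable (det_metric h) /\
  forall (a : R) (U : set R[i]) (v : 'I_r -> local_data E),
    local_frame h a U v ->
    forall (W : set R[i]), copen W -> W `<=` disc ->
    forall s : local_data (det_bundle E),
      det_prolong h a W s <-> prolong (det_metric h) (gamma h v) W s.
Proof.
split=> [|a U v vf W Wo Wd s]; first exact: det_acceptable.
split=> [|sp]; first exact: (det_prolong_growth Eh_acceptable vf Wo Wd).
have [sS _] := sp; split=> // p Wp; have [p0|/eqP p0] := eqVneq p 0.
  by rewrite p0 in Wp *; exact: (growth_det_prolong_origin Eh_acceptable vf Wo Wd Wp sp).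
exact: (growth_det_prolong_away a Eh_acceptable Wo sS (conj Wp p0) Wd).
Qed.
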